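(* Let $X=\Delta/G$ be any compact connected pointed hyperbolic Riemann surface, $G$ being the torsion-free co-compact Fuchsian group uniformizing it. The full group of holomorphic self-homeomorphisms of the complex analytic solenoid $H_\infty(X)$ that preserve its base leaf coincides with $\mathrm{ComAut}(X)$, where $\gamma\in\mathrm{ComAut}(X)$ is identified with the self-homeomorphism $H_\infty(\gamma)$ of $H_\infty(X)$.
   Context: $\Delta$ is the unit disc, $\mathrm{Aut}(\Delta)$ its group of holomorphic automorphisms; the base point of $X$ is the image of $0\in\Delta$. $\mathrm{ComAut}(X)=\{g\in\mathrm{Aut}(\Delta): gGg^{-1}\text{ and }G\text{ are commensurable}\}$, where two subgroups are commensurable if their intersection has finite index in both. For a group $F$, $\widehat F$ denotes its profinite completion. The solenoid is $H_\infty(X)=\Delta\times_G\widehat G$, the quotient of $\Delta\times\widehat G$ by the action $g\cdot(z,\hat\gamma)=(gz,g\hat\gamma)$ of $G$ (here $G\subset\widehat G$). Its path components, called leaves, are the images of the slices $\Delta\times\{\hat\gamma\}$, and each slice maps bijectively onto its leaf; the base leaf is the image of $\Delta\times\{1\}$, identified with $\Delta$ by $z\mapsto[(z,1)]$. Each leaf has the complex structure coming from $\Delta$. A self-homeomorphism of $H_\infty(X)$ (with the quotient topology) is holomorphic if it is holomorphic on each leaf. For a finite index subgroup $H\subset G$, let $\hat i:\widehat H\to\widehat G$ be induced by the inclusion and let $Q_H:\Delta\times_H\widehat H\to\Delta\times_G\widehat G$ be the homeomorphism induced by $\mathrm{Id}\times\hat i$. For $\gamma\in\mathrm{ComAut}(X)$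 put $H=G\cap\gamma^{-1}G\gamma$ and $K=G\cap\gamma G\gamma^{-1}=\gamma H\gamma^{-1}$, both of finite index in $G$, and let $\widehat{C_\gamma}:\widehat H\to\widehat K$ be induced by $h\mapsto\gamma h\gamma^{-1}$. Then $H_\infty(\gamma)=Q_K\circ\Psi\circ Q_H^{-1}$, where $\Psi:\Delta\times_H\widehat H\to\Delta\times_K\widehat K$ is $\Psi([(z,\hat h)])=[(\gamma(z),\widehat{C_\gamma}(\hat h))]$. On the base leaf $\Delta$, $H_\infty(\gamma)$ restricts to $\gamma$. *)

(* Defs.v *)
From HB Require Import structures.
From mathcomp Require Import all_boot all_order all_algebra complex.
From mathcomp Require Import all_classical all_reals all_analysis.

Set Implicit Arguments.
Unset Strict Implicit.
Unset Printing Implicit Defensive.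

Import Order.TTheory GRing.Theory Num.Theory numFieldNormedType.Exports.

Local Open Scope classical_set_scope.
Local Open Scope quotient_scope.

Section Subgroups.
Local Open Scope group_scope.
Variable gT : groupType.

(* [groupClosed gT] lives in too large a universe to index a product topology,
   as is needed for the profinite completion. *)
Record subgroup := Subgroup {
  sg_set :> set gT;
  sg1 : sg_set 1;
  sgM : forall x y, sg_set x -> sg_set y -> sg_set (x * y);
  sgV : forall x, sg_set x -> sg_set x^-1 }.

Implicit Types (A B : subgroup) (x y g : gT).

Definition subg_of A : Type := set_type A.
HB.instance Definition _ A := SubChoice.on (subg_of A).
Fact subg_of_closed A : group_closed (fun x : gT => x \in (A : set gT)).
Proof.
split; first exact/mem_set/sg1.
by move=> x y /set_mem Ax /set_mem Ay; apply/mem_set/sgM/sgV.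
Qed.
HB.instance Definition _ A :=
  SubChoice_isSubGroup.Build gT _ (subg_of A) (subg_of_closed A).

Definition subgI A B : subgroup.
Proof.
exists (A `&` B); first by split; exact: sg1.
- by move=> x y [Ax Bx] [Ay By]; split; exact: sgM.
- by move=> x [Ax Bx]; split; exact: sgV.
Defined.

Fact subgIl A B : subgI A B `<=` A.
Proof. exact: subIsetl. Qed.

(* The subgroup g A g^-1; beware that [x ^ g] is g^-1 * x * g. *)
Definition subgJ g A : subgroup.
Proof.
exists [set x | sg_set A (x ^ g)] => /=; first by rewrite conj1g; exact: sg1.
- by move=> x y Ax Ay; rewrite conjMg; exact: sgM.
- by move=> x Ax; rewrite conjVg; exact: sgV.
Defined.

Definition lcoset x (B : set gT) : set gT := [set y | B (x^-1 * y)].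

(* Meant for B a subgroup of A. *)
Definition finite_index (B A : set gT) : Prop :=
  finite_set [set lcoset x B | x in A].

Definition commensurable A B : Prop :=
  finite_index (A `&` B) A /\ finite_index (A `&` B) B.

Definition torsion_free (A : set gT) : Prop :=
  forall x n, A x -> (0 < n)%N -> x ^+ n = 1 -> x = 1.

End Subgroups.

Section ProfiniteCompletion.
Local Open Scope group_scope.

Record fin_normal (F : groupType) := FinNormal {
  fin_normal_sub :> subgroup F;
  fin_normalJ : forall x y : F,
    sg_set fin_normal_sub x -> sg_set fin_normal_sub (x ^ y);
  fin_normal_index : finite_index fin_normal_sub [set: F] }.

HB.instance Definition _ F := gen_eqMixin (fin_normal F).
HB.instance Definition _ F := gen_choiceMixin (fin_normal F).

Section Quotient.
Variables (F : groupType) (N : fin_normal F).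
Implicit Types x y : F.

Definition coset_rel : rel F := fun x y => `[< sg_set N (x^-1 * y) >].
Fact coset_relP : equiv_class_of coset_rel.
Proof.
have sym x y : coset_rel x y -> coset_rel y x.
  by move=> /asboolP Nxy; apply/asboolP; move: (sgV Nxy); rewrite invgM invgK.
split=> [x|x y|y x z]; first by apply/asboolP; rewrite mulVg; exact: sg1.
  by apply/idP/idP; exact: sym.
move=> /asboolP xy /asboolP yz; apply/asboolP.
by move: (sgM xy yz); rewrite -mulgA mulVKg.
Qed.
Canonical coset_equiv := EquivRelPack coset_relP.

Definition quot := {eq_quot coset_rel}.
HB.instance Definition _ := Choice.on quot.
HB.instance Definition _ := EqQuotient.on quot.
Implicit Types u v w : quot.

Definition quot_one : quot := \pi_quot 1.
Definition quot_mul u v : quot := \pi_quot (repr u * repr v).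
Definition quot_inv u : quot := \pi_quot (repr u)^-1.

Fact quot_eqP x y : \pi_quot x = \pi_quot y <-> sg_set N (x^-1 * y).
Proof. by split=> [/eqquotP/asboolP|Nxy]; [|apply/eqquotP/asboolP]. Qed.

Fact quot_mulE x y : quot_mul (\pi_quot x) (\pi_quot y) = \pi_quot (x * y).
Proof.
rewrite /quot_mul; case: piP => x' /quot_eqP xx'; case: piP => y' /quot_eqP yy'.
apply/esym/quot_eqP.
have -> : (x * y)^-1 * (x' * y') = (x^-1 * x') ^ y * (y^-1 * y').
  by rewrite conjgE invgM -!mulgA mulVKg.
exact: sgM (fin_normalJ _ xx') yy'.
Qed.

Fact quot_invE x : quot_inv (\pi_quot x) = \pi_quot x^-1.
Proof.
rewrite /quot_inv; case: piP => x' /quot_eqP xx'; apply/quot_eqP.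
have -> : x'^-1^-1 * x^-1 = (x^-1 * x') ^ (x^-1).
  by rewrite conjgE !invgK -!mulgA mulVKg.
exact: fin_normalJ.
Qed.

Fact quot_mulA : associative quot_mul.
Proof.
elim/quotW => x; elim/quotW => y; elim/quotW => z.
by rewrite (quot_mulE y z) (quot_mulE x y) !quot_mulE mulgA.
Qed.
Fact quot_mul1g : left_id quot_one quot_mul.
Proof. by elim/quotW => x; rewrite quot_mulE mul1g. Qed.
Fact quot_mulg1 : right_id quot_one quot_mul.
Proof. by elim/quotW => x; rewrite quot_mulE mulg1. Qed.
Fact quot_mulVg : left_inverse quot_one quot_inv quot_mul.
Proof. by elim/quotW => x; rewrite quot_invE quot_mulE mulVg. Qed.
Fact quot_mulgV : right_inverse quot_one quot_inv quot_mul.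
Proof. by elim/quotW => x; rewrite quot_invE quot_mulE mulgV. Qed.
HB.instance Definition _ := isGroup.Build quot
  quot_mulA quot_mul1g quot_mulg1 quot_mulVg quot_mulgV.

Fact piM x y : \pi_quot (x * y) = \pi_quot x * \pi_quot y.
Proof. by rewrite -quot_mulE. Qed.
Fact piV x : \pi_quot x^-1 = (\pi_quot x)^-1.
Proof. by rewrite -quot_invE. Qed.

End Quotient.

Section Completion.
Variable F : groupType.

Definition quot_prod :=
  prod_topology (fun N : fin_normal F => discrete_topology (quot N)).
HB.instance Definition _ := Topological.on quot_prod.

(* The transition map F / M -> F / N is x M |-> x N. *)
Definition coherent : set quot_prod :=
  [set u | forall M N : fin_normal F, M `<=` N ->
     \pi_(quot N) (repr (u M : quot M)) = u N].

Definition profinite : Type := set_type coherent.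
HB.instance Definition _ := Topological.on profinite.

Fact profinite_eq (u v : profinite) :
  (forall N, set_val u N = set_val v N) -> u = v.
Proof. by move=> uv; apply/val_inj/functional_extensionality_dep. Qed.

Fact pi_repr_mul (M N : fin_normal F) (a b : quot M) : M `<=` N ->
  \pi_(quot N) (repr (a * b)) = \pi_(quot N) (repr a) * \pi_(quot N) (repr b).
Proof.
move=> MN; rewrite -piM; apply/quot_eqP/MN/quot_eqP.
by rewrite piM !reprK.
Qed.
Fact pi_repr_inv (M N : fin_normal F) (a : quot M) : M `<=` N ->
  \pi_(quot N) (repr a^-1) = (\pi_(quot N) (repr a))^-1.
Proof.
move=> MN; rewrite -piV; apply/quot_eqP/MN/quot_eqP.
by rewrite piV !reprK.
Qed.

Fact coherent_pi (x : F) : coherent (fun N => \pi_(quot N) x).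
Proof. by move=> M N MN; apply/quot_eqP/MN/quot_eqP; rewrite reprK. Qed.

Definition to_profinite (x : F) : profinite := SigSub (mem_set (coherent_pi x)).

Fact coherent_mul (u v : profinite) :
  coherent (fun N => (set_val u N : quot N) * (set_val v N : quot N)).
Proof.
move=> M N MN; rewrite pi_repr_mul//.
by rewrite (set_valP u _ _ MN) (set_valP v _ _ MN).
Qed.
Definition profinite_mul (u v : profinite) : profinite :=
  SigSub (mem_set (coherent_mul u v)).

Fact coherent_inv (u : profinite) :
  coherent (fun N => (set_val u N : quot N)^-1).
Proof. by move=> M N MN; rewrite pi_repr_inv// (set_valP u _ _ MN). Qed.
Definition profinite_inv (u : profinite) : profinite :=
  SigSub (mem_set (coherent_inv u)).

Fact profinite_mulA : associative profinite_mul.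
Proof. by move=> u v w; apply: profinite_eq => N; apply: mulgA. Qed.
Fact profinite_mul1g : left_id (to_profinite 1) profinite_mul.
Proof. by move=> u; apply: profinite_eq => N; apply: mul1g. Qed.
Fact profinite_mulg1 : right_id (to_profinite 1) profinite_mul.
Proof. by move=> u; apply: profinite_eq => N; apply: mulg1. Qed.
Fact profinite_mulVg : left_inverse (to_profinite 1) profinite_inv profinite_mul.
Proof. by move=> u; apply: profinite_eq => N; apply: mulVg. Qed.
Fact profinite_mulgV : right_inverse (to_profinite 1) profinite_inv profinite_mul.
Proof. by move=> u; apply: profinite_eq => N; apply: mulgV. Qed.
HB.instance Definition _ := isGroup.Build profinite
  profinite_mulA profinite_mul1g profinite_mulg1 profinite_mulVg profinite_mulgV.
HB.instance Definition _ := isPointed.Build profinite 1.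

Fact to_profiniteM (x y : F) :
  to_profinite (x * y) = to_profinite x * to_profinite y.
Proof. by apply: profinite_eq => N; apply: piM. Qed.

End Completion.

Section Functoriality.
Variables (F E : groupType) (phi : {multiplicative F -> E}).

Fact multiplicative1 : phi 1 = 1.
Proof. by apply: (mulgI (phi 1)); rewrite -gmulfM !mulg1. Qed.
Fact multiplicativeV x : phi x^-1 = (phi x)^-1.
Proof. by apply: (mulgI (phi x)); rewrite -gmulfM !mulgV multiplicative1. Qed.

Definition preim_sub (M : subgroup E) : subgroup F.
Proof.
exists (phi @^-1` M) => /=; first by rewrite multiplicative1; exact: sg1.
- by move=> x y Mx My; rewrite gmulfM; exact: sgM.
- by move=> x Mx; rewrite multiplicativeV; exact: sgV.
Defined.

Variable M : fin_normal E.
Fact preim_normalJ x y : sg_set (preim_sub M) x -> sg_set (preim_sub M) (x ^ y).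
Proof.
by rewrite /= conjgE !gmulfM multiplicativeV -conjgE; exact: fin_normalJ.
Qed.
Fact preim_index : finite_index (preim_sub M) [set: F].
Proof.
apply: sub_finite_set (finite_image (preimage phi) (fin_normal_index M)).
move=> _ [x _ <-]; exists (lcoset (phi x) M); first by exists (phi x).
by apply/seteqP; split=> y; rewrite /lcoset/= gmulfM multiplicativeV.
Qed.
Definition preim_normal : fin_normal F := FinNormal preim_normalJ preim_index.
End Functoriality.

Section FunctorialityMap.
Variables (F E : groupType) (phi : {multiplicative F -> E}).

Fact quot_map_pi (M : fin_normal E) x :
  \pi_(quot M) (phi (repr (\pi_(quot (preim_normal phi M)) x))) =
  \pi_(quot M) (phi x).
Proof.
case: piP => y /quot_eqP /=; rewrite gmulfM multiplicativeV => ?.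
by apply/esym/quot_eqP.
Qed.

Fact quot_map_mul (M : fin_normal E) (a b : quot (preim_normal phi M)) :
  \pi_(quot M) (phi (repr (a * b))) =
  \pi_(quot M) (phi (repr a)) * \pi_(quot M) (phi (repr b)).
Proof.
elim/quotW: a => x; elim/quotW: b => y.
by rewrite -piM !quot_map_pi gmulfM piM.
Qed.

Fact coherent_map (u : profinite F) :
  coherent (fun M : fin_normal E =>
    \pi_(quot M) (phi (repr (set_val u (preim_normal phi M) : quot _)))).
Proof.
move=> M N MN.
have sMN : preim_normal phi M `<=` preim_normal phi N.
  by move=> x; apply: MN.
have uMN : \pi_(quot (preim_normal phi N))
    (repr (set_val u (preim_normal phi M) : quot (preim_normal phi M))) =
    set_val u (preim_normal phi N) := set_valP u _ _ sMN.
rewrite [RHS](congr1 (fun a : quot _ => \pi_(quot N) (phi (repr a))) (esym uMN)).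
rewrite quot_map_pi.
by apply/quot_eqP/MN/quot_eqP; rewrite reprK.
Qed.

(* The component at M of the image of u is the image of the component of u at
   phi^-1(M) under the map F / phi^-1(M) -> E / M induced by phi. *)
Definition profinite_map (u : profinite F) : profinite E :=
  SigSub (mem_set (coherent_map u)).

Fact profinite_map_to x : profinite_map (to_profinite x) = to_profinite (phi x).
Proof. by apply: profinite_eq => M; apply: quot_map_pi. Qed.
Fact profinite_mapM u v :
  profinite_map (u * v) = profinite_map u * profinite_map v.
Proof.
by apply: profinite_eq => M; apply: quot_map_mul.
Qed.
End FunctorialityMap.

End ProfiniteCompletion.

Section OrbitSpaces.
Local Open Scope group_scope.

Record action (F : groupType) (T : Type) := Action {
  act :> F -> T -> T;
  act1 : forall x, act 1 x = x;
  actM : forall g h x, act (g * h) x = act g (act h x) }.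

Section OrbitSpace.
Variables (F : groupType) (T : topologicalType) (to : action F T).

Definition orbit_rel : rel T := fun x y => `[< exists g, y = to g x >].
Fact orbit_relP : equiv_class_of orbit_rel.
Proof.
have sym x y : orbit_rel x y -> orbit_rel y x.
  move=> /asboolP[g ->]; apply/asboolP; exists g^-1.
  by rewrite -actM mulVg act1.
split=> [x|x y|y x z]; first by apply/asboolP; exists 1; rewrite act1.
  by apply/idP/idP; exact: sym.
move=> /asboolP[g ->] /asboolP[h ->]; apply/asboolP.
by exists (h * g); rewrite actM.
Qed.
Canonical orbit_equiv := EquivRelPack orbit_relP.

Definition orbit_space : Type := quotient_topology {eq_quot orbit_rel}.
HB.instance Definition _ := Topological.on orbit_space.
HB.instance Definition _ := Quotient.on orbit_space.

Definition orbit_of (x : T) : orbit_space := \pi_orbit_space x.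

Fact orbit_ofP x y : orbit_of x = orbit_of y <-> exists g, y = to g x.
Proof. by split=> [/eqquotP/asboolP|xy]; [|apply/eqquotP/asboolP]. Qed.
End OrbitSpace.
Arguments orbit_of {F T} to x.

Definition orbit_map (F E : groupType) (T U : topologicalType)
    (to : action F T) (tu : action E U) (f : T -> U) :
    orbit_space to -> orbit_space tu :=
  fun p => orbit_of tu (f (repr p)).

Arguments orbit_map {F E T U} to tu f p.

Fact orbit_mapE (F E : groupType) (T U : topologicalType)
    (to : action F T) (tu : action E U) (f : T -> U) :
  (forall g x, exists h, f (to g x) = tu h (f x)) ->
  forall x, orbit_map to tu f (orbit_of to x) = orbit_of tu (f x).
Proof.
move=> ftu x; rewrite /orbit_map /orbit_of; case: piP => y /orbit_ofP[g ->].
by apply/esym/orbit_ofP/ftu.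
Qed.

End OrbitSpaces.
Arguments orbit_of {F T} to x.
Arguments orbit_map {F E T U} to tu f p.

Section Disc.
Variable R : realType.
Local Open Scope ring_scope.
Local Notation C := (R[i]^o).

Definition disc : Type := set_type [set z : C | `|z| < 1].
HB.instance Definition _ := Topological.on disc.
HB.instance Definition _ := SubChoice.on disc.

Fact disc0 : [set z : C | `|z| < 1] 0.
Proof. by rewrite /= normr0 ltr01. Qed.
Definition disc_zero : disc := SigSub (mem_set disc0).
HB.instance Definition _ := isPointed.Build disc disc_zero.

(* The extension by 0 is harmless: the disc is open. *)
Definition disc_ext (f : disc -> disc) (w : C) : C :=
  if insub w is Some z then \val (f z) else 0.

Definition holomorphic (f : disc -> disc) : Prop :=
  forall z : disc, derivable (disc_ext f) (\val z) 1.

Definition biholomorphic (f : disc -> disc) : Prop :=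
  holomorphic f /\
  exists g : disc -> disc, [/\ holomorphic g, cancel f g & cancel g f].

Definition Aut : Type :=
  set_type [set f : {compact-open, disc -> disc} | biholomorphic f].
HB.instance Definition _ := Topological.on Aut.
HB.instance Definition _ := SubChoice.on Aut.
Definition aut_fun (g : Aut) : disc -> disc := \val g.
Coercion aut_fun : Aut >-> Funclass.

Fact aut_eq (g h : Aut) : g =1 h -> g = h.
Proof. by move=> gh; apply/val_inj/funext. Qed.

Fact near_disc (z : disc) : \forall w \near (\val z : C), exists u : disc, w = \val u.
Proof.
apply/nbhs_normP; exists (1 - `|\val z : C|).
  by rewrite /= subr_gt0; exact: set_valP z.
move=> w /= zw; suff w1 : [set w : C | `|w| < 1] w.
  by exists (SigSub (mem_set w1)).
rewrite /= -(subrK (\val z : C) w).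
by rewrite (le_lt_trans (ler_normD _ _))// -ltrBrDr distrC.
Qed.

Fact disc_extE (f : disc -> disc) (z : disc) : disc_ext f (\val z) = \val (f z).
Proof. by rewrite /disc_ext valK. Qed.

Fact holomorphic_id : holomorphic idfun.
Proof.
move=> z; apply: (@near_eq_derivable _ _ _ id); last exact: derivable_id.
near=> w; have [u ->] : exists u : disc, w = \val u by near: w; exact: near_disc.
by rewrite disc_extE.
Unshelve. all: by end_near. Qed.

Fact holomorphic_comp (f g : disc -> disc) :
  holomorphic f -> holomorphic g -> holomorphic (f \o g).
Proof.
move=> fh gh z; apply: (@near_eq_derivable _ _ _ (disc_ext f \o disc_ext g)).
  near=> w; have [u ->] : exists u : disc, w = \val u by near: w; exact: near_disc.
  by rewrite /= !disc_extE.
apply/derivable1_diffP/differentiable_comp; first exact/derivable1_diffP/gh.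
by rewrite disc_extE; apply/derivable1_diffP/fh.
Unshelve. all: by end_near. Qed.

Fact biholomorphic_id : biholomorphic idfun.
Proof.
by split; [|exists idfun; split=> //]; exact: holomorphic_id.
Qed.

Fact biholomorphic_comp (f g : disc -> disc) :
  biholomorphic f -> biholomorphic g -> biholomorphic (f \o g).
Proof.
move=> [fh [f' [f'h fK f'K]]] [gh [g' [g'h gK g'K]]].
split; first exact: holomorphic_comp.
exists (g' \o f'); split; first exact: holomorphic_comp.
- exact: can_comp fK gK.
- exact: can_comp g'K f'K.
Qed.

Fact aut_biholomorphic (f : Aut) : biholomorphic f.
Proof. exact: set_valP f. Qed.

Definition to_aut (f : disc -> disc) (fb : biholomorphic f) : Aut :=
  SigSub (mem_set (fb : [set f : {compact-open, disc -> disc} | biholomorphic f] f)).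

Fact biholomorphic_inv (f : Aut) :
  exists g : Aut, cancel f g /\ cancel g f.
Proof.
have [fh [f' [f'h fK f'K]]] := aut_biholomorphic f.
have bf' : biholomorphic f' by split => //; exists f.
by exists (to_aut bf').
Qed.

Definition aut_one : Aut := to_aut biholomorphic_id.
Definition aut_mul (f g : Aut) : Aut :=
  to_aut (biholomorphic_comp (aut_biholomorphic f) (aut_biholomorphic g)).
Definition aut_inv (f : Aut) : Aut := sval (cid (biholomorphic_inv f)).

Fact aut_mulA : associative aut_mul.
Proof. by move=> f g h; apply: aut_eq. Qed.
Fact aut_mul1g : left_id aut_one aut_mul.
Proof. by move=> f; apply: aut_eq. Qed.
Fact aut_mulg1 : right_id aut_one aut_mul.
Proof. by move=> f; apply: aut_eq. Qed.
Fact aut_mulVg : left_inverse aut_one aut_inv aut_mul.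
Proof.
by move=> f; apply: aut_eq; rewrite /aut_inv; case: cid => g [fg gf] z; apply: fg.
Qed.
Fact aut_mulgV : right_inverse aut_one aut_inv aut_mul.
Proof.
by move=> f; apply: aut_eq; rewrite /aut_inv; case: cid => g [fg gf] z; apply: gf.
Qed.
HB.instance Definition _ := isGroup.Build Aut
  aut_mulA aut_mul1g aut_mulg1 aut_mulVg aut_mulgV.

(* G is discrete for the compact-open topology. *)
Definition fuchsian (G : subgroup Aut) : Prop :=
  forall g : Aut, sg_set G g -> isolated G g.

Definition disc_action (G : subgroup Aut) : action (subg_of G) disc.
Proof. by exists (fun (g : subg_of G) z => (\val g : Aut) z). Defined.

Definition cocompact (G : subgroup Aut) : Prop :=
  compact [set: orbit_space (disc_action G)].

Definition ComAut (G : subgroup Aut) : set Aut :=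
  [set g | commensurable (subgJ g G) G].

End Disc.

Section Solenoid.
Variable R : realType.
Local Open Scope group_scope.
Local Notation disc := (disc R).
Local Notation Aut := (Aut R).
Implicit Types (G H K : subgroup Aut) (g : Aut).

Definition hat G : Type := profinite (subg_of G).
HB.instance Definition _ G := Topological.on (hat G).
HB.instance Definition _ G := Group.on (hat G).
HB.instance Definition _ G := Pointed.on (hat G).

Definition solenoid_action G : action (subg_of G) (disc * hat G)%type.
Proof.
exists (fun (g : subg_of G) p => ((\val g : Aut) p.1, to_profinite g * p.2)).
- by case=> z u /=; rewrite mul1g.
- by move=> g h [z u] /=; rewrite to_profiniteM mulgA.
Defined.

Definition solenoid G : Type := orbit_space (solenoid_action G).
HB.instance Definition _ G := Topological.on (solenoid G).

Definition slice G (u : hat G) (z : disc) : solenoid G :=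
  orbit_of (solenoid_action G) (z, u).

HB.instance Definition _ G := isPointed.Build (solenoid G) (slice 1 (disc_zero R)).

Definition base_leaf G : set (solenoid G) := range (slice (1 : hat G)).
Arguments base_leaf G _ : clear implicits.

Definition homeomorphism (T U : topologicalType) (F : T -> U) : Prop :=
  continuous F /\
  exists F' : U -> T, [/\ continuous F', cancel F F' & cancel F' F].

(* The leaves are the images of the slices, with z as coordinate. Being the path
   components, they are permuted by homeomorphisms, so that asking for v is no
   restriction on these. *)
Definition leafwise_holomorphic G (F : solenoid G -> solenoid G) : Prop :=
  forall u : hat G, exists (v : hat G) (f : disc -> disc),
    holomorphic f /\ forall z, F (slice u z) = slice v (f z).

Definition hol_homeo_base G : set (solenoid G -> solenoid G) :=
  [set F | [/\ homeomorphism F, leafwise_holomorphic F &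
     F @` base_leaf G = base_leaf G]].

Definition incl H G (HG : H `<=` G) (h : subg_of H) : subg_of G :=
  SigSub (mem_set (HG _ (set_valP h))).
Fact inclM H G (HG : H `<=` G) : {morph incl HG : x y / x * y}.
Proof. by move=> x y; apply/val_inj. Qed.
HB.instance Definition _ H G (HG : H `<=` G) :=
  isMultiplicative.Build _ _ (incl HG) (inclM HG).

Definition Q_map H G (HG : H `<=` G) : solenoid H -> solenoid G :=
  orbit_map (solenoid_action H) (solenoid_action G)
    (fun p => (p.1, profinite_map (incl HG) p.2)).

Fact Q_mapE H G (HG : H `<=` G) u z :
  Q_map HG (slice u z) = slice (profinite_map (incl HG) u) z.
Proof.
apply: orbit_mapE => h [w v]; exists (incl HG h) => /=.
by rewrite profinite_mapM profinite_map_to.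
Qed.

Definition conj_hom g H K (HK : forall h, sg_set H h -> sg_set K (h ^ g^-1))
    (h : subg_of H) : subg_of K := SigSub (mem_set (HK _ (set_valP h))).
Fact conj_homM g H K (HK : forall h, sg_set H h -> sg_set K (h ^ g^-1)) :
  {morph conj_hom HK : x y / x * y}.
Proof. by move=> x y; apply/val_inj; apply: conjMg. Qed.
HB.instance Definition _ g H K HK :=
  isMultiplicative.Build _ _ (@conj_hom g H K HK) (conj_homM HK).

Section Hinfty.
Variables (G : subgroup Aut) (g : Aut).
Let H := subgI G (subgJ g^-1 G).
Let K := subgI G (subgJ g G).

Fact Hinfty_conj h : sg_set H h -> sg_set K (h ^ g^-1).
Proof. by move=> [Gh Gh']; split=> //=; rewrite -conjgM mulVg conjg1. Qed.

Definition Psi : solenoid H -> solenoid K :=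
  orbit_map (solenoid_action H) (solenoid_action K)
    (fun p => (g p.1, profinite_map (conj_hom Hinfty_conj) p.2)).

Fact PsiE u z :
  Psi (slice u z) = slice (profinite_map (conj_hom Hinfty_conj) u) (g z).
Proof.
apply: orbit_mapE => h [w v]; exists (conj_hom Hinfty_conj h) => /=.
rewrite profinite_mapM profinite_map_to; congr (_, _).
suff gh : (\val h : Aut) ^ g^-1 * g = g * (\val h : Aut).
  exact: (congr1 (fun k : Aut => k w) (esym gh)).
by rewrite conjgE invgK -!mulgA mulVg mulg1.
Qed.

(* For g in ComAut G both Q_map are homeomorphisms, so that pinv is the actual
   inverse. *)
Definition Hinfty : solenoid G -> solenoid G :=
  Q_map (@subgIl _ G (subgJ g G)) \o Psi \o
  pinv setT (Q_map (@subgIl _ G (subgJ g^-1 G))).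
End Hinfty.
End Solenoid.
Arguments Hinfty {R} G g _.
Arguments ComAut {R} G _.
Arguments base_leaf {R} G _.
Arguments hol_homeo_base {R} G _.

(* Main.v *)
From mathcomp Require Import all_boot all_order all_algebra.
From mathcomp Require Import fieldext galois finfield.
From mathcomp Require Import finmap complex.
Require Import Defs.
From mathcomp Require Import all_classical all_reals all_analysis.
From mathcomp Require Import ring lra.

(** Automorphisms of the disc in the commensurator act on the solenoid because
    the maps Q are homeomorphisms: the solenoids are compact and Hausdorff, and
    the completion of a subgroup of finite index embeds in that of the group,
    which is covered by finitely many translates of it.
    The base leaf is dense, the group being dense in its completion, so that
    continuous maps are determined by their restriction to it
    ([continuous_eq_base]); as H_oo(g) restricts to g, this gives at once
    functoriality and, the base leaf being a faithful copy of the disc,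
    injectivity ([HinftyM], [Hinfty_inj]).  Faithfulness amounts to residual
    finiteness of the group ([fuchsian_residually_finite]), which follows from
    Malcev's theorem: the group is finitely generated and acts linearly on the
    hyperboloid model.

    For surjectivity ([Hinfty_surj]), let F be a holomorphic homeomorphism of
    the solenoid preserving the base leaf, and f its restriction to the disc.
    The inverse of F restricts to an inverse q of f, which is continuous for the
    topology of the disc since the leaf topology can be recovered from that of
    the solenoid ([leaf_continuous]).  So f is injective, holomorphic and proper,
    hence a Möbius transformation: by the Schwarz lemma, obtained from a maximum
    principle and thus from Goursat's theorem, which are proved first.

    It remains to see that f commensurates G.  Since F is uniformly continuous,
    there is a normal subgroup N of finite index such that, for h in N, the
    automorphism f h f^-1 is at small distance from some element of G at each
    point of the disc ([leaf_uniformly_close]).  Now G acts with a positive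
    injectivity radius, so this element does not depend on the point, and
    differs from f h f^-1 by an automorphism of bounded displacement, which is
    trivial ([close_to_group]).  Hence f N f^-1 is contained in G.  The same
    argument for the inverse of F shows that f is in the commensurator, and F
    and H_oo(f) coincide on the base leaf, so everywhere.

    Distances are measured by the pseudo-hyperbolic distance, which is invariant
    under automorphisms. *)

Set Implicit Arguments.
Unset Strict Implicit.
Unset Printing Implicit Defensive.

Import Order.TTheory GRing.Theory Num.Theory numFieldNormedType.Exports.
Import ComplexField.

Local Open Scope classical_set_scope.
Local Open Scope ring_scope.
Local Open Scope complex_scope.

(** * Closed differential forms on rectangles *)

Section Circulation.
Variable R : realType.
Implicit Types (f g : R -> R) (a b c s t : R).
Local Notation mu := (@lebesgue_measure R).

Definition itg f a b : R := \int[mu]_(x in `[a, b]) f x.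

Definition cont_on f a b := forall x, a <= x <= b -> {for x, continuous f}.

Lemma cont_on_itg f a b : cont_on f a b -> mu.-integrable `[a, b] (EFin \o f).
Proof.
move=> fc; apply: continuous_compact_integrable; first exact: segment_compact.
apply: continuous_in_subspaceT => x; rewrite inE /= in_itv /=; exact: fc.
Qed.

Lemma itg_split f a b c : a <= c <= b -> cont_on f a b ->
  itg f a b = itg f a c + itg f c b.
Proof.
move=> /andP[ac cb] fc; have fi := cont_on_itg fc.
have /(_ _ _)/eqP := @Rintegral_itvB _ f (BLeft a) (BRight b) c fi.
rewrite !bnd_simp => /(_ ac cb); rewrite subr_eq addrC /itg => /eqP ->.
congr (_ + _); rewrite Rintegral_itv_obnd_cbnd//.
apply: integrableS fi => //; apply: subset_itv; by rewrite bnd_simp.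
Qed.

Lemma itg_sub_bound f g a b k (eta : R) : a <= b ->
  cont_on f a b -> cont_on g a b ->
  (forall x, a <= x <= b -> `|f x - g x - k| <= eta) ->
  `|itg f a b - itg g a b - k * (b - a)| <= eta * (b - a).
Proof.
move=> ab fc gc fgk.
have cI (r : R) : mu.-integrable `[a, b] (EFin \o cst r).
  by apply: cont_on_itg => x _; exact: cst_continuous.
have cE (r : R) : \int[mu]_(x in `[a, b]) r = r * (b - a).
  rewrite Rintegral_cst//= lebesgue_measure_itv /= lte_fin.
  case: ltP => [_|ba]; rewrite ?EFinN -?EFinB//=.
  by have -> : a = b by [lra]; rewrite subrr.
have fgc : cont_on (fun x => f x - g x) a b.
  by move=> x xab; apply: continuousB; [exact: fc|exact: gc].
have fgkc : cont_on (fun x => f x - g x - k) a b.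
  by move=> x xab; apply: continuousB; [exact: fgc|exact: cst_continuous].
rewrite /itg -(cE k) -RintegralB//; try exact: cont_on_itg.
rewrite -RintegralB//; last 2 first.
- exact: cont_on_itg.
- exact: cI.
have H := le_normr_Rintegral _ (cont_on_itg fgkc).
apply: le_trans (H _) _; first exact: measurable_itv.
rewrite -cE; apply: le_Rintegral => //.
- apply: cont_on_itg => x xab; apply: continuous_comp; first exact: fgkc.
  exact: norm_continuous.
- exact: cI.
Qed.

Lemma itg_le_sub f g a b (k : R) : a <= b -> cont_on f a b -> cont_on g a b ->
  (forall x, a <= x <= b -> f x <= g x - k) ->
  itg f a b <= itg g a b - k * (b - a).
Proof.
move=> ab fc gc fgk.
have gkc : cont_on (fun x => g x - k) a b.
  by move=> x xab; apply: continuousB; [exact: gc|exact: cst_continuous].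
have cc : cont_on (cst 0) a b by move=> x _; exact: cst_continuous.
have H : itg f a b <= itg (fun x => g x - k) a b.
  by rewrite /itg; apply: le_Rintegral => //; exact: cont_on_itg.
have zero : itg (cst 0) a b = 0.
  by rewrite /itg /Rintegral integral0.
apply: le_trans H _.
have kc : cont_on (cst k) a b by move=> x _; exact: cst_continuous.
have := @itg_sub_bound (fun x => g x - k) g a b (- k) 0 ab gkc gc.
rewrite mul0r normr_le0 subr_eq0 subr_eq => H2.
rewrite (eqP (H2 _)) => [|x _]; last by rewrite (_ : _ - _ = 0) ?normr0//; ring.
by rewrite mulNr addrC.
Qed.

(** Fréchet differentiability at (s, t) of a function of two real variables. *)
Definition diff2 (P : R -> R -> R) s t (a b : R) :=
  forall e : R, 0 < e -> exists2 d : R, 0 < d & forall s' t',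
    `|s' - s| < d -> `|t' - t| < d ->
    `|P s' t' - P s t - a * (s' - s) - b * (t' - t)|
       <= e * (`|s' - s| + `|t' - t|).

Lemma diff2_cont1 P s t a b : diff2 P s t a b -> {for s, continuous (P^~ t)}.
Proof.
move=> Pd; apply/cvgrPdist_le => e e0.
have [d d0 Pd'] := Pd 1 ltr01.
have a0 : 0 < 1 + `|a| by rewrite ltr_pwDl.
apply/nbhs_ballP; exists (Num.min d (e / (1 + `|a|))).
  by rewrite /= lt_min d0 divr_gt0.
move=> s'; rewrite /ball/= distrC lt_min => /andP[sd]; rewrite ltr_pdivlMr// => se.
have := Pd' s' t sd; rewrite subrr normr0 mulr0 addr0 subr0 mul1r => /(_ d0) H1.
rewrite distrC; apply: le_trans (ltW se).
have -> : P s' t - P s t = (P s' t - P s t - a * (s' - s)) + a * (s' - s) by ring.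
rewrite [leRHS]mulrDr mulr1 [X in _ <= _ + X]mulrC -normrM.
by apply: le_trans (ler_normD _ _) _; rewrite lerD2r.
Qed.

Lemma diff2_cont2 P s t a b : diff2 P s t a b -> {for t, continuous (P s)}.
Proof.
move=> Pd; apply: (@diff2_cont1 (fun x y => P y x) t s b a) => e e0.
have [d d0 Pd'] := Pd e e0; exists d => // t' s' tt' ss'.
rewrite [X in e * X]addrC; have := Pd' _ _ ss' tt'.
by rewrite -!addrA [- (a * _) + _]addrC !addrA.
Qed.

Variables (P Q : R -> R -> R).

(** The integral of P ds + Q dt along the boundary of [s0, s1] x [t0, t1]. *)
Definition circulation s0 s1 t0 t1 : R :=
  itg (P^~ t0) s0 s1 + itg (Q s1) t0 t1 - itg (P^~ t1) s0 s1 - itg (Q s0) t0 t1.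

(** That the derivative of P in t and that of Q in s are the same b says that
    the form P ds + Q dt is closed. *)
Definition closed_at s t := exists a b c, diff2 P s t a b /\ diff2 Q s t b c.

Lemma closed_at_cont s t : closed_at s t ->
  {for s, continuous (P^~ t)} /\ {for t, continuous (Q s)}.
Proof. by move=> [a [b [c [/diff2_cont1 Pc /diff2_cont2 Qc]]]]. Qed.

Definition closed_on s0 s1 t0 t1 :=
  forall s t, s0 <= s <= s1 -> t0 <= t <= t1 -> closed_at s t.

Lemma closed_onP s0 s1 t0 t1 : closed_on s0 s1 t0 t1 ->
  (forall t, t0 <= t <= t1 -> cont_on (P^~ t) s0 s1) /\
  (forall s, s0 <= s <= s1 -> cont_on (Q s) t0 t1).
Proof.
by move=> cl; split=> [t tI s sI|s sI t tI];
  have [] := closed_at_cont (cl s t sI tI).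
Qed.

Lemma closed_on_sub s0 s1 t0 t1 s0' s1' t0' t1' :
  s0 <= s0' -> s1' <= s1 -> t0 <= t0' -> t1' <= t1 ->
  closed_on s0 s1 t0 t1 -> closed_on s0' s1' t0' t1'.
Proof.
move=> ? ? ? ? cl s t /andP[? ?] /andP[? ?]; apply: cl; apply/andP; split; lra.
Qed.

Lemma circulation_quarters s0 s1 t0 t1 sm tm : closed_on s0 s1 t0 t1 ->
  s0 <= sm <= s1 -> t0 <= tm <= t1 ->
  circulation s0 s1 t0 t1 =
    circulation s0 sm t0 tm + circulation sm s1 t0 tm +
    circulation s0 sm tm t1 + circulation sm s1 tm t1.
Proof.
move=> cl sI tI; have [cP cQ] := closed_onP cl; rewrite /circulation.
rewrite (itg_split sI (cP t0 _)); last by apply/andP; split; lra.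
rewrite (itg_split sI (cP t1 _)); last by apply/andP; split; lra.
rewrite (itg_split tI (cQ s0 _)); last by apply/andP; split; lra.
rewrite (itg_split tI (cQ s1 _)); last by apply/andP; split; lra.
by ring.
Qed.

(** To first order P and Q are affine, and the circulation of a closed affine
    form vanishes: only the error terms of differentiability remain. *)
Lemma circulation_small s t : closed_at s t ->
  forall e, 0 < e -> exists2 d, 0 < d & forall s0 t0 l m,
    0 < l < d -> 0 < m < d -> s0 <= s <= s0 + l -> t0 <= t <= t0 + m ->
    closed_on s0 (s0 + l) t0 (t0 + m) ->
    `|circulation s0 (s0 + l) t0 (t0 + m)| <= e * (l + m) ^+ 2.
Proof.
move=> [a [b [c [Pd Qd]]]] e e0; have e20 : 0 < e / 2 by rewrite divr_gt0.
have [d1 d10 {}Pd] := Pd _ e20; have [d2 d20 {}Qd] := Qd _ e20.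
exists (Num.min d1 d2); first by rewrite lt_min d10.
move=> s0 t0 l m /andP[l0]; rewrite lt_min => /andP[ld1 ld2] /andP[m0].
rewrite lt_min => /andP[md1 md2] sI tI cl; have [cP cQ] := closed_onP cl.
have nrm (x y h : R) : y <= x <= y + h -> forall z, y <= z <= y + h -> `|z - x| <= h.
  by move=> /andP[? ?] z /andP[? ?]; rewrite ler_norml; apply/andP; split; lra.
have PI : `|itg (P^~ t0) s0 (s0 + l) - itg (P^~ (t0 + m)) s0 (s0 + l)
    - (- b * m) * (s0 + l - s0)| <= (e * (l + m)) * (s0 + l - s0).
  apply: itg_sub_bound; [lra| apply: cP; lra| apply: cP; lra|].
  move=> x xI.
  have xs := nrm _ _ _ sI _ xI.
  have t0t : `|t0 - t| <= m by apply: nrm tI _ _; lra.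
  have t1t : `|t0 + m - t| <= m by apply: nrm tI _ _; lra.
  have /= H1 := Pd x t0 (le_lt_trans xs ld1) (le_lt_trans t0t md1).
  have /= H2 := Pd x (t0 + m) (le_lt_trans xs ld1) (le_lt_trans t1t md1).
  have -> : P x t0 - P x (t0 + m) - - b * m =
    (P x t0 - P s t - a * (x - s) - b * (t0 - t)) -
    (P x (t0 + m) - P s t - a * (x - s) - b * (t0 + m - t)) by ring.
  apply: le_trans (ler_normB _ _) _.
  apply: le_trans (lerD H1 H2) _.
  by rewrite -mulrDr; rewrite mulrAC ler_pdivrMr// -mulrA ler_pM2l//; lra.
have QI : `|itg (Q (s0 + l)) t0 (t0 + m) - itg (Q s0) t0 (t0 + m)
    - (b * l) * (t0 + m - t0)| <= (e * (l + m)) * (t0 + m - t0).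
  apply: itg_sub_bound; [lra| apply: cQ; lra| apply: cQ; lra|].
  move=> x xI.
  have xs := nrm _ _ _ tI _ xI.
  have t0t : `|s0 - s| <= l by apply: nrm sI _ _; lra.
  have t1t : `|s0 + l - s| <= l by apply: nrm sI _ _; lra.
  have /= H1 := Qd s0 x (le_lt_trans t0t ld2) (le_lt_trans xs md2).
  have /= H2 := Qd (s0 + l) x (le_lt_trans t1t ld2) (le_lt_trans xs md2).
  have -> : Q (s0 + l) x - Q s0 x - b * l =
    (Q (s0 + l) x - Q s t - b * (s0 + l - s) - c * (x - t)) -
    (Q s0 x - Q s t - b * (s0 - s) - c * (x - t)) by ring.
  apply: le_trans (ler_normB _ _) _.
  apply: le_trans (lerD H2 H1) _.
  by rewrite -mulrDr; rewrite mulrAC ler_pdivrMr// -mulrA ler_pM2l//; lra.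
rewrite /circulation; move: PI QI.
set p1 := itg _ _ _; set p2 := itg _ _ _; set q1 := itg _ _ _.
set q2 := itg _ _ _ => PI QI.
have -> : p1 + q1 - p2 - q2 =
  (p1 - p2 - (- b * m) * (s0 + l - s0)) + (q1 - q2 - (b * l) * (t0 + m - t0)).
  by ring.
apply: le_trans (ler_normD _ _) _; apply: le_trans (lerD PI QI) _.
by rewrite le_eqVlt; apply/orP; left; apply/eqP; ring.
Qed.

End Circulation.

Section Bisection.
Variable R : realType.
Variables (P Q : R -> R -> R).

(** Bisection: otherwise some quarter of each rectangle carries at least a
    fourth of its circulation, which contradicts [circulation_small] at the
    common point of the nested quarters. No continuity of the partial
    derivatives is involved. *)
Theorem goursat (s0 t0 l m : R) : 0 < l -> 0 < m ->
  closed_on P Q s0 (s0 + l) t0 (t0 + m) ->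
  circulation P Q s0 (s0 + l) t0 (t0 + m) = 0.
Proof.
move=> l0 m0 cl.
set J := circulation P Q s0 (s0 + l) t0 (t0 + m).
apply/eqP/contraT => /negP/negP J0.
have {}J0 : 0 < `|J| by rewrite normr_gt0.
pose h n : R := 2^-1 ^+ n.
have h0 n : 0 < h n by rewrite exprn_gt0// invr_gt0.
have hS n : h n.+1 + h n.+1 = h n by rewrite /h exprS; lra.
pose I (s t : R) n := circulation P Q s (s + l * h n) t (t + m * h n).
(* the rectangles p.1 + [0, l / 2^n] x p.2 + [0, m / 2^n] still carrying more
   than their share of the circulation *)
pose bad (p : R * R) n := [/\ s0 <= p.1, p.1 + l * h n <= s0 + l, t0 <= p.2,
   p.2 + m * h n <= t0 + m & `|J| * h n ^+ 2 <= `|I p.1 p.2 n|].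
have step (q : {p : (R * R) * nat | bad p.1 p.2}) :
  {q' : {p : (R * R) * nat | bad p.1 p.2} |
    [/\ (sval q').2 = (sval q).2.+1, (sval q).1.1 <= (sval q').1.1,
     (sval q').1.1 + l * h (sval q).2.+1 <= (sval q).1.1 + l * h (sval q).2,
     (sval q).1.2 <= (sval q').1.2 &
     (sval q').1.2 + m * h (sval q).2.+1 <= (sval q).1.2 + m * h (sval q).2]}.
  apply: cid; case: q => [[[s t] n] /= [/= a1 a2 a3 a4 a5]].
  have l1 : 0 < l * h n.+1 by rewrite mulr_gt0.
  have m1 : 0 < m * h n.+1 by rewrite mulr_gt0.
  have lS : l * h n.+1 + l * h n.+1 = l * h n by rewrite -mulrDr hS.
  have mS : m * h n.+1 + m * h n.+1 = m * h n by rewrite -mulrDr hS.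
  have lE : s + l * h n = (s + l * h n.+1) + l * h n.+1 by rewrite -addrA lS.
  have mE : t + m * h n = (t + m * h n.+1) + m * h n.+1 by rewrite -addrA mS.
  have : I s t n = I s t n.+1 + I (s + l * h n.+1) t n.+1 +
       I s (t + m * h n.+1) n.+1 + I (s + l * h n.+1) (t + m * h n.+1) n.+1.
    rewrite /I lE mE; apply: circulation_quarters; first last.
    - by apply/andP; split; lra.
    - by apply/andP; split; lra.
    - by apply: closed_on_sub cl; lra.
  move=> IE.
  have hh : h n ^+ 2 = 4 * h n.+1 ^+ 2 by rewrite -hS; ring.
  suff [p [pn p1 p2 p3 p4]] : exists p : R * R, [/\ `|J| * h n.+1 ^+ 2 <= `|I p.1 p.2 n.+1|,
     s <= p.1, p.1 + l * h n.+1 <= s + l * h n, t <= p.2 & p.2 + m * h n.+1 <= t + m * h n].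
    have bp : bad p n.+1.
      by split; [exact: le_trans a1 p1|exact: le_trans p2 a2|
                 exact: le_trans a3 p3|exact: le_trans p4 a4|].
    by exists (exist _ (p, n.+1) bp).
  apply/not_existsP => no.
  have H p1 p2 : s <= p1 -> p1 + l * h n.+1 <= s + l * h n -> t <= p2 ->
      p2 + m * h n.+1 <= t + m * h n -> `|I p1 p2 n.+1| < `|J| * h n.+1 ^+ 2.
    by move=> ? ? ? ?; rewrite ltNge; apply/negP => ?; apply: (no (p1, p2)).
  have ls : s <= s + l * h n.+1 by rewrite lerDl ltW.
  have lh : s + l * h n.+1 <= s + l * h n by rewrite lerD2l -lS lerDl ltW.
  have ll : s + l * h n.+1 + l * h n.+1 <= s + l * h n by rewrite lE.
  have mt : t <= t + m * h n.+1 by rewrite lerDl ltW.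
  have mh : t + m * h n.+1 <= t + m * h n by rewrite lerD2l -mS lerDl ltW.
  have mm : t + m * h n.+1 + m * h n.+1 <= t + m * h n by rewrite mE.
  have H1 := H s t (lexx _) lh (lexx _) mh.
  have H2 := H (s + l * h n.+1) t ls ll (lexx _) mh.
  have H3 := H s (t + m * h n.+1) (lexx _) lh mt mm.
  have H4 := H (s + l * h n.+1) (t + m * h n.+1) ls ll mt mm.
  have := a5; rewrite leNgt hh mulrCA IE => /negP; apply.
  apply: le_lt_trans (ler_normD _ _) _.
  apply: le_lt_trans (lerD (ler_normD _ _) (lexx _)) _.
  apply: le_lt_trans (lerD (lerD (ler_normD _ _) (lexx _)) (lexx _)) _.
  move: H1 H2 H3 H4; move: (`|J| * _) `|I _ _ _| `|I _ _ _| `|I _ _ _| `|I _ _ _|.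
  by clear; move=> *; lra.
have bad0 : bad (s0, t0) 0%N.
  by rewrite /bad /I /h expr0 !mulr1 expr1n mulr1; split.
have [f [f0 fS]] := dependent_choice step (exist _ ((s0, t0), 0%N) bad0).
pose s n := (sval (f n)).1.1; pose t n := (sval (f n)).1.2.
have fn n : (sval (f n)).2 = n.
  by elim: n => [|n IH]; [rewrite f0 | have [-> _ _ _ _] := fS n; rewrite IH].
have fbad n : bad (s n, t n) n.
  by have := svalP (f n); rewrite fn /s /t; case: (sval (f n)).1.
have sS n : s n <= s n.+1 /\ s n.+1 + l * h n.+1 <= s n + l * h n.
  by have [_ H1 H2 _ _] := fS n; rewrite fn in H2.
have tS n : t n <= t n.+1 /\ t n.+1 + m * h n.+1 <= t n + m * h n.
  by have [_ _ _ H1 H2] := fS n; rewrite fn in H2.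
have lim (u : nat -> R) (k : R) : 0 < k ->
    (forall n, u n <= u n.+1 /\ u n.+1 + k * h n.+1 <= u n + k * h n) ->
    exists x, forall n, u n <= x <= u n + k * h n.
  move=> k0 uS.
  have mono n j : u n <= u (n + j)%N /\ u (n + j)%N + k * h (n + j)%N <= u n + k * h n.
    elim: j => [|j [IH1 IH2]]; first by rewrite addn0.
    by have [H1 H2] := uS (n + j)%N; rewrite addnS; split; lra.
  have bnd n j : u j <= u n + k * h n.
    have [nj|jn] := leqP n j.
      have [_] := mono n (j - n)%N; rewrite subnKC//.
      by have := mulr_gt0 k0 (h0 j); lra.
    have [] := mono j (n - j)%N; rewrite subnKC ?(ltnW jn)// => H _.
    by have := mulr_gt0 k0 (h0 n); lra.
  have ne : range u !=set0 by exists (u 0%N), 0%N.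
  exists (sup (range u)) => n; apply/andP; split.
    apply: ub_le_sup; last by exists n.
    by exists (u 0%N + k * h 0%N) => _ [j _ <-]; exact: bnd.
  by apply: ge_sup => // _ [j _ <-]; exact: bnd.
have [x xI] := lim s l l0 sS; have [y yI] := lim t m m0 tS.
have clxy : closed_at P Q x y.
  have := xI 0%N; have := yI 0%N; rewrite /s /t f0/= /h expr0 !mulr1 => yI0 xI0.
  exact: cl.
have lm0 : 0 < (l + m) ^+ 2 by rewrite exprn_gt0// addr_gt0.
have e0 : 0 < `|J| / (2 * (l + m) ^+ 2) by rewrite divr_gt0// mulr_gt0.
have [d d0 Hd] := circulation_small clxy e0.
have [n hn] : exists n, (l + m) * h n < d.
  have := @cvg_expr R 2^-1; rewrite ger0_norm ?invr_ge0// invf_lt1 ?ltr1n// => /(_ isT).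
  move=> /cvgrPdist_lt /(_ (d / (l + m))); rewrite divr_gt0 ?addr_gt0// => /(_ isT) [n _ Hn].
  exists n; have := Hn n (leqnn n); rewrite sub0r normrN (ger0_norm (ltW (h0 n))).
  by rewrite ltr_pdivlMr ?addr_gt0// mulrC.
have lh : 0 < l * h n by rewrite mulr_gt0.
have mh : 0 < m * h n by rewrite mulr_gt0.
rewrite mulrDl in hn.
have [/= b1 b2 b3 b4 b5] := fbad n.
have clr : closed_on P Q (s n) (s n + l * h n) (t n) (t n + m * h n).
  by apply: closed_on_sub cl.
have := Hd (s n) (t n) (l * h n) (m * h n).
rewrite lh mh => /(_ _ _ (xI n) (yI n) clr) Hfin.
have H2 : `|J| * h n ^+ 2 <= `|J| / (2 * (l + m) ^+ 2) * (l * h n + m * h n) ^+ 2.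
  by apply: le_trans b5 (Hfin _ _); apply: le_lt_trans hn; rewrite ?lerDl ?lerDr ltW.
have H3 : `|J| / (2 * (l + m) ^+ 2) * (l * h n + m * h n) ^+ 2 = `|J| * h n ^+ 2 / 2.
  by rewrite -mulrDl; field; rewrite gt_eqF// addr_gt0.
have H4 : 0 < `|J| * h n ^+ 2 by rewrite mulr_gt0// exprn_gt0.
move: H2; rewrite H3 ler_pdivlMr//; move: H4; move: (`|J| * h n ^+ 2); clear; move=> *; lra.
Qed.

End Bisection.

(** * The maximum modulus principle *)

Lemma derivable_littleo (K : numFieldType) (f : K^o -> K^o) (x : K^o) :
  derivable f x 1 -> forall e : K, 0 < e ->
    exists2 d : K, 0 < d & forall h : K, `|h| < d ->
      `|f (x + h) - f x - 'D_1 f x * h| <= e * `|h|.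
Proof.
move=> fd e e0; set l := 'D_1 f x.
have /cvgrPdist_le/(_ e e0)/nbhs_ballP[d /= d0 Hd] :
  h^-1 *: ((f \o shift x) (h *: (1 : K^o)) - f x) @[h --> 0^'] --> l := fd.
exists d => // h hd; have [->|h0] := eqVneq h 0.
  by rewrite addr0 subrr mulr0 subrr !normr0 mulr0.
have := Hd h; rewrite /ball/= sub0r normrN => /(_ hd h0).
rewrite distrC /GRing.scale/= mulr1 [h + x]addrC.
have -> : f (x + h) - f x - l * h = (h^-1 * (f (x + h) - f x) - l) * h.
  by rewrite mulrBl mulrAC mulVf// mul1r.
by rewrite normrM => H; rewrite ler_pM2r// normr_gt0.
Qed.

Notation cj := (@conjc _).

Section Complex.
Variable R : realType.
Local Notation C := R[i].
Implicit Types (z w p : C) (u : C -> C).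

(** The norm of R[i] takes its values in R[i]; this modulus is real. *)
Definition cabs z : R := Normc.normc z.

Lemma cabsE z : `|z| = (cabs z)%:C. Proof. by []. Qed.
Lemma cabs0 : cabs 0 = 0. Proof. exact: Normc.normc0. Qed.
Lemma cabs1 : cabs 1 = 1. Proof. exact: Normc.normc1. Qed.
Lemma cabsM z w : cabs (z * w) = cabs z * cabs w. Proof. exact: Normc.normcM. Qed.
Lemma cabsV z : cabs z^-1 = (cabs z)^-1. Proof. exact: Normc.normcV. Qed.
Lemma cabsN z : cabs (- z) = cabs z. Proof. exact: normcN. Qed.
Lemma cabsC z w : cabs (z - w) = cabs (w - z). Proof. by rewrite -cabsN opprB. Qed.
Lemma cabsD z w : cabs (z + w) <= cabs z + cabs w. Proof. exact: le_normcD. Qed.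
Lemma cabsB z w : cabs (z - w) <= cabs z + cabs w.
Proof. by rewrite -(cabsN w); exact: cabsD. Qed.
Lemma cabs_ge0 z : 0 <= cabs z. Proof. by case: z => a b; exact: sqrtr_ge0. Qed.
Lemma cabs_eq0 z : (cabs z == 0) = (z == 0).
Proof. by apply/eqP/eqP => [/Normc.eq0_normc//|->]; exact: cabs0. Qed.
Lemma cabs_gt0 z : (0 < cabs z) = (z != 0).
Proof. by rewrite lt_def cabs_ge0 andbT cabs_eq0. Qed.
Lemma cabs_dist z w : cabs z - cabs w <= cabs (z - w).
Proof. by rewrite lerBlDr -{1}(subrK w z); exact: cabsD. Qed.
Lemma cabs_sqr z : cabs z ^+ 2 = complex.Re z ^+ 2 + complex.Im z ^+ 2.
Proof. by case: z => a b /=; rewrite /cabs/= sqr_sqrtr// addr_ge0 ?sqr_ge0. Qed.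
Lemma Re_cabs z : `|complex.Re z| <= cabs z.
Proof.
rewrite -(@ler_pXn2r _ 2)// ?nnegrE ?cabs_ge0// cabs_sqr real_normK ?num_real//.
by rewrite lerDl sqr_ge0.
Qed.
Lemma Im_cabs z : `|complex.Im z| <= cabs z.
Proof.
rewrite -(@ler_pXn2r _ 2)// ?nnegrE ?cabs_ge0// cabs_sqr real_normK ?num_real//.
by rewrite lerDr sqr_ge0.
Qed.
Lemma cabs_ReIm z : cabs z <= `|complex.Re z| + `|complex.Im z|.
Proof.
rewrite -(@ler_pXn2r _ 2)// ?nnegrE ?cabs_ge0 ?addr_ge0// cabs_sqr sqrrD.
by rewrite !real_normK ?num_real// -addrA lerD2l lerDr mulrn_wge0// mulr_ge0.
Qed.
Lemma cabs_real (a : R) : cabs a%:C = `|a|.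
Proof. by rewrite /cabs/= expr0n/= addr0 sqrtr_sqr. Qed.
Lemma cabs_conj z : cabs (cj z) = cabs z.
Proof. by case: z => a b; rewrite /cabs/= sqrrN. Qed.

Definition cdiff u z l := forall e : R, 0 < e -> exists2 d : R, 0 < d &
  forall w, cabs (w - z) < d -> cabs (u w - u z - l * (w - z)) <= e * cabs (w - z).

Definition ccont u z := forall e : R, 0 < e -> exists2 d : R, 0 < d &
  forall w, cabs (w - z) < d -> cabs (u w - u z) <= e.

Lemma derivable_cdiff (f : C^o -> C^o) z : derivable f z 1 -> exists l, cdiff f z l.
Proof.
move=> /derivable_littleo fl; exists ('D_1 f z) => e e0.
have [|d d0 Hd] := fl e%:C; first by rewrite ltcR.
have /andP[/eqP d1 d2] : (complex.Im d == 0) && (0 < complex.Re d) by move: d0; rewrite ltcE.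
exists (complex.Re d) => // w wd; have := Hd (w - z).
rewrite [z + _]addrC subrK !cabsE -rmorphM/= lecR; apply.
by case: d d1 wd {d0 d2 Hd} => a b /= -> ?; rewrite ltcR.
Qed.

Lemma cdiff_ccont u z l : cdiff u z l -> ccont u z.
Proof.
move=> ul e e0; have [d d0 Hd] := ul 1 ltr01.
have l0 : 0 < 1 + cabs l by rewrite ltr_pwDl// cabs_ge0.
exists (Num.min d (e / (1 + cabs l))); first by rewrite lt_min d0 divr_gt0.
move=> w; rewrite lt_min => /andP[/Hd]; rewrite ltr_pdivlMr// => H /ltW H2.
apply: le_trans H2.
have -> : u w - u z = (u w - u z - l * (w - z)) + l * (w - z) by ring.
apply: le_trans (cabsD _ _) _; rewrite cabsM [leRHS]mulrDr mulr1.
by rewrite mul1r in H; rewrite [X in _ <= _ + X]mulrC lerD2r.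
Qed.

(** The exponential function of s + it. *)
Definition polar (s t : R) : C := (expR s * cos t) +i* (expR s * sin t).

Lemma polarD s t s' t' : polar (s + s') (t + t') = polar s t * polar s' t'.
Proof.
rewrite /polar; apply/eqP; rewrite eq_complex /= expRD cosD sinD.
by apply/andP; split; apply/eqP; ring.
Qed.

Lemma cabs_polar s t : cabs (polar s t) = expR s.
Proof.
rewrite /polar /cabs/= !exprMn -mulrDr cos2Dsin2 mulr1 sqrtr_sqr ger0_norm//. 
Qed.

Lemma real_littleo (f : R -> R) (x l : R) : is_derive x 1 f l ->
  forall e : R, 0 < e -> exists2 d : R, 0 < d & forall h : R, `|h| < d ->
      `|f (x + h) - f x - l * h| <= e * `|h|.
Proof.
by move=> [fd <-] e e0; exact: (@derivable_littleo R f x fd e e0).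
Qed.

Lemma polar_littleo (e : R) : 0 < e -> exists2 d : R, 0 < d & forall s t,
  `|s| < d -> `|t| < d ->
  cabs (polar s t - 1 - (s +i* t)) <= e * (`|s| + `|t|).
Proof.
move=> e0; pose k := Num.min (e / 4) 1.
have k0 : 0 < k by rewrite lt_min ltr01 andbT divr_gt0.
have ke : k <= e / 4 by rewrite ge_min lexx.
have k1 : k <= 1 by rewrite ge_min lexx orbT.
have [d1 d10 H1] := real_littleo (is_derive_expR 0) k0.
have [d2 d20 H2] := real_littleo (is_derive_cos 0) k0.
have [d3 d30 H3] := real_littleo (is_derive_sin 0) k0.
exists (Num.min (Num.min d1 d2) (Num.min d3 (k / 4))).
  by rewrite !lt_min d10 d20 d30 divr_gt0.
move=> s t; rewrite !lt_min => /andP[/andP[/H1 {}H1 _] /andP[_ s4]].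
move=> /andP[/andP[_ /H2 {}H2] /andP[/H3 {}H3 t4]].
move: H1 H2 H3; rewrite !add0r expR0 cos0 sin0 mul1r oppr0 mul0r !subr0 ?addr0 mul1r.
move=> H1 H2 H3.
have sk : `|expR s - 1| <= 2 * `|s|.
  have -> : expR s - 1 = (expR s - 1 - s) + s by ring.
  apply: le_trans (ler_normD _ _) _; rewrite mulrDl mul1r lerD2r.
  by apply: le_trans H1 _; rewrite ler_piMl.
have tk : `|sin t| <= 2 * `|t|.
  have -> : sin t = (sin t - t) + t by ring.
  apply: le_trans (ler_normD _ _) _; rewrite mulrDl mul1r lerD2r.
  by apply: le_trans H3 _; rewrite ler_piMl.
have c1 : `|cos t| <= 1 by rewrite ler_norml cos_geN1 cos_le1.
have s1 : `|1 + s| <= 2.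
  by apply: le_trans (ler_normD _ _) _; rewrite normr1; lra.
have s0 := normr_ge0 s; have t0 := normr_ge0 t.
apply: le_trans (cabs_ReIm _) _ => /=.
have -> : expR s * cos t - 1 - s =
  (expR s - 1 - s) * cos t + (1 + s) * (cos t - 1) by ring.
have -> : expR s * sin t - 0 - t = (expR s - 1) * sin t + (sin t - t) by ring.
have B1 : `|(expR s - 1 - s) * cos t| <= k * `|s|.
  by rewrite normrM -[leRHS]mulr1 ler_pM.
have B2 : `|(1 + s) * (cos t - 1)| <= 2 * (k * `|t|) by rewrite normrM ler_pM.
have B3 : `|(expR s - 1) * sin t| <= (2 * (k / 4)) * (2 * `|t|).
  by rewrite normrM ler_pM//; apply: le_trans sk _; lra.
have B4 := ler_normD ((expR s - 1 - s) * cos t) ((1 + s) * (cos t - 1)).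
have B5 := ler_normD ((expR s - 1) * sin t) (sin t - t).
have B6 : k * `|s| <= e / 4 * `|s| by rewrite ler_wpM2r.
have B7 : k * `|t| <= e / 4 * `|t| by rewrite ler_wpM2r.
have B8 : 0 <= e * `|s| by rewrite mulr_ge0// ltW.
have B9 : 0 <= e * `|t| by rewrite mulr_ge0// ltW.
lra.
Qed.

(** The Cauchy-Riemann equations in the coordinates s and t: the forms with
    coefficients the real and imaginary parts of u along the exponential are
    closed. *)
Lemma polar_diff2 u p s t l : cdiff u (p + polar s t) l -> exists a b,
  diff2 (fun s t => complex.Re (u (p + polar s t))) s t a (- b) /\
  diff2 (fun s t => complex.Im (u (p + polar s t))) s t b a.
Proof.
set z := p + polar s t => ul.
pose L := l * polar s t.
exists (complex.Re L), (complex.Im L).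
have key (e : R) : 0 < e -> exists2 d : R, 0 < d & forall s' t',
    `|s' - s| < d -> `|t' - t| < d ->
    cabs (u (p + polar s' t') - u z - L * ((s' - s) +i* (t' - t)))
       <= e * (`|s' - s| + `|t' - t|).
  move=> e0; have E0 := expR_gt0 s.
  have lE : 0 <= cabs l * expR s by rewrite mulr_ge0// ?cabs_ge0// ltW.
  have e10 : 0 < e / (4 * expR s) by rewrite divr_gt0// mulr_gt0.
  have e20 : 0 < Num.min 1 (e / (2 * (cabs l * expR s + 1))).
    by rewrite lt_min ltr01 divr_gt0// mulr_gt0// ltr_wpDl.
  have [d1 d10 H1] := ul _ e10; have [d2 d20 H2] := polar_littleo e20.
  exists (Num.min d2 (d1 / (4 * expR s))).
    by rewrite lt_min d20 divr_gt0// mulr_gt0.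
  move=> s' t'; rewrite !lt_min => /andP[/H2 {}H2 s1] /andP[/H2 {}H2 t1].
  move: s1 t1; rewrite !ltr_pdivlMr ?mulr_gt0// => s1 t1.
  set w := p + polar s' t'.
  pose dz := (s' - s) +i* (t' - t).
  pose err := polar (s' - s) (t' - t) - 1 - dz.
  have wz : w - z = polar s t * (dz + err).
    rewrite /w /z /err -{1}(subrK s s') -{1}(subrK t t').
    by rewrite [s' - s + s]addrC [t' - t + t]addrC polarD; ring.
  have nr : cabs dz <= `|s' - s| + `|t' - t| by exact: cabs_ReIm.
  have nr0 : 0 <= `|s' - s| + `|t' - t| by rewrite addr_ge0.
  have ner : cabs err <= `|s' - s| + `|t' - t|.
    by apply: le_trans H2 _; rewrite ler_piMl// ge_min lexx.
  have nwz : cabs (w - z) <= expR s * (2 * (`|s' - s| + `|t' - t|)).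
    rewrite wz cabsM cabs_polar ler_pM2l//.
    by apply: le_trans (cabsD _ _) _; lra.
  have -> : u w - u z - L * dz = (u w - u z - l * (w - z)) + l * polar s t * err.
    by rewrite wz /L; ring.
  apply: le_trans (cabsD _ _) _.
  have I1 : cabs (u w - u z - l * (w - z)) <= e / 2 * (`|s' - s| + `|t' - t|).
    have /H1 H : cabs (w - z) < d1 by apply: le_lt_trans nwz _; lra.
    apply: le_trans H _.
    have -> : e / 2 * (`|s' - s| + `|t' - t|) =
       e / (4 * expR s) * (expR s * (2 * (`|s' - s| + `|t' - t|))).
      by field; rewrite gt_eqF.
    by rewrite ler_pM2l.
  have I2 : cabs (l * polar s t * err) <= e / 2 * (`|s' - s| + `|t' - t|).
    rewrite !cabsM cabs_polar.
    have I3 : cabs err <= e / (2 * (cabs l * expR s + 1)) * (`|s' - s| + `|t' - t|).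
      by apply: le_trans H2 _; rewrite ler_wpM2r// ge_min lexx orbT.
    apply: le_trans (ler_wpM2l lE I3) _.
    set q := cabs l * expR s in lE *; set D := `|s' - s| + _ in nr0 *.
    have q1 : 0 < q + 1 by rewrite ltr_wpDl.
    have -> : q * (e / (2 * (q + 1)) * D) = (e / 2 * D) * (q / (q + 1)).
      by field; rewrite gt_eqF.
    rewrite ler_piMr//; first by rewrite mulr_ge0// divr_ge0// ltW.
    by rewrite ler_pdivrMr// mul1r lerDl.
  by lra.
split=> e e0; have [d d0 Hd] := key e e0; exists d => // s' t' sd td;
  have {}Hd := Hd s' t' sd td; apply: le_trans Hd.
- apply: le_trans (Re_cabs _); rewrite le_eqVlt; apply/orP; left; apply/eqP.
  congr `|_|; rewrite /z; case: (u _) => ? ?; case: (u _) => ? ?.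
  by rewrite /L; case: (l * _) => ? ? /=; ring.
- apply: le_trans (Im_cabs _); rewrite le_eqVlt; apply/orP; left; apply/eqP.
  congr `|_|; rewrite /z; case: (u _) => ? ?; case: (u _) => ? ?.
  by rewrite /L; case: (l * _) => ? ? /=; ring.
Qed.

Lemma polar_2pi s : polar s (0 + 2 * pi) = polar s 0.
Proof.
by rewrite /polar add0r mulr_natl cos2pi sin2pi cos0 sin0.
Qed.

(** The average of [Re u] over the circles around p does not depend on the
    radius: in logarithmic polar coordinates it is the integral along a side of
    a rectangle, the contributions of the two horizontal sides cancelling by
    periodicity.  It tends to [Re (u p)] when the radius tends to 0. *)
Lemma circle_max u p (rho0 rho eta : R) : 0 < rho -> rho < rho0 -> 0 < eta ->
  ccont u p -> (forall z, z != p -> cabs (z - p) < rho0 -> exists l, cdiff u z l) ->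
  exists2 z, cabs (z - p) = rho & complex.Re (u p) - eta < complex.Re (u z).
Proof.
move=> r0 rr0 eta0 uc ud; apply: contrapT => no.
have {}no z : cabs (z - p) = rho -> complex.Re (u z) <= complex.Re (u p) - eta.
  by move=> zr; rewrite leNgt; apply/negP => ?; apply: no; exists z.
have eta20 : 0 < eta / 2 by rewrite divr_gt0.
have [d d0 Hd] := uc _ eta20.
pose s1 := ln rho; pose s0 := Num.min (s1 - 1) (ln (d / 2)).
have s01 : s0 <= s1 - 1 by rewrite ge_min lexx.
have d20 : 0 < d / 2 by rewrite divr_gt0.
have s0d : expR s0 <= d / 2.
  by rewrite -(lnK d20) ler_expR ge_min lexx orbT.
have es1 : expR s1 = rho by rewrite lnK.
have m0 : 0 < 2 * pi :> R by rewrite mulr_gt0// pi_gt0.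
have l0 : 0 < s1 - s0 by lra.
have s0s1 : s0 <= s1 by lra.
pose P s t := complex.Im (u (p + polar s t)).
pose Q s t := complex.Re (u (p + polar s t)).
have cl : closed_on P Q s0 (s0 + (s1 - s0)) 0 (0 + 2 * pi).
  move=> s t /andP[_ ss1] _; have [|| l ul] := ud (p + polar s t).
  - rewrite -subr_eq0 addrC addKr -cabs_gt0 cabs_polar; exact: expR_gt0.
  - rewrite addrC addKr cabs_polar; apply: le_lt_trans rr0.
    by rewrite -es1 ler_expR; lra.
  have [a [b [Ha Hb]]] := polar_diff2 ul.
  by exists b, a, (- b).
have := goursat l0 m0 cl; rewrite /circulation.
rewrite (_ : P^~ (0 + 2 * pi) = P^~ 0); last first.
  by apply/funext => s; rewrite /P polar_2pi.
set i0 := itg (fun s => P s 0) _ _; set i1 := itg (Q _) _ _.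
set i2 := itg (Q s0) _ _ => E.
have QQ : i1 = i2 by apply/eqP; rewrite -subr_eq0 -E; apply/eqP; ring.
rewrite /i1 /i2 {i0 i1 i2 E} in QQ.
have [_ cQ] := closed_onP cl.
have s1E : s0 + (s1 - s0) = s1 by ring.
rewrite s1E in QQ cQ.
have := @itg_le_sub _ (Q s1) (Q s0) 0 (0 + 2 * pi) (eta / 2).
rewrite QQ => H.
have : itg (Q s0) 0 (0 + 2 * pi) <= itg (Q s0) 0 (0 + 2 * pi) - eta / 2 * (0 + 2 * pi - 0).
  apply: H; [by rewrite add0r ltW|by apply: cQ; rewrite lexx s0s1|
    by apply: cQ; rewrite lexx s0s1|].
  move=> t _; rewrite /Q.
  have H1 : complex.Re (u (p + polar s1 t)) <= complex.Re (u p) - eta.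
    by apply: no; rewrite addrC addKr cabs_polar.
  have H2 : cabs (u (p + polar s0 t) - u p) <= eta / 2.
    apply: Hd; rewrite addrC addKr cabs_polar; apply: le_lt_trans s0d _.
    by rewrite ltr_pdivrMr// ltr_pMr// ltr1n.
  have := le_trans (Re_cabs _) H2; rewrite ler_norml raddfB/= => /andP[H3 _].
  move: H1 H3; move: (complex.Re _) (complex.Re _) (complex.Re _); clear.
  by move=> *; lra.
by rewrite lerBrDr gerDl leNgt mulr_gt0// add0r subr0.
Qed.

End Complex.

Section ComplexTopology.
Variable R : realType.
Local Notation C := R[i].
Implicit Types (z w p : C) (u : C -> C).

Lemma nbhsCP (z : C^o) (A : set C) :
  nbhs z A <-> exists2 d : R, 0 < d & forall w, cabs (w - z) < d -> A w.
Proof.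
split=> [/(@nbhs_ballP _ C^o z A)[d /= d0 dA]|[d d0 dA]].
  have /andP[/eqP d1 d2] : (complex.Im d == 0) && (0 < complex.Re d) by move: d0; rewrite ltcE.
  exists (complex.Re d) => // w wd; apply: dA; rewrite /ball/= cabsE cabsC.
  by case: d d1 wd {d0 d2} => a b /= -> ?; rewrite ltcR.
apply/(@nbhs_ballP _ C^o); exists d%:C; first by rewrite /= ltcR.
by move=> w; rewrite /ball/= cabsE cabsC ltcR; exact: dA.
Qed.

Lemma cabs_continuous : continuous (@cabs R : C^o -> R).
Proof.
move=> z A /nbhs_ballP[e /= e0 eA]; apply/nbhsCP; exists e => // w zw; apply: eA.
rewrite /ball/= ltr_norml; apply/andP; split; have := cabs_dist z w; have := cabs_dist w z.
  by lra.
by rewrite [cabs (z - w)]cabsC; lra.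
Qed.

Lemma compact_cball (r : R) : compact ([set z | cabs z <= r] : set C^o).
Proof.
have sq : compact ((fun x : R * R => x.1 +i* x.2 : C^o) @` (`[- r, r] `*` `[- r, r])).
  apply: continuous_compact; last by apply: compact_setX; exact: segment_compact.
  apply: continuous_subspaceT => -[x y] A /nbhsCP[d /= d0 dA].
  have d20 : 0 < d / 2 by rewrite divr_gt0.
  exists (ball x (d / 2), ball y (d / 2)); first by split; exact: nbhsx_ballx.
  move=> [x' y'] /= [+ +]; rewrite /ball/= => xx yy; apply: dA.
  apply: le_lt_trans (cabs_ReIm _) _; rewrite /= distrC [X in _ + X]distrC; lra.
apply: (subclosed_compact _ sq).
  apply: (@closed_comp _ _ (@cabs R : C^o -> R) [set x | x <= r]); last exact: closed_le.
  by move=> z _; exact: cabs_continuous.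
move=> [x y] /= zr; exists (x, y) => //=; rewrite !in_itv/=.
have := Re_cabs (x +i* y); have := Im_cabs (x +i* y); rewrite /= !ler_norml.
by move=> /andP[? ?] /andP[? ?]; split; apply/andP; split; lra.
Qed.

(** Adding e |z|^2 to [Re u] makes it reach its maximum at some p inside the
    disc. As |z|^2 = |p|^2 + 2 Re (cj p * (z - p)) + |z - p|^2, the sum is, up
    to a constant, the real part of a function U as regular as u, plus e |z -
    p|^2; so [Re U] lies below [Re (U p)] by a fixed amount on small circles
    around p, against [circle_max]. The latter asks for no derivative at the
    centre, so that the origin may be a removable singularity. *)
Lemma max_principle_Re u :
  (forall z, cabs z < 1 -> ccont u z) ->
  (forall z, z != 0 -> cabs z < 1 -> exists l, cdiff u z l) ->
  (forall e, 0 < e -> exists2 r, r < 1 & forall z, r <= cabs z < 1 ->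
     complex.Re (u z) <= 1 + e) ->
  forall z, cabs z < 1 -> complex.Re (u z) <= 1.
Proof.
move=> uc ud ub z0 z01; rewrite leNgt; apply/negP => uz0.
pose e := (complex.Re (u z0) - 1) / 4.
have e0 : 0 < e by rewrite divr_gt0// subr_gt0.
have [r0 r01 Hr] := ub e e0.
pose r := Num.max r0 (cabs z0).
have r1 : r < 1 by rewrite gt_max r01.
have rr0 : r0 <= r by rewrite le_max lexx.
have rz0 : cabs z0 <= r by rewrite le_max lexx orbT.
pose h z : R := complex.Re (u z) + e * cabs z ^+ 2.
have [p /= pr pmax] : exists2 p : C, cabs p <= r & forall z, cabs z <= r -> h z <= h p.
  have ne : [set z : C^o | cabs z <= r] !=set0 by exists z0.
  have hc : {within [set z : C^o | cabs z <= r], continuous (h : C^o -> R)}.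
    apply: continuous_in_subspaceT => z; rewrite inE /= => zr.
    have c1 : {for (z : C^o), continuous (fun z : C^o => complex.Re (u z))}.
      move=> A /nbhs_ballP[d /= d0 dA]; apply/nbhsCP.
      have [k k0 Hk] := uc z (le_lt_trans zr r1) (d / 2) (divr_gt0 d0 (ltr0Sn _ 1)).
      exists k => // w /Hk H; apply: dA; rewrite /ball/= distrC -raddfB.
      apply: le_lt_trans (le_trans (Re_cabs _) H) _; lra.
    have c2 : {for (z : C^o), continuous (fun z : C^o => e * cabs z ^+ 2)}.
      apply: (@continuousM _ C^o); first exact: cst_continuous.
      apply: (@continuous_comp C^o R R (@cabs R) (fun x => x ^+ 2)).
        exact: cabs_continuous.
      exact: exprn_continuous.
    exact: continuousD c1 c2.
  have [p pI pm] := compact_EVT_max ne (@compact_cball r) hc.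
  exists p; first by move: pI; rewrite inE.
  by move=> z zr; apply: pm; rewrite inE.
have sq1 z : cabs z < 1 -> cabs z ^+ 2 <= 1.
  by move=> z1; rewrite expr_le1// ?cabs_ge0 ?ltW.
have p1 := le_lt_trans pr r1.
have hp : 1 + 4 * e <= h p.
  apply: le_trans (pmax z0 rz0).
  have -> : 1 + 4 * e = complex.Re (u z0) by rewrite /e; field.
  by rewrite lerDl mulr_ge0 ?sqr_ge0// ltW.
have hpe : h p <= complex.Re (u p) + e.
  by rewrite lerD2l ler_piMr ?sq1// ltW.
have pr0 : cabs p < r.
  rewrite lt_neqAle pr andbT; apply/negP => /eqP pE.
  have : complex.Re (u p) <= 1 + e by apply: Hr; rewrite pE rr0.
  lra.
pose U z : C := u z + (2 * e)%:C * cj p * (z - p).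
(* the discs around p have to avoid the origin, unless it is their centre *)
pose rho0 : R := if p == 0 then r - cabs p else Num.min (r - cabs p) (cabs p).
have rho00 : 0 < rho0.
  rewrite /rho0; case: eqVneq => [_|p0]; first by rewrite subr_gt0.
  by rewrite lt_min subr_gt0 pr0 cabs_gt0.
have rho0r : rho0 <= r - cabs p.
  by rewrite /rho0; case: eqP => // _; rewrite ge_min lexx.
have inD z : cabs (z - p) < rho0 -> cabs z < r.
  by have := cabs_dist z p; move=> *; lra.
have linc z : cdiff (fun z => (2 * e)%:C * cj p * (z - p)) z ((2 * e)%:C * (cj p)).
  move=> d d0; exists 1 => // w _; rewrite (_ : _ - _ - _ = 0) ?cabs0; last by ring.
  by rewrite mulr_ge0 ?cabs_ge0// ltW.
have Uc : ccont U p.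
  move=> d d0; have d20 : 0 < d / 2 by rewrite divr_gt0.
  have [k1 k10 H1] := uc p p1 _ d20; have [k2 k20 H2] := cdiff_ccont (linc p) d20.
  exists (Num.min k1 k2); first by rewrite lt_min k10.
  move=> w; rewrite lt_min => /andP[/H1 {}H1 /H2 {}H2].
  rewrite /U opprD addrACA; apply: le_trans (cabsD _ _) _; lra.
have Ud z : z != p -> cabs (z - p) < rho0 -> exists l, cdiff U z l.
  move=> zp zr; have [||l ul] := ud z; last 1 first.
  - exists (l + (2 * e)%:C * (cj p)) => d d0; have d20 : 0 < d / 2 by rewrite divr_gt0.
    have [k1 k10 H1] := ul _ d20; exists k1 => // w /H1 {}H1.
    rewrite /U (_ : _ - _ - _ = u w - u z - l * (w - z)); last by ring.
    apply: le_trans H1 _; rewrite ler_wpM2r ?cabs_ge0//; lra.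
  - apply: contraTneq zr => z0E; rewrite -leNgt z0E sub0r cabsN /rho0.
    case: eqVneq => [p0|_]; last by rewrite ge_min lexx orbT.
    by move: zp; rewrite z0E p0 eqxx.
  - exact: lt_trans (inD _ zr) r1.
pose rho := rho0 / 2.
have rho_gt0 : 0 < rho by rewrite divr_gt0.
have rho_lt : rho < rho0 by rewrite /rho; lra.
have eta0 : 0 < e * rho ^+ 2 by rewrite mulr_gt0// exprn_gt0.
have [z zrho] := circle_max rho_gt0 rho_lt eta0 Uc Ud.
have zr : cabs z <= r by apply/ltW/inD; rewrite zrho.
have hE : h z = complex.Re (U z) + e * (cabs p ^+ 2 + rho ^+ 2).
  rewrite /h /U -zrho !cabs_sqr raddfD /= -addrA; congr (_ + _).
  by case: (z) => a b; case: (p) => c d /=; ring.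
have -> : U p = u p by rewrite /U subrr mulr0 addr0.
move=> H; have := pmax z zr; rewrite hE /h => H2; lra.
Qed.

Lemma max_principle u :
  (forall z, cabs z < 1 -> ccont u z) ->
  (forall z, z != 0 -> cabs z < 1 -> exists l, cdiff u z l) ->
  (forall e, 0 < e -> exists2 r, r < 1 & forall z, r <= cabs z < 1 ->
     cabs (u z) <= 1 + e) ->
  forall z, cabs z < 1 -> cabs (u z) <= 1.
Proof.
move=> uc ud ub z0 z01; have [->|uz0] := eqVneq (u z0) 0; first by rewrite cabs0.
(* rotate so that the value at z0 becomes real *)
pose c := (cj (u z0)) / (cabs (u z0))%:C.
have cu0 : 0 < cabs (u z0) by rewrite cabs_gt0.
have c1 : cabs c = 1.
  rewrite /c cabsM cabsV cabs_conj cabs_real ger0_norm ?cabs_ge0// mulfV//.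
  by rewrite gt_eqF.
have cuE : complex.Re (c * u z0) = cabs (u z0).
  have -> : c * u z0 = ((cabs (u z0) ^+ 2) / cabs (u z0))%:C.
    rewrite /c mulrAC rmorphM fmorphV/=; congr (_ / _).
    by rewrite cabs_sqr; case: (u z0) => a b /=; apply/eqP; rewrite eq_complex/=; apply/andP; split; apply/eqP; ring.
  by rewrite /= expr2 mulfK// gt_eqF.
rewrite -cuE; move: (c) c1 cuE => {}c c1 cuE.
apply: (@max_principle_Re (fun z => c * u z)) => // [z z1 e e0|z z0' z1|e e0].
- have [d d0 Hd] := uc z z1 e e0; exists d => // w /Hd.
  by rewrite -mulrBr cabsM c1 mul1r.
- have [l ul] := ud z z0' z1; exists (c * l) => e e0.
  have [d d0 Hd] := ul e e0; exists d => // w /Hd.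
  rewrite (_ : c * u w - _ - _ = c * (u w - u z - l * (w - z))); last by ring.
  by rewrite cabsM c1 mul1r.
- have [r r1 Hr] := ub e e0; exists r => // z /Hr; apply: le_trans.
  by rewrite -[leRHS]mul1r -c1 -cabsM; apply: le_trans (Re_cabs _); exact: ler_norm.
Qed.

End ComplexTopology.

(** * Complex differentiation *)

Section Calculus.
Variable R : realType.
Local Notation C := R[i].
Implicit Types (z w p a c : C) (u v : C -> C).

Lemma cdiff_local u v z l (d0 : R) : 0 < d0 ->
  (forall w, cabs (w - z) < d0 -> u w = v w) -> cdiff u z l -> cdiff v z l.
Proof.
move=> d00 uv ul e e0; have [d dp Hd] := ul e e0.
exists (Num.min d d0); first by rewrite lt_min dp.
move=> w; rewrite lt_min => /andP[/Hd H /uv <-].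
by rewrite -(uv z)// subrr cabs0.
Qed.

Lemma cdiff_cst c z : cdiff (fun=> c) z 0.
Proof.
move=> e e0; exists 1 => // w _; rewrite subrr mul0r subrr cabs0.
by rewrite mulr_ge0 ?cabs_ge0// ltW.
Qed.

Lemma cdiff_id z : cdiff id z 1.
Proof.
move=> e e0; exists 1 => // w _; rewrite mul1r subrr cabs0.
by rewrite mulr_ge0 ?cabs_ge0// ltW.
Qed.

Lemma cdiffD u v z l m : cdiff u z l -> cdiff v z m ->
  cdiff (fun w => u w + v w) z (l + m).
Proof.
move=> ul vm e e0; have e20 : 0 < e / 2 by rewrite divr_gt0.
have [d1 d10 H1] := ul _ e20; have [d2 d20 H2] := vm _ e20.
exists (Num.min d1 d2); first by rewrite lt_min d10.
move=> w; rewrite lt_min => /andP[/H1 {}H1 /H2 {}H2].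
rewrite (_ : u w + v w - _ - _ =
  (u w - u z - l * (w - z)) + (v w - v z - m * (w - z))); last by ring.
by apply: le_trans (cabsD _ _) _; lra.
Qed.

Lemma cdiffM u v z l m : cdiff u z l -> cdiff v z m ->
  cdiff (fun w => u w * v w) z (l * v z + u z * m).
Proof.
move=> ul vm e e0.
have K1 : 0 < cabs (v z) + 1 by rewrite ltr_wpDl// cabs_ge0.
have K2 : 0 < cabs l + 1 by rewrite ltr_wpDl// cabs_ge0.
have K3 : 0 < cabs (u z) + 1 by rewrite ltr_wpDl// cabs_ge0.
have e1 : 0 < e / 3 / (cabs (v z) + 1) by rewrite !divr_gt0.
have e2 : 0 < Num.min 1 (e / 3 / (cabs l + 1)) by rewrite lt_min ltr01 !divr_gt0.
have e3 : 0 < e / 3 / (cabs (u z) + 1) by rewrite !divr_gt0.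
have [d1 d10 H1] := ul _ e1; have [d2 d20 H2] := cdiff_ccont vm e2.
have [d3 d30 H3] := vm _ e3.
exists (Num.min d1 (Num.min d2 d3)); first by rewrite !lt_min d10 d20.
move=> w; rewrite !lt_min => /andP[/H1 {}H1 /andP[/H2 {}H2 /H3 {}H3]].
rewrite (_ : u w * v w - _ - _ =
  (u w - u z - l * (w - z)) * v w + l * (w - z) * (v w - v z) +
  u z * (v w - v z - m * (w - z))); last by ring.
have W0 := cabs_ge0 (w - z).
have H2a : cabs (v w - v z) <= 1 by apply: le_trans H2 _; rewrite ge_min lexx.
have H2b : cabs (v w - v z) <= e / 3 / (cabs l + 1).
  by apply: le_trans H2 _; rewrite ge_min lexx orbT.
have vw : cabs (v w) <= cabs (v z) + 1 by have := cabs_dist (v w) (v z); lra.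
have B1 : cabs ((u w - u z - l * (w - z)) * v w) <= e / 3 * cabs (w - z).
  rewrite cabsM; apply: le_trans (ler_pM _ _ H1 vw) _; rewrite ?cabs_ge0//.
  rewrite le_eqVlt; apply/orP; left; apply/eqP; field; lra.
have B2 : cabs (l * (w - z) * (v w - v z)) <= e / 3 * cabs (w - z).
  rewrite !cabsM; have ll : cabs l * cabs (w - z) <= (cabs l + 1) * cabs (w - z).
    by rewrite ler_wpM2r// lerDl.
  apply: le_trans (ler_pM _ _ ll H2b) _; rewrite ?mulr_ge0 ?cabs_ge0//.
  rewrite le_eqVlt; apply/orP; left; apply/eqP; field; lra.
have B3 : cabs (u z * (v w - v z - m * (w - z))) <= e / 3 * cabs (w - z).
  rewrite cabsM; have uu : cabs (u z) <= cabs (u z) + 1 by rewrite lerDl.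
  apply: le_trans (ler_pM _ _ uu H3) _; rewrite ?cabs_ge0//.
  rewrite le_eqVlt; apply/orP; left; apply/eqP; field; lra.
apply: le_trans (cabsD _ _) _; apply: le_trans (lerD (cabsD _ _) (lexx _)) _; lra.
Qed.

Lemma cdiff_inv z : z != 0 -> cdiff (fun w => w^-1) z (- z^-2).
Proof.
move=> z0 e e0; have cz : 0 < cabs z by rewrite cabs_gt0.
exists (Num.min (cabs z / 2) (e * cabs z ^+ 3 / 2)).
  by rewrite lt_min !divr_gt0// mulr_gt0// exprn_gt0.
move=> w; rewrite lt_min => /andP[H1 H2].
have wz : cabs z / 2 <= cabs w by have := cabs_dist z w; rewrite cabsC; lra.
have w0 : w != 0 by rewrite -cabs_gt0; lra.
rewrite (_ : _ - _ - _ = (w - z) * ((w - z) / (w * z ^+ 2))); last first.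
  by field; rewrite ?z0 ?w0.
rewrite cabsM mulrC ler_wpM2r ?cabs_ge0// cabsM cabsV ler_pdivrMr; last first.
  by rewrite cabs_gt0 mulf_neq0// expf_neq0.
rewrite cabsM expr2 cabsM; apply: ltW; apply: lt_le_trans H2 _.
rewrite (_ : e * cabs z ^+ 3 / 2 = e * ((cabs z / 2) * (cabs z * cabs z))).
  by rewrite ler_pM2l// ler_pM2r// mulr_gt0.
by field.
Qed.

Lemma cdiff_comp u v z l m : cdiff u z l -> cdiff v (u z) m ->
  cdiff (v \o u) z (m * l).
Proof.
move=> ul vm e e0.
have K1 : 0 < cabs m + 1 by rewrite ltr_wpDl// cabs_ge0.
have K2 : 0 < cabs l + 1 by rewrite ltr_wpDl// cabs_ge0.
have e1 : 0 < e / 2 / (cabs l + 1) by rewrite !divr_gt0.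
have e2 : 0 < Num.min 1 (e / 2 / (cabs m + 1)) by rewrite lt_min ltr01 !divr_gt0.
have [d1 d10 H1] := vm _ e1; have [d2 d20 H2] := ul _ e2.
exists (Num.min d2 (d1 / (cabs l + 1))); first by rewrite lt_min d20 divr_gt0.
move=> w; rewrite lt_min ltr_pdivlMr// => /andP[/H2 {}H2 wd].
have W0 := cabs_ge0 (w - z).
have H2a : cabs (u w - u z - l * (w - z)) <= cabs (w - z).
  by apply: le_trans H2 _; rewrite ler_piMl// ge_min lexx.
have H2b : cabs (u w - u z - l * (w - z)) <= e / 2 / (cabs m + 1) * cabs (w - z).
  by apply: le_trans H2 _; rewrite ler_wpM2r// ge_min lexx orbT.
have H3 : cabs (u w - u z) <= (cabs l + 1) * cabs (w - z).
  rewrite -(subrK (l * (w - z)) (u w - u z)).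
  by apply: le_trans (cabsD _ _) _; rewrite cabsM; lra.
have /H1 {}H1 : cabs (u w - u z) < d1 by apply: le_lt_trans H3 _; rewrite mulrC.
rewrite (_ : _ - _ - _ = (v (u w) - v (u z) - m * (u w - u z)) +
  m * (u w - u z - l * (w - z))); last by rewrite /=; ring.
apply: le_trans (cabsD _ _) _.
have B1 : cabs (v (u w) - v (u z) - m * (u w - u z)) <= e / 2 * cabs (w - z).
  apply: le_trans H1 _; apply: le_trans (ler_wpM2l (ltW e1) H3) _.
  rewrite le_eqVlt; apply/orP; left; apply/eqP; field; lra.
have B2 : cabs (m * (u w - u z - l * (w - z))) <= e / 2 * cabs (w - z).
  rewrite cabsM; have mm : cabs m <= cabs m + 1 by rewrite lerDl.
  apply: le_trans (ler_pM _ _ mm H2b) _; rewrite ?cabs_ge0//.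
  rewrite le_eqVlt; apply/orP; left; apply/eqP; field; lra.
lra.
Qed.

Lemma cdiff_div u v z l m : v z != 0 -> cdiff u z l -> cdiff v z m ->
  exists k, cdiff (fun w => u w / v w) z k.
Proof.
move=> vz ul vm; eexists; apply: (cdiffM ul).
exact: (@cdiff_comp v (fun w => w^-1) _ _ _ vm (cdiff_inv vz)).
Qed.

Lemma cdiff_derivable (f : C^o -> C^o) z l : cdiff f z l -> derivable f z 1.
Proof.
move=> fl; apply/cvg_ex; exists l => /= A /(@nbhs_ballP _ C^o l A)[e /= e0 eA].
have /andP[/eqP e1 e2] : (complex.Im e == 0) && (0 < complex.Re e) by move: e0; rewrite ltcE.
have e20 : 0 < complex.Re e / 2 by rewrite divr_gt0.
have [d d0 Hd] := fl _ e20.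
apply/nbhsCP; exists d => // h hd h0; apply: eA; rewrite /ball/=.
have -> : e = (complex.Re e)%:C by case: (e) e1 => a b /= ->.
rewrite subr0 in hd.
have := Hd (h + z); rewrite addrK => /(_ hd) H.
rewrite cabsE ltcR cabsC.
have -> : h^-1 *: (f (h *: (1 : C^o) + z) - f z) - l = (f (h + z) - f z - l * h) / h.
  by rewrite /GRing.scale/= mulr1 mulrBl mulfK// mulrC.
rewrite cabsM cabsV ltr_pdivrMr ?cabs_gt0//; apply: le_lt_trans H _.
rewrite ltr_pM2r ?cabs_gt0//; lra.
Qed.

(** A function whose derivative vanishes along a segment takes the same value at
    both ends: mean value theorem for its real and imaginary parts. *)
Lemma cdiff0_segment u z w :
  ccont u z -> ccont u w ->
  (forall t : R, 0 < t < 1 -> cdiff u (z + t%:C * (w - z)) 0) -> u z = u w.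
Proof.
move=> uz uw ud.
have tE (t : R) s : (z + s%:C * (w - z)) - (z + t%:C * (w - z)) = (s - t)%:C * (w - z).
  by rewrite rmorphB; ring.
suff key (P : C -> R) : (forall a b, `|P a - P b| <= cabs (a - b)) -> P (u z) = P (u w).
  apply/eqP; rewrite eq_complex; apply/andP; split; apply/eqP; apply: key => a b.
    by rewrite -raddfB; exact: Re_cabs.
  by rewrite -raddfB; exact: Im_cabs.
move=> PL; pose g (t : R) := P (u (z + t%:C * (w - z))).
have wz0 : 0 < cabs (w - z) + 1 by rewrite ltr_wpDl// cabs_ge0.
have gc (t : R) : ccont u (z + t%:C * (w - z)) -> {for t, continuous g}.
  move=> uc A /nbhs_ballP[e /= e0 eA]; have e20 : 0 < e / 2 by rewrite divr_gt0.
  have [d d0 Hd] := uc _ e20; apply/nbhs_ballP; exists (d / (cabs (w - z) + 1)).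
    by rewrite /= divr_gt0.
  move=> s; rewrite /ball/= distrC ltr_pdivlMr// => H; apply: eA.
  rewrite /ball/= distrC; apply: le_lt_trans (PL _ _) _.
  apply: le_lt_trans (Hd _ _) _; last lra.
  rewrite tE cabsM cabs_real; apply: le_lt_trans H.
  by rewrite ler_wpM2l// lerDl.
have gd (t : R) : t \in `]0, 1[ -> is_derive t 1 g 0.
  rewrite in_itv/= => /ud ut.
  have lim0 : (fun h : R => h^-1 *: ((g \o shift t) (h *: 1) - g t)) h @[h --> 0^'] --> (0 : R).
    move=> A /nbhs_ballP[e /= e0 eA].
    have e20 : 0 < e / (cabs (w - z) + 1) by rewrite divr_gt0.
    have [d d0 Hd] := ut _ e20; apply/nbhs_ballP; exists (d / (cabs (w - z) + 1)).
      by rewrite /= divr_gt0.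
    move=> h; rewrite /ball/= sub0r normrN ltr_pdivlMr// => H h0; apply: eA.
    rewrite /ball/= sub0r normrN /GRing.scale/= mulr1.
    have {}Hd := Hd (z + (h + t)%:C * (w - z)).
    rewrite tE addrK mul0r subr0 cabsM cabs_real in Hd.
    have H2 : `|h| * cabs (w - z) < d.
      by apply: le_lt_trans H; rewrite ler_wpM2l// lerDl.
    have H3 := le_trans (PL _ _) (Hd H2).
    rewrite normrM normfV ltr_pdivrMl ?normr_gt0//.
    apply: le_lt_trans H3 _.
    rewrite (_ : _ * _ = `|h| * (e * (cabs (w - z) / (cabs (w - z) + 1)))); last by ring.
    rewrite ltr_pM2l ?normr_gt0// gtr_pMr// ltr_pdivrMr// mul1r ltrDl; exact: ltr01.
  by split; [apply/cvg_ex; exists 0 | apply/cvg_lim].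
have gcI : {within `[0, 1], continuous g}.
  apply: continuous_in_subspaceT => t; rewrite inE /= in_itv/= => /andP[t0 t1].
  apply: gc; have [->|t0'] := eqVneq t 0; first by rewrite mul0r addr0.
  have [->|t1'] := eqVneq t 1; first by rewrite mul1r addrC subrK.
  by apply: cdiff_ccont; apply: ud; rewrite !lt_neqAle t0 t1 eq_sym t0' t1'.
have [c _] := MVT (@ltr01 R) gd gcI.
by rewrite mul0r /g mul0r addr0 mul1r [z + _]addrC subrK => /eqP; rewrite subr_eq0 => /eqP.
Qed.

End Calculus.

(** * Möbius transformations and the Schwarz lemma *)

Section Mobius.
Variable R : realType.
Local Notation C := R[i].
Implicit Types (z w p q a c : C) (u g : C -> C).

(** For c of modulus 1 and a in the disc these are the automorphisms of the
    disc. *)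
Definition mob c a z : C := c * (z - a) / (1 - cj a * z).

Lemma unit_conj c : cabs c = 1 -> (cj c) * c = 1.
Proof.
move=> c1; have := cabs_sqr c; rewrite c1 expr1n => H.
case: c H {c1} => a b /= H; apply/eqP; rewrite eq_complex/=.
by apply/andP; split; apply/eqP; [rewrite H|]; ring.
Qed.

Lemma mob_den_ge a z (r : R) : cabs a <= r -> cabs z <= 1 -> 1 - r <= cabs (1 - cj a * z).
Proof.
move=> ar z1; have := cabs_dist 1 (cj a * z); rewrite cabs1 cabsM cabs_conj.
have : cabs a * cabs z <= cabs a by rewrite ler_piMr// cabs_ge0.
lra.
Qed.

Lemma mob_den a z : cabs a < 1 -> cabs z <= 1 -> 1 - cj a * z != 0.
Proof.
move=> a1 z1; rewrite -cabs_gt0.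
by apply: lt_le_trans (mob_den_ge (lexx _) z1); rewrite subr_gt0.
Qed.

Lemma mob_den_le2 a z : cabs a <= 1 -> cabs z <= 1 -> cabs (1 - cj a * z) <= 2.
Proof.
move=> a1 z1; apply: le_trans (cabsB _ _) _; rewrite cabs1 cabsM cabs_conj.
have := mulr_ile1 (cabs_ge0 a) (cabs_ge0 z) a1 z1; lra.
Qed.

(** The identity which makes the disc, and its pseudo-hyperbolic distance,
    invariant under Möbius transformations. *)
Lemma mob_sqr a z : cabs (1 - cj a * z) ^+ 2 - cabs (z - a) ^+ 2 =
  (1 - cabs a ^+ 2) * (1 - cabs z ^+ 2).
Proof. by rewrite !cabs_sqr; case: a => a b; case: z => x y /=; ring. Qed.

Lemma one_sub_sqr_gt0 a : cabs a < 1 -> 0 < 1 - cabs a ^+ 2.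
Proof. by move=> a1; rewrite subr_gt0 expr_lt1// cabs_ge0. Qed.

Lemma mob_lt1 c a z : cabs c = 1 -> cabs a < 1 -> cabs z < 1 -> cabs (mob c a z) < 1.
Proof.
move=> c1 a1 z1; have d0 := mob_den a1 (ltW z1).
rewrite /mob cabsM cabsV cabsM c1 mul1r ltr_pdivrMr ?mul1r ?cabs_gt0//.
rewrite -(@ltr_pXn2r _ 2)// ?nnegrE ?cabs_ge0// -subr_gt0 mob_sqr.
by rewrite mulr_gt0// one_sub_sqr_gt0.
Qed.

Lemma mobK c a z : cabs c = 1 -> cabs a < 1 -> cabs z < 1 ->
  mob (cj c) (- (c * a)) (mob c a z) = z.
Proof.
move=> c1 a1 z1; have d0 := mob_den a1 (ltW z1); have cc := unit_conj c1.
have d2 := mob_den a1 (ltW a1).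
rewrite /mob.
have -> : (cj c) * (c * (z - a) / (1 - cj a * z) - - (c * a)) = z * (1 - cj a * a) / (1 - cj a * z).
  rewrite (_ : (cj c) * _ = cj c * c * ((z - a) / (1 - cj a * z) + a)); last by ring.
  by rewrite cc; field.
have -> : 1 - (cj (- (c * a))) * (c * (z - a) / (1 - cj a * z)) = (1 - cj a * a) / (1 - cj a * z).
  rewrite rmorphN rmorphM /= (_ : 1 - _ = 1 + cj c * c * (cj a * ((z - a) / (1 - cj a * z)))); last by ring.
  by rewrite cc; field.
by field; rewrite d0 d2.
Qed.

Lemma mobKinv c a z : cabs c = 1 -> cabs a < 1 -> cabs z < 1 ->
  mob c a (mob (cj c) (- (c * a)) z) = z.
Proof.
move=> c1 a1 z1; have cc := unit_conj c1.
have := @mobK (cj c) (- (c * a)) z; rewrite conjcK cabs_conj cabsN cabsM c1 mul1r.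
by rewrite mulrN opprK mulrA cc mul1r => ->.
Qed.

Lemma mob_cdiff c a z : cabs c = 1 -> cabs a < 1 -> cabs z < 1 ->
  exists2 l, l != 0 & cdiff (mob c a) z l.
Proof.
move=> c1 a1 z1; have d0 := mob_den a1 (ltW z1).
have dn : cdiff (fun w => c * (w - a)) z (0 * (z - a) + c * (1 + 0)).
  by apply: cdiffM; [exact: cdiff_cst|apply: cdiffD; [exact: cdiff_id|exact: cdiff_cst]].
have dd : cdiff (fun w => 1 - cj a * w) z (0 + (0 * z + (- (cj a)) * 1)).
  apply: cdiffD; first exact: cdiff_cst.
  apply: (@cdiff_local _ (fun w => - cj a * w) _ _ _ 1) => // [w _|]; first by rewrite mulNr.
  by apply: cdiffM; [exact: cdiff_cst|exact: cdiff_id].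
have := cdiffM dn (@cdiff_comp _ (fun w => 1 - cj a * w) (fun w => w^-1) z _ _ dd (cdiff_inv d0)).
set l := (X in cdiff _ _ X) => H; exists l => //.
have -> : l = c * (1 - cj a * a) / (1 - cj a * z) ^+ 2 by rewrite /l /=; field.
have c0 : c != 0 by rewrite -cabs_gt0 c1.
by rewrite mulf_neq0 ?invr_eq0 ?expf_neq0// mulf_neq0// mob_den// ltW.
Qed.

Lemma mob_ball c a (r : R) : cabs c = 1 -> cabs a < 1 -> r < 1 ->
  exists2 r', r' < 1 & forall z, cabs z <= r -> cabs (mob c a z) <= r'.
Proof.
move=> c1 a1 r1; have [r0|r0] := ltP r 0.
  by exists 0 => // z zr; have := cabs_ge0 z; lra.
pose k := (1 - cabs a ^+ 2) * (1 - r ^+ 2) / 4.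
have r21 : 0 < 1 - r ^+ 2 by rewrite subr_gt0 expr_lt1.
have a21 := one_sub_sqr_gt0 a1.
have k0 : 0 < k by rewrite divr_gt0// mulr_gt0.
exists (1 - k / 2) => [|z zr]; first lra.
have z1 : cabs z < 1 by lra.
have d0 := mob_den a1 (ltW z1); have m1 := mob_lt1 c1 a1 z1.
have D2 := mob_den_le2 (ltW a1) (ltW z1).
have D0 : 0 < cabs (1 - cj a * z) by rewrite cabs_gt0.
have H : k <= 1 - cabs (mob c a z) ^+ 2.
  rewrite /mob cabsM cabsV cabsM c1 mul1r exprMn exprVn.
  rewrite -(mulfV (lt0r_neq0 (exprn_gt0 2 D0))) -mulrBl mob_sqr ler_pdivlMr ?exprn_gt0//.
  have D4 : cabs (1 - cj a * z) ^+ 2 <= 4.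
    by rewrite (_ : 4 = 2 ^+ 2) ?ler_pXn2r ?nnegrE ?cabs_ge0//; ring.
  apply: le_trans (ler_wpM2l (ltW k0) D4) _; rewrite /k divfK// ler_pM2l//.
  by rewrite lerB// ler_pXn2r ?nnegrE ?cabs_ge0.
have k4 : k <= 1 by have := sqr_ge0 (cabs (mob c a z)); lra.
rewrite -(@ler_pXn2r _ 2)// ?nnegrE ?cabs_ge0//; last lra.
have -> : (1 - k / 2) ^+ 2 = 1 - k + k ^+ 2 / 4 by field.
have := sqr_ge0 k; lra.
Qed.

Lemma unit_conjE c : cabs c = 1 -> (cj c) = c^-1.
Proof.
move=> c1; have c0 : c != 0 by rewrite -cabs_gt0 c1.
by apply: (mulIf c0); rewrite unit_conj// mulVf.
Qed.

Lemma mob_normal_form c p q : cabs c = 1 -> cabs p < 1 -> cabs q < 1 ->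
  exists c' a, [/\ cabs c' = 1, cabs a < 1 &
    forall z, cabs z < 1 -> mob 1 (- q) (c * mob 1 p z) = mob c' a z].
Proof.
move=> c1 p1 q1; have c0 : c != 0 by rewrite -cabs_gt0 c1.
have cE := unit_conjE c1.
have cq1 : cabs (cj c * q) < 1 by rewrite cabsM cabs_conj c1 mul1r.
have cqE : (cj (cj c * q)) = c * (cj q) by rewrite rmorphM /= conjcK.
pose D := 1 - c * cj q * p.
have D0 : D != 0 by rewrite /D -cqE; apply: mob_den => //; exact: ltW.
have DcE : (cj D) = 1 - c^-1 * q * (cj p).
  by rewrite /D rmorphB rmorph1 !rmorphM /= conjcK cE.
have Dc0 : (cj D) != 0 by rewrite conjc_eq0.
pose a := (p - c^-1 * q) / (cj D).
have acE : (cj a) = (cj p - c * (cj q)) / D.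
  by rewrite /a -cE rmorphM fmorphV /= conjcK rmorphB /= cqE.
have a1 : cabs a < 1.
  have := mob_lt1 (cabs1 R) cq1 p1; rewrite /mob cqE mul1r -/D cE.
  by rewrite cabsM cabsV -(cabs_conj D) -cabsV -cabsM.
exists (c * (cj D / D)), a; split=> // [|z z1].
  by rewrite !cabsM c1 mul1r cabsV cabs_conj mulfV// gt_eqF// cabs_gt0.
have E1 := mob_den a1 (ltW z1).
have E2 := mob_den p1 (ltW z1).
have m1 : cabs (c * mob 1 p z) < 1.
  by rewrite cabsM c1 mul1r; apply: mob_lt1 => //; exact: cabs1.
have Nq1 : cabs (- q) < 1 by rewrite cabsN.
have E3 := mob_den Nq1 (ltW m1).
have E4 : D - (cj p - c * (cj q)) * z != 0.
  by have := mulf_neq0 D0 E1; rewrite acE mulrBr mulr1 mulrA [D * _]mulrC divfK.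
have -> : mob (c * (cj D / D)) a z = c * (cj D * z - (p - c^-1 * q)) / (D - (cj p - c * (cj q)) * z).
  rewrite /mob acE /a; move: (cj D) (D) Dc0 D0 E4 => x y x0 y0 E4.
  by field; rewrite x0 y0 c0 E4.
rewrite /mob rmorphN /= in E3 *.
have -> : 1 - - cj q * (c * (1 * (z - p) / (1 - cj p * z))) =
   (D - (cj p - c * (cj q)) * z) / (1 - cj p * z) by rewrite /D; field.
rewrite DcE; field; rewrite c0 E2.
by rewrite E4.
Qed.

Lemma mob0 c a : mob c a 0 = - (c * a).
Proof. by rewrite /mob mulr0 subr0 divr1 sub0r mulrN. Qed.

Lemma moba c a : mob c a a = 0.
Proof. by rewrite /mob subrr mulr0 mul0r. Qed.

(** If l were nonzero, moving z in the direction u z / l would increase the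
    modulus of u at first order. *)
Lemma unimodular_cdiff u z l (d0 : R) : 0 < d0 ->
  (forall w, cabs (w - z) < d0 -> cabs (u w) = 1) -> cdiff u z l -> l = 0.
Proof.
move=> d00 u1 ul; apply/eqP; rewrite -[_ == _]negbK; apply/negP => l0.
have lp : 0 < cabs l by rewrite cabs_gt0.
have uz : cabs (u z) = 1 by apply: u1; rewrite subrr cabs0.
have l2 : 0 < cabs l / 2 by rewrite divr_gt0.
have [d dp Hd] := ul _ l2.
pose t := Num.min d d0 * cabs l / 2.
have m0 : 0 < Num.min d d0 by rewrite lt_min dp.
have t0 : 0 < t by rewrite divr_gt0// mulr_gt0.
pose w := z + t%:C * (u z / l).
have wz : w - z = t%:C * (u z / l) by rewrite /w addrC addKr.
have cwz : cabs (w - z) = Num.min d d0 / 2.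
  rewrite wz !cabsM cabsV uz mul1r cabs_real ger0_norm ?ltW// /t.
  by field; rewrite gt_eqF.
have : cabs (w - z) < Num.min d d0 by rewrite cwz; lra.
rewrite lt_min => /andP[/Hd {}Hd /u1 uw].
have lwz : l * (w - z) = t%:C * u z by rewrite wz; field.
rewrite lwz cwz (_ : _ - _ - _ = - ((1 + t)%:C * u z - u w)) in Hd; last by rewrite rmorphD; ring.
rewrite cabsN in Hd.
have := le_trans (cabs_dist _ _) Hd; rewrite cabsM uz uw cabs_real ger0_norm; last lra.
have tE : cabs l / 2 * (Num.min d d0 / 2) = t / 2 by rewrite /t; ring.
rewrite tE; move: t0; clear; lra.
Qed.

(** The maximum principle applies to g z / z and, g being proper with the origin
    as its only zero, to z / g z; both have modulus 1 towards the circle. So the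
    quotient is unimodular, hence constant. *)
Lemma schwarz_proper g l :
  g 0 = 0 -> cdiff g 0 l -> l != 0 ->
  (forall z, cabs z < 1 -> cabs (g z) < 1) ->
  (forall z, cabs z < 1 -> exists k, cdiff g z k) ->
  (forall z, cabs z < 1 -> z != 0 -> g z != 0) ->
  (forall r, r < 1 -> exists2 r', r' < 1 &
     forall z, r' <= cabs z < 1 -> r <= cabs (g z)) ->
  exists2 c, cabs c = 1 & forall z, cabs z < 1 -> g z = c * z.
Proof.
move=> g0 gl l0 gD gd gn gp.
pose u z := if z == 0 then l else g z / z.
pose v z := if z == 0 then l^-1 else z / g z.
have near0 z : z != 0 -> exists2 d : R, 0 < d & forall w, cabs (w - z) < d -> w != 0.
  move=> z0; exists (cabs z); first by rewrite cabs_gt0.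
  move=> w; apply: contraTneq => ->; by rewrite sub0r cabsN ltxx.
have lp : 0 < cabs l by rewrite cabs_gt0.
have udiff z : z != 0 -> cabs z < 1 -> exists k, cdiff u z k.
  move=> z0 z1; have [m gm] := gd z z1.
  have [k uk] := cdiff_div z0 gm (cdiff_id z).
  have [d d0 Hd] := near0 z z0; exists k; apply: cdiff_local d0 _ uk => w /Hd.
  by rewrite /u => /negbTE ->.
have vdiff z : z != 0 -> cabs z < 1 -> exists k, cdiff v z k.
  move=> z0 z1; have [m gm] := gd z z1.
  have [k uk] := cdiff_div (gn z z1 z0) (cdiff_id z) gm.
  have [d d0 Hd] := near0 z z0; exists k; apply: cdiff_local d0 _ uk => w /Hd.
  by rewrite /v => /negbTE ->.
have uc0 : ccont u 0.
  move=> e e0; have [d d0 Hd] := gl e e0; exists d => // w /Hd.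
  rewrite /u eqxx subr0 g0 subr0; case: eqVneq => [_ _|w0].
    by rewrite subrr cabs0 ltW.
  rewrite (_ : g w / w - l = (g w - l * w) / w); last by field.
  by rewrite cabsM cabsV ler_pdivrMr ?cabs_gt0.
have vE z : v z = (u z)^-1.
  by rewrite /v /u; case: eqP => // _; rewrite invf_div.
have vc0 : ccont v 0.
  have u00 : u 0 != 0 by rewrite /u eqxx.
  have inv := cdiff_ccont (cdiff_inv u00).
  move=> e e0; have [d d0 Hd] := inv e e0.
  have d20 : 0 < d / 2 by rewrite divr_gt0.
  have [k k0 Hk] := uc0 _ d20; exists k => // w /Hk H.
  rewrite !vE; apply: Hd; lra.
have cc (f : C -> C) : ccont f 0 -> (forall z, z != 0 -> cabs z < 1 -> exists k, cdiff f z k) ->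
    forall z, cabs z < 1 -> ccont f z.
  move=> f0 fd z z1; have [->//|z0] := eqVneq z 0.
  by have [k] := fd z z0 z1; exact: cdiff_ccont.
have inve (e : R) : 0 < e -> 0 < (1 + e)^-1 < 1.
  by move=> e0; rewrite invr_gt0 invf_lt1 ?addr_gt0// ltrDl e0 andbT.
have u1 : forall z, cabs z < 1 -> cabs (u z) <= 1.
  apply: max_principle => //; first exact: cc.
  move=> e e0; have /andP[i0 i1] := inve e e0; exists (1 + e)^-1 => // z /andP[z0 z1].
  have cz : 0 < cabs z by lra.
  rewrite /u -cabs_eq0 gt_eqF// cabsM cabsV ler_pdivrMr//.
  apply: le_trans (ltW (gD z z1)) _.
  by rewrite -ler_pdivrMl ?mulr1// addr_gt0.
have v1 : forall z, cabs z < 1 -> cabs (v z) <= 1.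
  apply: max_principle => //; first exact: cc.
  move=> e e0; have /andP[i0 i1] := inve e e0; have [r r1 Hr] := gp _ i1.
  exists (Num.max r 2^-1); first by rewrite gt_max r1 invf_lt1// ltr1n.
  move=> z /andP[]; rewrite ge_max => /andP[rz hz] z1.
  have cz : 0 < cabs z by lra.
  have gz : (1 + e)^-1 <= cabs (g z) by apply: Hr; rewrite rz.
  have gz0 : 0 < cabs (g z) by lra.
  rewrite /v -cabs_eq0 gt_eqF// cabsM cabsV ler_pdivrMr//.
  apply: le_trans (ltW z1) _.
  by rewrite -ler_pdivrMl ?mulr1// addr_gt0.
have un z : cabs z < 1 -> cabs (u z) = 1.
  move=> z1; apply/eqP; rewrite eq_le u1//=.
  have : 0 < cabs (u z).
    rewrite cabs_gt0 /u; case: ifPn => // z0.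
    by apply: mulf_neq0; [exact: gn|rewrite invr_eq0].
  have := v1 z z1; rewrite vE cabsV => + uz.
  by rewrite -[X in _ <= X]invr1 lef_pV2 ?posrE.
exists l; first by have := un 0; rewrite cabs0 ltr01 /u eqxx => ->.
move=> z z1; have [->|z0] := eqVneq z 0; first by rewrite g0 mulr0.
have : u 0 = u z.
  apply: cdiff0_segment => //; first exact: cc udiff _ z1.
  move=> t /andP[t0 t1]; rewrite add0r subr0.
  have tz1 : cabs (t%:C * z) < 1.
    rewrite cabsM cabs_real ger0_norm ?ltW//.
    by rewrite mulr_ilt1 ?cabs_ge0// ltW.
  have tz0 : t%:C * z != 0 by rewrite -cabs_gt0 cabsM cabs_real mulr_gt0 ?cabs_gt0// normr_gt0 gt_eqF.
  have [k uk] := udiff _ tz0 tz1.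
  have dp : 0 < 1 - cabs (t%:C * z) by rewrite subr_gt0.
  have <- // : k = 0.
  apply: (unimodular_cdiff dp) uk => w wd; apply: un.
  by have := cabs_dist w (t%:C * z); lra.
rewrite {1}/u eqxx /u (negbTE z0) => ->.
by rewrite mulfVK.
Qed.

End Mobius.

(** * Proper injective holomorphic maps *)

Section Disc.
Variable R : realType.
Local Notation C := R[i].
Local Notation disc := (disc R).
Implicit Types (z : disc) (f : disc -> disc).

Definition dval z : C := \val z.

Lemma dval_lt1 z : cabs (dval z) < 1.
Proof. by have : `|\val z| < 1 := set_valP z; rewrite cabsE ltcR. Qed.

Lemma in_disc (w : C) : cabs w < 1 -> [set z : C^o | `|z| < 1] w.
Proof. by rewrite /= cabsE ltcR. Qed.

Definition mkdisc (w : C) (w1 : cabs w < 1) : disc := SigSub (mem_set (in_disc w1)).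

Lemma dval_inj : injective dval. Proof. exact: val_inj. Qed.

Lemma disc_exists (w : C) : cabs w < 1 -> exists z, dval z = w.
Proof. by move=> w1; exists (mkdisc w1). Qed.

Lemma dval0 : dval (disc_zero R) = 0. Proof. by []. Qed.

Lemma disc_extD f z : disc_ext f (dval z) = dval (f z).
Proof. exact: disc_extE. Qed.

Lemma holomorphic_cdiff f z : holomorphic f -> exists l, cdiff (disc_ext f) (dval z) l.
Proof. by move=> fh; exact: derivable_cdiff (fh z). Qed.

Lemma cdiff_holomorphic f (F : C -> C) :
  (forall z, dval (f z) = F (dval z)) ->
  (forall z : C, cabs z < 1 -> exists l, cdiff F z l) -> holomorphic f.
Proof.
move=> fF Fd z; have [l Fl] := Fd _ (dval_lt1 z).
apply: (@cdiff_derivable _ _ _ l).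
have d0 : 0 < 1 - cabs (dval z) by rewrite subr_gt0 dval_lt1.
apply: cdiff_local d0 _ Fl => w wz.
have [|w' <-] := @disc_exists w; first by have := cabs_dist w (dval z); lra.
by rewrite disc_extD fF.
Qed.

(** Properness, the disc being exhausted by closed balls. *)
Definition proper_map f := forall r : R, r < 1 -> exists2 r', r' < 1 &
  forall z, cabs (dval (f z)) <= r -> cabs (dval z) <= r'.

(** The derivative of f cannot vanish along a whole segment, f being injective.
    Möbius transformations move a point where it does not vanish, and its image,
    to the origin, where [schwarz_proper] applies. *)
Theorem proper_injective_mobius f : holomorphic f -> injective f -> proper_map f ->
  exists c a, [/\ cabs c = 1, cabs a < 1 & forall z, dval (f z) = mob c a (dval z)].
Proof.
move=> fh fi fp; pose F := disc_ext f.
have Fd (z : C) : cabs z < 1 -> exists l, cdiff F z l.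
  by move=> /disc_exists[w <-]; exact: holomorphic_cdiff.
have F1 (z : C) : cabs z < 1 -> cabs (F z) < 1.
  by move=> /disc_exists[w <-]; rewrite /F disc_extD dval_lt1.
have Fi (z w : C) : cabs z < 1 -> cabs w < 1 -> F z = F w -> z = w.
  move=> /disc_exists[z' <-] /disc_exists[w' <-].
  by rewrite /F !disc_extD => /dval_inj/fi ->.
have [p p1 [lp lp0 Fp]] : exists2 p : C, cabs p < 1 & exists2 l, l != 0 & cdiff F p l.
  apply: contrapT => no.
  have h1 : cabs (2^-1)%:C < 1 :> R by rewrite cabs_real ger0_norm; lra.
  have z1 : cabs 0 < 1 :> R by rewrite cabs0.
  have : F 0 = F (2^-1)%:C.
    have cc (z : C) : cabs z < 1 -> ccont F z by move=> /Fd[l]; exact: cdiff_ccont.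
    apply: cdiff0_segment; [exact: (cc _ z1)|exact: (cc _ h1)|move=> t /andP[t0 t1]].
    have t2 : cabs (0 + t%:C * ((2^-1)%:C - 0)) < 1.
      rewrite add0r subr0 cabsM !cabs_real !ger0_norm; lra.
    have [l Fl] := Fd _ t2; have [l0|l0] := eqVneq l 0; first by rewrite l0 in Fl.
    by exfalso; apply: no; exists (0 + t%:C * ((2^-1)%:C - 0)) => //; exists l.
  move=> /(Fi _ _ z1 h1)/eqP; rewrite eq_complex/= => /andP[/eqP H _]; lra.
pose q := F p; have q1 : cabs q < 1 by exact: F1.
have one1 : cabs (1 : C) = 1 by exact: cabs1.
have Np1 : cabs (- p) < 1 by rewrite cabsN.
pose g (z : C) := mob 1 q (F (mob 1 (- p) z)).
have z1 : cabs (0 : C) < 1 by rewrite cabs0.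
have mp0 : mob 1 (- p) 0 = p by rewrite mob0 mul1r opprK.
have g0 : g 0 = 0 by rewrite /g mp0 -/q moba.
have m1 (z : C) : cabs z < 1 -> cabs (mob 1 (- p) z) < 1 by exact: mob_lt1.
have [l1 l10 D1] := mob_cdiff one1 Np1 z1.
have [l2 l20 D2] := mob_cdiff one1 q1 q1.
have gd (z : C) : cabs z < 1 -> exists k, cdiff g z k.
  move=> zz; have [k1 _ E1] := mob_cdiff one1 Np1 zz.
  have [k2 E2] := Fd _ (m1 z zz).
  have [k3 _ E3] := mob_cdiff one1 q1 (F1 _ (m1 z zz)).
  by eexists; exact: (@cdiff_comp _ (F \o mob 1 (- p)) (mob 1 q) z _ _ (cdiff_comp E1 E2) E3).
have gl : cdiff g 0 (l2 * (lp * l1)).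
  apply: (@cdiff_comp _ (F \o mob 1 (- p)) (mob 1 q) 0); last by rewrite /= mp0.
  by apply: (cdiff_comp D1); rewrite mp0.
have [||||c c1 gE] := schwarz_proper g0 gl _ _ gd.
- by rewrite !mulf_neq0.
- by move=> z zz; apply: mob_lt1 => //; apply: F1; exact: m1.
- move=> z zz; apply: contra => /eqP gz0.
  have : mob 1 (- p) z = mob 1 (- p) 0.
    rewrite mp0; apply: Fi => //; first exact: m1.
    rewrite -/q -(mobK one1 q1 (F1 _ (m1 z zz))) -/(g z) gz0.
    by rewrite -{2}(mobK one1 q1 q1) moba.
  by move=> /(congr1 (mob (cj 1) (- (1 * - p)))); rewrite !mobK// => ->.
- move=> r r1.
  have Nq1 : cabs (- (1 * q)) < 1 by rewrite mul1r cabsN.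
  have c11 : cabs ((cj 1) : C) = 1 by rewrite cabs_conj.
  have [r2 r21 H2] := mob_ball c11 Nq1 r1.
  have [r3 r31 H3] := fp _ r21.
  have Npp1 : cabs (- (1 * - p)) < 1 by rewrite mul1r opprK.
  have [r4 r41 H4] := mob_ball c11 Npp1 r31.
  exists (Num.max 0 ((1 + r4) / 2)); first by rewrite gt_max ltr01/=; lra.
  move=> z /andP[rz zz]; rewrite leNgt; apply/negP => gr.
  have Fz : cabs (F (mob 1 (- p) z)) <= r2.
    by rewrite -(mobK one1 q1 (F1 _ (m1 z zz))); apply: H2; exact: ltW.
  have [w wE] := disc_exists (m1 z zz).
  have : cabs (dval w) <= r3 by apply: H3; rewrite -disc_extD wE.
  rewrite wE => /H4; rewrite mobK// => zr4.
  move: rz; rewrite ge_max => /andP[_]; lra.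
have [c' [a [c'1 a1 nf]]] := mob_normal_form c1 p1 q1.
exists c', a; split=> // z; set x := dval z; have x1 : cabs x < 1 by exact: dval_lt1.
have px1 : cabs (mob 1 p x) < 1 by exact: mob_lt1.
rewrite -nf// -gE// /g.
have := mobK one1 p1 x1; rewrite mul1r conjc1 => ->.
have := mobK one1 q1 (F1 _ x1); rewrite mul1r conjc1 => ->.
by rewrite /F /x disc_extD.
Qed.

End Disc.

(** * The pseudo-hyperbolic distance *)

Section DiscTopology.
Variable R : realType.
Local Notation C := R[i].
Local Notation disc := (disc R).
Implicit Types (f : disc -> disc).

Lemma nbhs_discP (z : disc) (A : set disc) :
  nbhs z A <-> exists2 d : R, 0 < d & forall w, cabs (dval w - dval z) < d -> A w.
Proof.
split=> [|[d d0 dA]].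
  rewrite nbhsE => -[_ [[V oV <-] Vz] VA].
  have /nbhsCP[d d0 dV] : nbhs (dval z : C^o) V by rewrite nbhsE; exists V.
  by exists d => // w wz; apply: VA; exact: dV.
have cv : {for z, continuous (set_val : disc -> C^o)} by exact: initial_continuous.
have : nbhs (set_val z : C^o) [set w | cabs (w - dval z) < d] by apply/nbhsCP; exists d.
move=> /cv H; have {}H : nbhs z [set w : disc | cabs (dval w - dval z) < d] by exact: H.
by apply: filterS H => w; exact: dA.
Qed.

Lemma dval_continuous : continuous (@dval R : disc -> C^o).
Proof. exact: initial_continuous. Qed.

Lemma holomorphic_continuous f : holomorphic f -> continuous f.
Proof.
move=> fh z A /nbhs_discP[e e0 eA]; apply/nbhs_discP.
have [l /cdiff_ccont fc] := holomorphic_cdiff z fh.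
have e20 : 0 < e / 2 by rewrite divr_gt0.
have [d d0 Hd] := fc _ e20; exists d => // w /Hd; rewrite !disc_extD => H.
by apply: eA; lra.
Qed.

Lemma compact_disc_ball (r : R) : r < 1 -> compact [set z : disc | cabs (dval z) <= r].
Proof.
move=> r1 F PF FA.
have PF' : ProperFilter ((@dval R : disc -> C^o) @ F) by exact: fmap_proper_filter.
have [|p [/= pr pcl]] := @compact_cball R r _ PF'; first exact: FA.
have p1 : cabs p < 1 by lra.
exists (mkdisc p1); split => //= A B FB /nbhs_discP[d d0 dB].
have : nbhs (p : C^o) [set w | cabs (w - p) < d] by apply/nbhsCP; exists d.
have FA' : F (@dval R @^-1` (@dval R @` A)) by apply: filterS FB => w Aw; exists w.
move=> /(pcl _ _ FA')[_ [[w Aw <-] wp]]; exists w; split => //; exact: dB.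
Qed.

(** The preimage of a closed ball by f is its image by q, on which the modulus
    has a maximum. *)
Lemma continuous_inverse_proper f q : continuous q -> cancel f q -> proper_map f.
Proof.
move=> qc fK r r1; have [r0|r0] := ltP r 0.
  by exists 0 => // z zr; have := cabs_ge0 (dval (f z)); lra.
have ne : [set z : disc | cabs (dval z) <= r] !=set0.
  by exists (disc_zero R); rewrite /mkset dval0 cabs0.
have cq : {within [set z : disc | cabs (dval z) <= r],
    continuous (@cabs R \o @dval R \o q)}.
  apply: continuous_subspaceT => z; apply: continuous_comp; first exact: qc.
  by apply: continuous_comp; [exact: dval_continuous|exact: cabs_continuous].
have [p pI pm] := compact_EVT_max ne (compact_disc_ball r1) cq.
exists (cabs (dval (q p))); first exact: dval_lt1.
by move=> z zr; have := pm (f z); rewrite inE /= fK; exact.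
Qed.

Lemma aut_mobius (g : Aut R) : exists c a,
  [/\ cabs c = 1, cabs a < 1 & forall z, dval (g z) = mob c a (dval z)].
Proof.
have [gh [g' [g'h gK g'K]]] := aut_biholomorphic g.
apply: proper_injective_mobius => //; first exact: can_inj gK.
exact: continuous_inverse_proper (holomorphic_continuous g'h) gK.
Qed.

Lemma mob_biholomorphic f c a : cabs c = 1 -> cabs a < 1 ->
  (forall z, dval (f z) = mob c a (dval z)) -> biholomorphic f.
Proof.
move=> c1 a1 fE.
have cc1 : cabs (cj c) = 1 by rewrite cabs_conj.
have ca1 : cabs (- (c * a)) < 1 by rewrite cabsN cabsM c1 mul1r.
have hol f' c' a' : cabs c' = 1 -> cabs a' < 1 ->
    (forall z, dval (f' z) = mob c' a' (dval z)) -> holomorphic f'.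
  move=> c'1 a'1 f'E; apply: (@cdiff_holomorphic _ _ (mob c' a')) => // z z1.
  by have [l _ ml] := mob_cdiff c'1 a'1 z1; exists l.
split; first exact: hol fE.
pose g (z : disc) := mkdisc (mob_lt1 cc1 ca1 (dval_lt1 z)).
have gE z : dval (g z) = mob (cj c) (- (c * a)) (dval z) by [].
exists g; split; first exact: hol gE.
- by move=> z; apply: dval_inj; rewrite gE fE mobK// dval_lt1.
- by move=> z; apply: dval_inj; rewrite fE gE mobKinv// dval_lt1.
Qed.

(** Such a map is a Möbius transformation, whose inverse is one too. *)
Lemma proper_aut f : holomorphic f -> injective f -> proper_map f -> biholomorphic f.
Proof.
move=> fh fi fp; have [c [a [c1 a1 fE]]] := proper_injective_mobius fh fi fp.
exact: mob_biholomorphic c1 a1 fE.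
Qed.

(** Pseudo-hyperbolic distance. *)
Definition phdist (z w : disc) : R := cabs (mob 1 (dval z) (dval w)).

Lemma phdistE z w : phdist z w = cabs (dval w - dval z) / cabs (1 - cj (dval z) * dval w).
Proof. by rewrite /phdist /mob mul1r cabsM cabsV. Qed.

Lemma phdist_ge0 z w : 0 <= phdist z w. Proof. exact: cabs_ge0. Qed.
Lemma phdist_lt1 z w : phdist z w < 1.
Proof. by rewrite /phdist mob_lt1 ?cabs1// dval_lt1. Qed.

Lemma phdistxx (x : disc) : phdist x x = 0.
Proof. by rewrite phdistE subrr cabs0 mul0r. Qed.

Lemma phdist_eq0 z w : phdist z w = 0 -> z = w.
Proof.
rewrite phdistE => /eqP; rewrite mulf_eq0 invr_eq0 !cabs_eq0.
rewrite (negbTE (mob_den (dval_lt1 z) (ltW (dval_lt1 w)))) orbF subr_eq0.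
by move=> /eqP/dval_inj.
Qed.

Lemma phdistC z w : phdist z w = phdist w z.
Proof.
rewrite !phdistE cabsC -[X in _ / X]cabs_conj; congr (_ / cabs _).
by rewrite rmorphB rmorphM rmorph1 /= conjcK mulrC.
Qed.

Lemma phdist_mob c a (z w z' w' : disc) : cabs c = 1 -> cabs a < 1 ->
  dval z' = mob c a (dval z) -> dval w' = mob c a (dval w) ->
  phdist z' w' = phdist z w.
Proof.
move=> c1 a1 zE wE; rewrite !phdistE zE wE.
have z1 := mob_den a1 (ltW (dval_lt1 z)).
have w1 := mob_den a1 (ltW (dval_lt1 w)).
have a2 := mob_den a1 (ltW a1).
have zw := mob_den (dval_lt1 z) (ltW (dval_lt1 w)).
have c0 : c != 0 by rewrite -cabs_gt0 c1.
set x := dval z in z1 zw *; set y := dval w in w1 zw *.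
have zc1 : 1 - a * cj x != 0.
  have := z1; rewrite -conjc_eq0 rmorphB rmorphM rmorph1 /= conjcK.
  by [].
have -> : mob c a y - mob c a x =
    c * (1 - cj a * a) * (y - x) / ((1 - cj a * x) * (1 - cj a * y)).
  by rewrite /mob; field; rewrite z1 w1.
have -> : 1 - cj (mob c a x) * mob c a y =
    (1 - cj a * a) * (1 - cj x * y) / ((1 - a * cj x) * (1 - cj a * y)).
  rewrite /mob !rmorphM fmorphV !rmorphB rmorph1 rmorphM /= conjcK (unit_conjE c1).
  by field; rewrite w1 zc1 c0.
have cz : cabs (1 - a * cj x) = cabs (1 - cj a * x).
  by rewrite -cabs_conj rmorphB rmorphM rmorph1 /= conjcK.
rewrite !cabsM !cabsV !cabsM cz c1 mul1r.
by field; rewrite !gt_eqF ?cabs_gt0.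
Qed.

Lemma phdist_aut (g : Aut R) z w : phdist (g z) (g w) = phdist z w.
Proof. by have [c [a [c1 a1 gE]]] := aut_mobius g; exact: phdist_mob (gE z) (gE w). Qed.

Lemma phdist_sqr z w : (1 - phdist z w ^+ 2) * cabs (1 - cj (dval z) * dval w) ^+ 2 =
  (1 - cabs (dval z) ^+ 2) * (1 - cabs (dval w) ^+ 2).
Proof.
rewrite -mob_sqr phdistE expr_div_n mulrBl mul1r divfK// expf_neq0//.
by rewrite gt_eqF// cabs_gt0 mob_den ?dval_lt1// ltW ?dval_lt1.
Qed.

(** In place of the triangle inequality: once x is moved to the origin, the
    pseudo-hyperbolic and the Euclidean distances of points close to it are
    comparable. *)
Lemma phdist_tri x y z (e : R) : e <= 2^-1 ->
  phdist x y < e -> phdist x z < e -> phdist y z < 3 * e.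
Proof.
move=> e2; pose m (w : disc) := mkdisc (mob_lt1 (cabs1 R) (dval_lt1 x) (dval_lt1 w)).
have mE (w : disc) : dval (m w) = mob 1 (dval x) (dval w) by [].
rewrite -(phdist_mob (cabs1 R) (dval_lt1 x) (mE y) (mE z)) /phdist -!mE.
move=> ye ze; rewrite -/(phdist _ _) phdistE; set u := dval (m y) in ye *; set v := dval (m z) in ze *.
have e0 : 0 < e by apply: le_lt_trans ye; exact: cabs_ge0.
have uv : cabs (cj u * v) <= 2^-1 * 2^-1.
  by rewrite cabsM cabs_conj ler_pM ?cabs_ge0// ltW//; [exact: lt_le_trans ye _|exact: lt_le_trans ze _].
have d : 3 / 4 <= cabs (1 - cj u * v).
  by have := cabs_dist 1 (cj u * v); rewrite cabs1; lra.
rewrite ltr_pdivrMr; last lra.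
apply: le_lt_trans (cabsB _ _) _.
have : 3 * e * (3 / 4) <= 3 * e * cabs (1 - cj u * v) by rewrite ler_pM2l// mulr_gt0.
lra.
Qed.

Lemma phdist_le z w : cabs (dval w - dval z) <= 2 * phdist z w.
Proof.
rewrite phdistE mulrA ler_pdivlMr; last first.
  by rewrite cabs_gt0 mob_den ?dval_lt1// ltW ?dval_lt1.
rewrite mulrC ler_wpM2r ?cabs_ge0//; apply: le_trans (cabsB _ _) _.
rewrite cabs1 cabsM cabs_conj.
have := mulr_ile1 (cabs_ge0 (dval z)) (cabs_ge0 (dval w)) (ltW (dval_lt1 z)) (ltW (dval_lt1 w)).
lra.
Qed.

Lemma nbhs_phdistP (z : disc) (A : set disc) :
  nbhs z A <-> exists2 d : R, 0 < d & forall w, phdist z w < d -> A w.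
Proof.
split=> [/nbhs_discP[d d0 dA]|[d d0 dA]].
  exists (d / 2); first by rewrite divr_gt0.
  by move=> w zw; apply: dA; apply: le_lt_trans (phdist_le _ _) _; lra.
have z0 : 0 < 1 - cabs (dval z) by rewrite subr_gt0 dval_lt1.
apply/nbhs_discP; exists (d * (1 - cabs (dval z))); first by rewrite mulr_gt0.
move=> w wz; apply: dA; rewrite phdistE ltr_pdivrMr; last first.
  by rewrite cabs_gt0 mob_den ?dval_lt1// ltW ?dval_lt1.
apply: lt_le_trans wz _; rewrite ler_pM2l//.
have := cabs_dist 1 (cj (dval z) * dval w); rewrite cabs1 cabsM cabs_conj.
have : cabs (dval z) * cabs (dval w) <= cabs (dval z).
  by rewrite ler_piMr ?cabs_ge0// ltW ?dval_lt1.
lra.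
Qed.

(** Towards the circle, a pseudo-hyperbolic displacement bounded away from 1 is
    small in the Euclidean sense, so that g extends by the identity to the
    circle; and a Möbius transformation fixing three points is the identity. *)
Lemma bounded_displacement (g : Aut R) (e : R) : e < 1 ->
  (forall z, phdist z (g z) <= e) -> g = 1%g.
Proof.
move=> e1 ge; have [c [a [c1 a1 gE]]] := aut_mobius g.
have e0 : 0 <= e by apply: le_trans (ge (disc_zero R)); exact: phdist_ge0.
(* the zeros of p are the fixed points of g *)
pose p (z : C) : C := z * (1 - cj a * z) - c * (z - a).
have e2 : 0 < 1 - e ^+ 2 by rewrite subr_gt0 expr_lt1.
have near_circle (zeta : C) (t : R) : cabs zeta = 1 -> 0 <= t < 1 ->
    cabs (p (t%:C * zeta)) ^+ 2 <= 8 * (1 - t) / (1 - e ^+ 2).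
  move=> zeta1 /andP[t0 t1].
  have tz : cabs (t%:C * zeta) = t by rewrite cabsM zeta1 mulr1 cabs_real ger0_norm.
  have [|z zE] := @disc_exists _ (t%:C * zeta); first by rewrite tz.
  have D0 := mob_den a1 (ltW (dval_lt1 z)).
  have pE : p (dval z) = (dval z - dval (g z)) * (1 - cj a * dval z).
    by rewrite gE /mob /p; field.
  have D2 : cabs (1 - cj a * dval z) ^+ 2 <= 4.
    have H := mob_den_le2 (ltW a1) (ltW (dval_lt1 z)).
    by rewrite (_ : 4 = 2 ^+ 2) ?ler_pXn2r ?nnegrE ?cabs_ge0//; ring.
  set w := dval (g z) in pE.
  have K : cabs (dval z - w) ^+ 2 <= (1 - t ^+ 2) / (1 - e ^+ 2).
    have Q0 : 0 <= cabs (1 - cj (dval z) * w) ^+ 2 by exact: sqr_ge0.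
    have K1 : cabs (dval z - w) ^+ 2 <= cabs (1 - cj (dval z) * w) ^+ 2.
      have := mob_sqr (dval z) w; rewrite [cabs (w - _)]cabsC.
      have := mulr_gt0 (one_sub_sqr_gt0 (dval_lt1 z)) (one_sub_sqr_gt0 (dval_lt1 (g z))).
      by rewrite -/w => *; lra.
    apply: le_trans K1 _; rewrite ler_pdivlMr// mulrC.
    have := phdist_sqr z (g z); rewrite -/w zE tz => HH.
    have PP : phdist z (g z) ^+ 2 <= e ^+ 2 by rewrite ler_pXn2r ?nnegrE ?phdist_ge0.
    have : (1 - e ^+ 2) * cabs (1 - cj (dval z) * w) ^+ 2 <=
           (1 - phdist z (g z) ^+ 2) * cabs (1 - cj (dval z) * w) ^+ 2.
      by rewrite ler_wpM2r// lerB.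
    rewrite zE HH => /le_trans; apply; rewrite ler_piMr//.
      by rewrite subr_ge0 expr_le1// ltW.
    by rewrite gerBl sqr_ge0.
  rewrite -zE pE cabsM exprMn.
  apply: le_trans (ler_pM _ _ K D2) _; rewrite ?sqr_ge0//.
  rewrite mulrAC ler_pM2r ?invr_gt0//.
  have -> : 1 - t ^+ 2 = (1 - t) * (1 + t) by ring.
  have H : (1 - t) * (1 + t) <= (1 - t) * 2 by rewrite ler_pM2l; lra.
  lra.
have p0 (zeta : C) : cabs zeta = 1 -> p zeta = 0.
  move=> zeta1; apply/eqP; rewrite -cabs_eq0; apply/negPn/negP => pn0.
  set eta := cabs (p zeta) in pn0.
  have eta0 : 0 < eta by rewrite lt_def pn0 cabs_ge0.
  pose s := Num.min 2^-1 (Num.min (eta / 8) (eta ^+ 2 * (1 - e ^+ 2) / 64)).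
  have s0 : 0 < s by rewrite !lt_min !divr_gt0 ?mulr_gt0 ?exprn_gt0// invr_gt0 ltr0n.
  have s1 : s <= 2^-1 by rewrite ge_min lexx.
  have s2 : s <= eta / 8 by rewrite !ge_min lexx orbT.
  have s3 : s <= eta ^+ 2 * (1 - e ^+ 2) / 64 by rewrite !ge_min lexx !orbT.
  have H := @near_circle zeta (1 - s) zeta1.
  have {}H : cabs (p ((1 - s)%:C * zeta)) ^+ 2 <= (eta / 2) ^+ 2 / 2.
    apply: le_trans (H _) _; first by apply/andP; split; lra.
    rewrite ler_pdivrMr// (_ : 1 - (1 - s) = s); last by ring.
    have -> : (eta / 2) ^+ 2 / 2 * (1 - e ^+ 2) = 8 * (eta ^+ 2 * (1 - e ^+ 2) / 64) by field.
    by rewrite ler_pM2l.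
  have {}H : cabs (p ((1 - s)%:C * zeta)) < eta / 2.
    rewrite -(@ltr_pXn2r _ 2)// ?nnegrE ?cabs_ge0 ?divr_ge0 ?cabs_ge0//.
    apply: le_lt_trans H _; have : 0 < (eta / 2) ^+ 2 by rewrite exprn_gt0// divr_gt0.
    lra.
  have D : cabs (p zeta - p ((1 - s)%:C * zeta)) <= s * 4.
    have -> : p zeta - p ((1 - s)%:C * zeta) =
        s%:C * ((1 - c) * zeta - cj a * zeta ^+ 2 * (2 - s)%:C).
      by rewrite /p !rmorphB rmorph1 rmorph_nat; ring.
    rewrite cabsM cabs_real gtr0_norm// ler_pM2l//.
    apply: le_trans (cabsB _ _) _; rewrite !cabsM zeta1 !mulr1 cabs_real cabs_conj.
    have c2 : cabs (1 - c) <= 2 by apply: le_trans (cabsB _ _) _; rewrite cabs1 c1.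
    have : cabs a * `|2 - s| <= 1 * 2.
      by rewrite ler_pM ?cabs_ge0 ?ltW// ger0_norm; lra.
    lra.
  have := cabs_dist (p zeta) (p ((1 - s)%:C * zeta)); rewrite -/eta; lra.
have pp : p 1 = 0 by apply: p0; exact: cabs1.
have pm : p (- 1) = 0 by apply: p0; rewrite cabsN cabs1.
have pi : p 'i = 0 by apply: p0; rewrite /cabs/= expr0n/= expr1n add0r sqrtr1.
have c1E : c = 1.
  have : p 1 - p (- 1) = 2 * (1 - c) by rewrite /p; ring.
  rewrite pp pm subrr => /esym/eqP; rewrite mulf_eq0 pnatr_eq0/= subr_eq0.
  by move=> /eqP.
have a0 : a = 0.
  have i2 : 'i%C * 'i%C = -1 :> C by rewrite -expr2 sqr_i.
  have : p 1 + p 'i = 2 * a.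
    rewrite /p c1E; move: ('i%C : C) i2 => i i2.
    rewrite [LHS](_ : _ = 2 * a - cj a * (1 + i * i)); last by ring.
    by rewrite i2 subrr mulr0 subr0.
  by rewrite pp pi addr0 => /esym/eqP; rewrite mulf_eq0 pnatr_eq0 => /eqP.
apply: aut_eq => z; apply: dval_inj; rewrite gE c1E a0.
by rewrite /mob conjc0 mul0r !subr0 divr1 mul1r.
Qed.

End DiscTopology.

(** * Proper discontinuity of Fuchsian groups *)

Lemma finite_near (T : Type) (I : choiceType) (F : set_system T) (B : set I)
    (P : I -> T -> Prop) : Filter F -> finite_set B ->
  (forall i, B i -> \forall t \near F, P i t) ->
  \forall t \near F, forall i, B i -> P i t.
Proof.
move=> FF Bfin BP.
have : F (\bigcap_(i in [set` fset_set B]) [set t | P i t]).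
  by apply: filter_bigI => i; rewrite in_fset_set// => /set_mem; exact: BP.
apply: filterS => t H i Bi; apply: H.
by rewrite /= in_fset_set//; exact: mem_set.
Qed.

Lemma finite_subsingleton (T : choiceType) (S : set T) :
  (forall x y, S x -> S y -> x = y) -> finite_set S.
Proof.
move=> Ssub; have [->|/set0P[x Sx]] := eqVneq S set0; first exact: finite_set0.
by apply: (@sub_finite_set _ _ [set x]) => // y Sy; exact: Ssub.
Qed.

(** Compactness of K in terms of near coverings, along the filter of the finite
    sets of indices directed by inclusion. *)
Lemma compact_locally_finite (X : topologicalType) (T : choiceType) (K : set X)
    (S : set T) (rel : T -> X -> Prop) : compact K ->
  (forall g, S g -> exists2 x, K x & rel g x) ->
  (forall x, K x -> exists2 U, nbhs x U &
     finite_set [set g | S g /\ exists2 y, U y & rel g y]) ->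
  finite_set S.
Proof.
move=> cK SK Kloc.
pose F : set_system (set T) := [set Y | exists2 A0, finite_set A0 &
  forall A, finite_set A -> A0 `<=` A -> Y A].
have FF : Filter F.
  split; first by exists set0.
  - move=> Y Z [A0 fA YA] [B0 fB ZB]; exists (A0 `|` B0).
      by rewrite finite_setU.
    move=> A fA'; rewrite subUset => -[AA BA]; split; [exact: YA|exact: ZB].
  - by move=> Y Z YZ [A0 fA YA]; exists A0 => // A fA' AA; exact/YZ/YA.
have := (compact_near_coveringP K).1 cK _ F (fun A x => forall g, S g -> rel g x -> A g) FF.
case.
  move=> x Kx; have [U xU fU] := Kloc x Kx.
  exists (U, [set A | [set g | S g /\ exists2 y, U y & rel g y] `<=` A]).
    by split => //; eexists; first exact: fU.
  by move=> [y A] /= [Uy SA] g Sg gy; apply: SA; split => //; exists y.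
move=> A0 fA0 HA; apply: sub_finite_set (fA0) => g Sg.
have [x Kx gx] := SK g Sg.
by apply: (HA A0) gx => //.
Qed.

Section Fuchsian.
Variable R : realType.
Local Notation C := R[i].
Local Notation disc := (disc R).
Local Notation Aut := (Aut R).
Variable G : subgroup Aut.
Hypothesis Gf : fuchsian G.

Lemma aut_mulE (g h : Aut) z : ((g * h)%g : Aut) z = g (h z). Proof. by []. Qed.
Lemma aut1E z : (1%g : Aut) z = z. Proof. by []. Qed.
Lemma autK (g : Aut) : cancel g ((g^-1)%g : Aut).
Proof. by move=> z; rewrite -aut_mulE mulVg. Qed.
Lemma autVK (g : Aut) : cancel ((g^-1)%g : Aut) g.
Proof. by move=> z; rewrite -aut_mulE mulgV. Qed.
Lemma aut_continuous (g : Aut) : continuous g.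
Proof. by have [gh _] := aut_biholomorphic g; exact: holomorphic_continuous. Qed.

Lemma phdist_near (x y : disc) (e : R) : (phdist x y < e) ->
  nbhs y [set w | (phdist x w < e)].
Proof.
pose m (w : disc) := mkdisc (mob_lt1 (cabs1 R) (dval_lt1 x) (dval_lt1 w)).
have mb : biholomorphic m by apply: (mob_biholomorphic (cabs1 R) (dval_lt1 x)).
move=> xy; have := @aut_continuous (to_aut mb) y [set w | (cabs (dval w) < e)].
apply; apply/nbhs_discP; exists (e - phdist x y); first by rewrite subr_gt0.
move=> w; have := cabs_dist (dval w) (dval (m y)).
by rewrite /= -[cabs (dval (m y))]/(phdist x y) -[aut_fun _ y]/(m y); lra.
Qed.

(** Every neighbourhood of the identity for the compact-open topology contains a
    uniform one. *)
Lemma discrete_uniform : exists2 e : R, 0 < e &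
  forall g : Aut, sg_set G g -> (forall z, cabs (dval (g z) - dval z) < e) -> g = 1%g.
Proof.
have [G1 [V V1 GV]] := Gf (sg1 G).
pose F : set_system {compact-open, disc -> disc} := [set U | exists2 e : R, 0 < e &
  forall f : disc -> disc, (forall z, cabs (dval (f z) - dval z) < e) -> U f].
have FF : Filter F.
  split; first by exists 1.
  - move=> A B [e1 e10 H1] [e2 e20 H2]; exists (Num.min e1 e2); first by rewrite lt_min e10.
    move=> f Hf; split; [apply: H1 => z|apply: H2 => z];
      by have := Hf z; rewrite lt_min => /andP[].
  - by move=> A B AB [e e0 H]; exists e => // f /H/AB.
have Fid : F --> (idfun : {compact-open, disc -> disc}).
  apply/compact_open_cvgP => K O cK oO KO.
  have := (compact_near_coveringP K).1 cK R (0^'+)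
     (fun e z => forall w : disc, cabs (dval w - dval z) < e -> O w).
  move=> /(_ _)[].
    move=> x Kx; have Ox : O x by apply: KO; exists x.
    have /nbhs_discP[d d0 dO] : nbhs x O by rewrite nbhsE; exists O.
    have d20 : 0 < d / 2 by rewrite divr_gt0.
    exists ([set z | cabs (dval z - dval x) < d / 2], [set e | e < d / 2]).
      split; first by apply/nbhs_discP; exists (d / 2).
      exact: nbhs_right_lt.
    move=> [z e] /= [zx ed] w wz; apply: dO.
    rewrite -(subrK (dval z) (dval w)) -addrA; apply: le_lt_trans (cabsD _ _) _; lra.
  move=> e' /= e'0 He'; exists (e' / 2); first by rewrite divr_gt0.
  move=> f Hf _ [x Kx <-]; apply: (He' (e' / 2)) Kx _ (Hf x).
    by rewrite /ball/= sub0r normrN gtr0_norm ?divr_gt0//; lra.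
  by rewrite divr_gt0.
move: V1; rewrite nbhsE => -[_ [[W oW <-] W1] WV].
have /Fid[e e0 He] : nbhs (idfun : {compact-open, disc -> disc}) W.
  by rewrite nbhsE; exists W.
exists e => // g Gg ge; have : (V `&` G) g by split => //; apply/WV/He.
by rewrite GV.
Qed.

Lemma mob_lipschitz_param (r : R) c a c' a' (z : C) : r < 1 -> cabs z < 1 ->
  cabs c = 1 -> cabs c' = 1 -> cabs a <= r -> cabs a' <= r ->
  cabs (mob c a z - mob c' a' z) <= 4 / (1 - r) ^+ 2 * (cabs (c - c') + cabs (a - a')).
Proof.
move=> r1 z1 c1 c'1 ar a'r.
have D0 := mob_den (le_lt_trans ar r1) (ltW z1).
have D'0 := mob_den (le_lt_trans a'r r1) (ltW z1).
have r0 : 0 < 1 - r by rewrite subr_gt0.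
have Dr := mob_den_ge ar (ltW z1); have D'r := mob_den_ge a'r (ltW z1).
have -> : mob c a z - mob c' a' z = (c - c') * (z - a) / (1 - cj a * z) +
    c' * ((z - a) * ((cj a - cj a') * z) + (a' - a) * (1 - cj a * z)) /
      ((1 - cj a * z) * (1 - cj a' * z)).
  by rewrite /mob; field; rewrite D0 D'0.
have za : cabs (z - a) <= 2 by apply: le_trans (cabsB _ _) _; lra.
have D2 := mob_den_le2 (ltW (le_lt_trans ar r1)) (ltW z1).
have i1 : (cabs (1 - cj a * z))^-1 <= (1 - r)^-1 by rewrite lef_pV2 ?posrE//; lra.
have i2 : (cabs (1 - cj a' * z))^-1 <= (1 - r)^-1 by rewrite lef_pV2 ?posrE//; lra.
have r1i : 1 <= (1 - r)^-1 by rewrite invf_ge1//; have := cabs_ge0 a; lra.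
have r0i : 0 <= (1 - r)^-1 by lra.
apply: le_trans (cabsD _ _) _; rewrite [leRHS]mulrDr; apply: lerD.
  rewrite !cabsM cabsV -mulrA [leRHS]mulrC ler_wpM2l ?cabs_ge0//.
  apply: le_trans (ler_pM _ _ za i1) _; rewrite ?invr_ge0 ?cabs_ge0//.
  rewrite -exprVn expr2; set q := (1 - r)^-1 in r1i r0i *.
  have : q <= q * q by rewrite ler_peMl.
  lra.
rewrite !cabsM cabsV c'1 mul1r cabsM invfM.
have N : cabs ((z - a) * ((cj a - cj a') * z) + (a' - a) * (1 - cj a * z)) <=
    4 * cabs (a - a').
  apply: le_trans (cabsD _ _) _; rewrite !cabsM.
  have -> : cabs (cj a - cj a') = cabs (a - a') by rewrite -rmorphB cabs_conj.
  rewrite [cabs (a' - a)]cabsC.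
  have A0 := cabs_ge0 (a - a').
  have B1 : cabs (a - a') * cabs z <= cabs (a - a') by rewrite ler_piMr// ltW.
  have B2 : cabs (z - a) * (cabs (a - a') * cabs z) <= 2 * cabs (a - a').
    by rewrite ler_pM ?mulr_ge0 ?cabs_ge0.
  have B3 : cabs (a - a') * cabs (1 - cj a * z) <= cabs (a - a') * 2 by rewrite ler_wpM2l.
  lra.
apply: le_trans (ler_pM _ _ N (ler_pM _ _ i1 i2)) _; rewrite ?mulr_ge0 ?invr_ge0 ?cabs_ge0//.
by rewrite le_eqVlt; apply/orP; left; apply/eqP; field; lra.
Qed.

Lemma mob_lipschitz (r : R) c a (z w : C) : r < 1 -> cabs z < 1 -> cabs w < 1 ->
  cabs c = 1 -> cabs a <= r ->
  cabs (mob c a z - mob c a w) <= cabs (z - w) / (1 - r) ^+ 2.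
Proof.
move=> r1 z1 w1 c1 ar; have a1 := le_lt_trans ar r1.
have Dz := mob_den a1 (ltW z1); have Dw := mob_den a1 (ltW w1).
have r0 : 0 < 1 - r by rewrite subr_gt0.
have -> : mob c a z - mob c a w =
    c * (z - w) * ((1 - cabs a ^+ 2)%:C) / ((1 - cj a * z) * (1 - cj a * w)).
  have -> : (1 - cabs a ^+ 2)%:C = 1 - cj a * a.
    rewrite rmorphB rmorph1 cabs_sqr; congr (_ - _); case: (a) => x y /=.
    by apply/eqP; rewrite eq_complex/=; apply/andP; split; apply/eqP; ring.
  by rewrite /mob; field; rewrite Dz Dw.
rewrite !cabsM cabsV c1 mul1r cabsM cabs_real (ger0_norm (ltW (one_sub_sqr_gt0 a1))).
rewrite -mulrA ler_wpM2l ?cabs_ge0// ler_pdivrMr ?mulr_gt0 ?cabs_gt0//.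
rewrite -exprVn expr2.
apply: (@le_trans _ _ 1); first by rewrite gerBl sqr_ge0.
rewrite mulrACA -[leLHS]mulr1; apply: ler_pM => //.
  by rewrite ler_pdivlMl ?mulr1//; exact: mob_den_ge ar (ltW z1).
by rewrite ler_pdivlMl ?mulr1//; exact: mob_den_ge ar (ltW w1).
Qed.

Definition has_param (g : Aut) c a := [/\ cabs c = 1, cabs a < 1 &
  forall z : disc, dval (g z) = mob c a (dval z)].

Lemma has_paramV (g : Aut) c a : has_param g c a ->
  forall z : disc, dval (((g^-1)%g : Aut) z) = mob (cj c) (- (c * a)) (dval z).
Proof.
by move=> [c1 a1 gE] z; rewrite -{2}(autVK g z) gE mobK// dval_lt1.
Qed.

(** If the parameters of g and g' are close, then g'^-1 * g is uniformly close
    to the identity. *)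
Lemma params_separated (r : R) : r < 1 -> exists2 eta : R, 0 < eta &
  forall g g' : Aut, sg_set G g -> sg_set G g' -> forall c a c' a',
    has_param g c a -> has_param g' c' a' -> cabs a <= r -> cabs a' <= r ->
    cabs (c - c') + cabs (a - a') < eta -> g = g'.
Proof.
move=> r1; have r0 : 0 < (1 - r) ^+ 2 by rewrite exprn_gt0// subr_gt0.
have [e e0 He] := discrete_uniform.
exists (e * (1 - r) ^+ 2 ^+ 2 / 4) => [|g g' Gg Gg' c a c' a' gp gp' ar a'r].
  by rewrite divr_gt0// mulr_gt0// exprn_gt0.
have [c1 a1 gE] := gp; have [c'1 a'1 gE'] := gp'.
move=> small; suff : (g'^-1 * g = 1)%g by move=> H; rewrite -[g](mulVKg g') H mulg1.
apply: He => [|z]; first by apply: sgM => //; exact: sgV.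
rewrite aut_mulE -{2}(autK g' z) !(has_paramV gp').
have Nr : cabs (- (c' * a')) <= r by rewrite cabsN cabsM c'1 mul1r.
apply: le_lt_trans (mob_lipschitz r1 _ _ _ Nr) _; rewrite ?dval_lt1 ?cabs_conj//.
rewrite ltr_pdivrMr// gE gE'.
apply: le_lt_trans (mob_lipschitz_param r1 (dval_lt1 z) c1 c'1 ar a'r) _.
rewrite mulrAC ltr_pdivrMr//.
move: small; rewrite ltr_pdivlMr// => small.
lra.
Qed.

(** The parameters c and a with |a| <= r form a compact set, in which those of G
    are uniformly separated. *)
Lemma finite_bounded_param (r : R) : r < 1 -> finite_set
  [set g : Aut | sg_set G g /\ exists c a, has_param g c a /\ cabs a <= r].
Proof.
move=> r1; have [eta eta0 sep] := params_separated r1.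
set S := [set g | _].
pose U (p : C * C) : set (C^o * C^o) :=
  [set q | cabs (q.1 - p.1) < eta / 4 /\ cabs (q.2 - p.2) < eta / 4].
have Uopen p : open (U p).
  rewrite openE => q [q1 q2]; have d1 : 0 < eta / 4 - cabs (q.1 - p.1) by rewrite subr_gt0.
  have d2 : 0 < eta / 4 - cabs (q.2 - p.2) by rewrite subr_gt0.
  exists ([set w | cabs (w - q.1) < eta / 4 - cabs (q.1 - p.1)],
          [set w | cabs (w - q.2) < eta / 4 - cabs (q.2 - p.2)]) => /=.
    split; apply/nbhsCP; first by exists (eta / 4 - cabs (q.1 - p.1)).
    by exists (eta / 4 - cabs (q.2 - p.2)).
  move=> [w1 w2] /= [h1 h2]; split => /=.
    by rewrite -(subrK q.1 w1) -addrA; apply: le_lt_trans (cabsD _ _) _; lra.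
  by rewrite -(subrK q.2 w2) -addrA; apply: le_lt_trans (cabsD _ _) _; lra.
have cK : compact ([set z : C^o | cabs z <= 1] `*` [set z : C^o | cabs z <= 1]).
  by apply: compact_setX; exact: compact_cball.
apply: (@compact_locally_finite _ Aut _ S
  (fun g (p : C^o * C^o) => has_param g p.1 p.2 /\ cabs p.2 <= r) cK).
  move=> g [Gg [c [a [gp ar]]]]; exists (c, a) => //=.
  by have [c1 a1 _] := gp; split=> /=; [rewrite c1|exact: ltW].
move=> p _; exists (U p).
  rewrite nbhsE; exists (U p) => //; split; first exact: Uopen.
  by split; rewrite subrr cabs0 divr_gt0.
apply: finite_subsingleton => g h.
move=> [[Gg _] [[c a] Up [gp ar]]] [[Gh _] [[c' a'] Up' [hp a'r]]].
apply: sep gp hp ar a'r _ => //.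
move: Up Up'; rewrite /U/= => -[u1 u2] [v1 v2].
have t1 : cabs (c - c') <= cabs (c' - p.1) + cabs (c - p.1).
  by rewrite [leRHS]addrC (_ : c - c' = (c - p.1) - (c' - p.1)) ?cabsB//; ring.
have t2 : cabs (a - a') <= cabs (a' - p.2) + cabs (a - p.2).
  by rewrite [leRHS]addrC (_ : a - a' = (a - p.2) - (a' - p.2)) ?cabsB//; ring.
lra.
Qed.

(** By the identity [mob_sqr], the parameter a of such a g is bounded away from
    the circle in terms of r. *)
Lemma finite_meet (r : R) : r < 1 -> finite_set [set g : Aut | sg_set G g /\
  exists2 z : disc, cabs (dval z) <= r & cabs (dval (g z)) <= r].
Proof.
move=> r1; pose k := (1 - r ^+ 2) * (1 - r) ^+ 2.
have [r0|r0] := ltP r 0.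
  apply: (@sub_finite_set _ _ set0) => // g [_ [z zr _]].
  by have := cabs_ge0 (dval z); lra.
have k0 : 0 < k by rewrite mulr_gt0 ?exprn_gt0 ?subr_gt0// expr_lt1.
have k1 : 1 - k / 2 < 1 by lra.
apply: sub_finite_set (finite_bounded_param k1) => g [Gg [z zr gzr]].
split => //; have [c [a [c1 a1 gE]]] := aut_mobius g; exists c, a; split => //.
have D0 : 0 < cabs (1 - cj a * dval z) by rewrite cabs_gt0 mob_den// ltW ?dval_lt1.
have Dr : 1 - r <= cabs (1 - cj a * dval z).
  have := cabs_dist 1 (cj a * dval z); rewrite cabs1 cabsM cabs_conj.
  have : cabs a * cabs (dval z) <= r.
    by apply: le_trans zr; rewrite ler_piMl ?cabs_ge0// ltW.
  lra.
have E : (1 - cabs a ^+ 2) * (1 - cabs (dval z) ^+ 2) =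
   (1 - cabs (dval (g z)) ^+ 2) * cabs (1 - cj a * dval z) ^+ 2.
  rewrite -mob_sqr gE /mob !cabsM cabsV c1 mul1r expr_div_n mulrBl mul1r divfK//.
  by rewrite expf_neq0// gt_eqF.
have K : k <= 1 - cabs a ^+ 2.
  have z0 : 1 - cabs (dval z) ^+ 2 <= 1 by rewrite gerBl sqr_ge0.
  apply: (@le_trans _ _ ((1 - cabs a ^+ 2) * (1 - cabs (dval z) ^+ 2))); last first.
    by rewrite ler_piMr// ltW// one_sub_sqr_gt0.
  rewrite E /k; apply: ler_pM.
  - by rewrite subr_ge0 expr_le1// ltW.
  - exact: sqr_ge0.
  - by rewrite lerB// ler_pXn2r ?nnegrE ?cabs_ge0.
  - by rewrite ler_pXn2r ?nnegrE ?subr_ge0 ?cabs_ge0// ltW.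
have a0 := sqr_ge0 (cabs a).
rewrite -(@ler_pXn2r _ 2)// ?nnegrE ?cabs_ge0//; last lra.
have -> : (1 - k / 2) ^+ 2 = 1 - k + k ^+ 2 / 4 by field.
have := sqr_ge0 k; lra.
Qed.

(** By [finite_meet] only finitely many elements of G move some point near w to
    some point near w'; those that do not send w to w' are excluded by shrinking
    e. *)
Lemma properly_discontinuous (w w' : disc) : exists2 e : R, 0 < e &
  forall g : Aut, sg_set G g -> forall x, phdist w x < e -> phdist w' (g x) < e -> g w = w'.
Proof.
pose r := (1 + Num.max (cabs (dval w)) (cabs (dval w'))) / 2.
have m1 : Num.max (cabs (dval w)) (cabs (dval w')) < 1 by rewrite gt_max !dval_lt1.
have r1 : r < 1 by rewrite /r; lra.
have wr : cabs (dval w) <= Num.max (cabs (dval w)) (cabs (dval w')) by rewrite le_max lexx.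
have w'r : cabs (dval w') <= Num.max (cabs (dval w)) (cabs (dval w')) by rewrite le_max lexx orbT.
pose B : set Aut := [set g | (sg_set G g /\
  exists2 z : disc, cabs (dval z) <= r & cabs (dval ((g : Aut) z)) <= r) /\ (g : Aut) w <> w'].
have Bfin : finite_set B by apply: sub_finite_set (finite_meet r1) => g [].
(* each of the finitely many candidates is excluded near w *)
have Bex (g : Aut) : g w <> w' -> \forall e \near 0^'+, forall x, phdist w x < e -> ~ phdist w' (g x) < e.
  move=> gww'; have d0 : 0 < phdist w' (g w).
    by rewrite lt_def phdist_ge0 andbT; apply/eqP => /phdist_eq0/esym.
  have d1 := phdist_lt1 w' (g w).
  near=> e => x wx gx.
  have e0 : e <= 2^-1 by near: e; apply: nbhs_right_le.
  have : 3 * e < phdist w' (g w).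
    rewrite -ltr_pdivlMl//; near: e; apply: nbhs_right_lt; by rewrite mulr_gt0 ?invr_gt0.
  have : phdist w' (g w) < 3 * e.
    apply: (@phdist_tri R (g x)) => //; rewrite phdistC//.
    by rewrite phdist_aut.
  lra.
have : \forall e \near 0^'+, forall g : Aut, B g -> forall x, phdist w x < e -> ~ phdist w' (g x) < e.
  by apply: finite_near => // g [_]; exact: Bex.
move=> H; near (0 : R)^'+ => e.
have e0 : 0 < e by near: e; exact: nbhs_right_gt.
exists e => // g Gg x wx gx; apply: contrapT => gww'.
have H2 : forall g : Aut, B g -> forall x, phdist w x < e -> ~ phdist w' (g x) < e by near: e.
apply: (H2 g _ x wx gx); split => //; split => //.
have er : e <= (1 - Num.max (cabs (dval w)) (cabs (dval w'))) / 4.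
  by near: e; apply: nbhs_right_le; rewrite divr_gt0// subr_gt0.
have lin (y : disc) u : cabs (dval y) <= Num.max (cabs (dval w)) (cabs (dval w')) ->
    phdist y u < e -> cabs (dval u) <= r.
  move: er (phdist_le y u) (cabs_dist (dval u) (dval y)); rewrite /r; clear.
  by move: (Num.max _ _) => M; lra.
by exists x; [exact: lin wr wx|exact: lin w'r gx].
Unshelve. all: by end_near. Qed.

(** An element fixing a point lies in a finite stabilizer, so has finite order. *)
Lemma torsion_free_fixed_point : torsion_free G ->
  forall (g : Aut) z, sg_set G g -> g z = z -> g = 1%g.
Proof.
move=> Gtf g z Gg gz.
have gnz n : ((g ^+ n)%g : Aut) z = z.
  by elim: n => [|n IH]; rewrite ?expg0// expgS aut_mulE IH.
have Ggn n : sg_set G (g ^+ n)%g.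
  by elim: n => [|n IH]; [rewrite expg0; exact: sg1|rewrite expgS; exact: sgM].
have fin : finite_set (range (fun n => (g ^+ n)%g)).
  apply: sub_finite_set (finite_meet (dval_lt1 z)) => _ [n _ <-]; split => //.
  by exists z; rewrite ?gnz.
pose p (n : nat) : Aut := (g ^+ n)%g.
have [m [n [mn gmn]]] : exists m n : nat, (m < n)%N /\ p m = p n.
  apply: contrapT => no.
  have neq (m n : nat) : (m < n)%N -> p m <> p n.
    by move=> mn pmn; apply: no; exists m; exists n; split; [exact: mn|exact: pmn].
  have inj : {in p @^-1` range p &, injective p}.
    move=> m n _ _ pmn; have [/neq/(_ pmn)[]|/neq/(_ (esym pmn))[]|//] := ltngtP m n.
  apply: infinite_nat; apply: sub_finite_set (finite_preimage inj fin).
  by move=> n _; exists n.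
rewrite /p in gmn.
apply: (Gtf g (n - m)%N) => //; first by rewrite subn_gt0.
apply: (mulgI (g ^+ m)%g); rewrite -expgnDr subnKC; last exact: ltnW.
by rewrite mulg1; exact: esym.
Qed.

End Fuchsian.

(** * Cocompact Fuchsian groups *)

Lemma orbit_of_open (F : groupType) (T : topologicalType) (to : action F T) (U : set T) :
  (forall g, continuous (to g)) -> open U -> open (orbit_of to @` U).
Proof.
move=> toc oU.
have -> : orbit_of to @` U = [set x | exists2 u, U u & orbit_of to u = x] by [].
suff : open (orbit_of to @^-1` [set x | exists2 u, U u & orbit_of to u = x]) by [].
suff -> : orbit_of to @^-1` [set x | exists2 u, U u & orbit_of to u = x] =
    \bigcup_g (to g @^-1` U).
  by apply: bigcup_open => g _; apply: open_comp => // x _; exact: toc.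
apply/seteqP; split=> [x [u Uu /esym/orbit_ofP[g ug]]|x [g _ Ux]].
  by exists g => //=; rewrite -ug.
by exists (to g x) => //; apply/esym/orbit_ofP; exists g.
Qed.

Section DiscConnected.
Variable R : realType.
Local Notation C := R[i].
Local Notation disc := (disc R).

Definition on_segment (z w y : disc) := exists2 t : R, 0 <= t <= 1 &
  dval y = dval z + t%:C * (dval w - dval z).

(** Connectedness of the segment from z to w. *)
Lemma segment_induction (z w : disc) (A : set disc) : A z ->
  (forall y, on_segment z w y -> (A y -> nbhs y A) /\ (~ A y -> nbhs y (~` A))) ->
  A w.
Proof.
move=> Az loc.
pose f (t : R) : C := dval z + t%:C * (dval w - dval z).
have fI (t : R) : 0 <= t <= 1 -> cabs (f t) < 1.
  move=> /andP[t0 t1]; rewrite /f (_ : _ + _ = (1 - t)%:C * dval z + t%:C * dval w); last first.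
    by rewrite rmorphB rmorph1; ring.
  have [->|tn0] := eqVneq t 0.
    by rewrite subr0 mul1r mul0r addr0 dval_lt1.
  have tp : 0 < t by rewrite lt_def tn0.
  apply: le_lt_trans (cabsD _ _) _; rewrite !cabsM !cabs_real !ger0_norm ?subr_ge0//.
  have H1 : (1 - t) * cabs (dval z) <= (1 - t) by rewrite ler_piMr ?subr_ge0// ltW ?dval_lt1.
  have H2 : t * cabs (dval w) < t by rewrite gtr_pMr// dval_lt1.
  lra.
pose seg (B : set disc) : set R := [set t | exists2 y, B y & dval y = f t].
have segn (B : set disc) (t : R) y : dval y = f t -> nbhs y B -> nbhs t (seg B).
  move=> yt /nbhs_discP[d d0 dB].
  have d'0 : 0 < Num.min d (1 - cabs (f t)) by rewrite lt_min d0 -yt subr_gt0 dval_lt1.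
  have K : 0 < cabs (dval w - dval z) + 1 by rewrite ltr_wpDl// cabs_ge0.
  apply/nbhs_ballP; exists (Num.min d (1 - cabs (f t)) / (cabs (dval w - dval z) + 1)).
    by rewrite /= divr_gt0.
  move=> s; rewrite /ball/= distrC ltr_pdivlMr// => st.
  have fst : cabs (f s - f t) < Num.min d (1 - cabs (f t)).
    rewrite (_ : f s - f t = (s - t)%:C * (dval w - dval z)); last first.
      by rewrite /f rmorphB; ring.
    rewrite cabsM cabs_real; apply: le_lt_trans st.
    by rewrite ler_wpM2l// lerDl.
  move: fst; rewrite lt_min => /andP[fd f1].
  have [|y' y'E] := @disc_exists _ (f s); first by have := cabs_dist (f s) (f t); lra.
  by exists y' => //; apply: dB; rewrite y'E yt.
have I01 (t : R) : `[0, 1]%classic t -> 0 <= t <= 1 by rewrite /= in_itv.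
have onseg (t : R) y : 0 <= t <= 1 -> dval y = f t -> on_segment z w y by exists t.
have segA (t : R) : 0 <= t <= 1 -> seg A t -> nbhs t (seg A).
  by move=> tI [y Ay yt]; apply: (segn _ _ _ yt); apply: (loc y (onseg t y tI yt)).1.
have segNA (t : R) : 0 <= t <= 1 -> seg (~` A) t -> nbhs t (seg (~` A)).
  by move=> tI [y Ay yt]; apply: (segn _ _ _ yt); apply: (loc y (onseg t y tI yt)).2.
have segN (t : R) : seg A t -> seg (~` A) t -> False.
  by move=> [y Ay yt] [y' Ay' y't]; apply: Ay'; rewrite (_ : y' = y)//; apply: dval_inj; rewrite y't yt.
have segT (t : R) : 0 <= t <= 1 -> seg A t \/ seg (~` A) t.
  move=> /fI/disc_exists[y yt].
  by have [Ay|nAy] := pselect (A y); [left|right]; exists y.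
have conn : `[0, 1] `&` seg A = `[0, 1]%classic.
  apply: (@segment_connected R 0 1).
  - exists 0; split; first by rewrite /= in_itv/= lexx ler01.
    by exists z => //; rewrite /f mul0r addr0.
  - exists ((seg A)^°); first exact: open_interior.
    apply/seteqP; split=> t [tI]; first by move=> /(segA t (I01 t tI)) H; split.
    by move=> /interior_subset.
  - exists (~` (seg (~` A))^°); first exact/open_closedC/open_interior.
    apply/seteqP; split=> t [tI].
      by move=> At; split => // /interior_subset; exact: segN.
    move=> H; split => //; have [//|NA] := segT t (I01 t tI).
    by exfalso; apply: H; exact: segNA (I01 t tI) NA.
have [_ [y Ay yw]] : (`[0, 1] `&` seg A) 1.
  by rewrite conn /= in_itv/= lexx ler01.
rewrite (_ : w = y)//; apply: dval_inj; rewrite yw /f; by ring.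
Qed.

End DiscConnected.

Section Cocompact.
Variable R : realType.
Local Notation C := R[i].
Local Notation disc := (disc R).
Local Notation Aut := (Aut R).
Variable G : subgroup Aut.

Lemma disc_action_continuous g : continuous (disc_action G g).
Proof. exact: aut_continuous. Qed.

(** The images of the open balls of radius e < 1 form an increasing open cover
    of the compact quotient. *)
Lemma fundamental_ball : cocompact G -> exists2 r : R, r < 1 &
  forall z : disc, exists2 g : Aut, sg_set G g & cabs (dval (g z)) <= r.
Proof.
move=> cG.
have := (compact_near_coveringP _).1 cG _ ((1 : R)^'-) (fun e x => exists2 z : disc,
   orbit_of (disc_action G) z = x & cabs (dval z) <= e) _.
case.
  move=> x _; pose z0 : disc := repr x.
  have d0 : 0 < (1 - cabs (dval z0)) / 2 by rewrite divr_gt0// subr_gt0 dval_lt1.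
  pose U := [set z : disc | cabs (dval z) < (1 + cabs (dval z0)) / 2].
  have oU : open U.
    rewrite (_ : U = (@cabs R \o @dval R) @^-1` [set x | x < (1 + cabs (dval z0)) / 2])//.
    apply: open_comp; last exact: open_lt.
    move=> z _; apply: continuous_comp; first exact: dval_continuous.
    exact: cabs_continuous.
  exists (orbit_of (disc_action G) @` U, [set e | (1 + cabs (dval z0)) / 2 <= e]).
    split => /=.
      rewrite nbhsE; exists (orbit_of (disc_action G) @` U) => //; split.
        exact: orbit_of_open (disc_action_continuous) oU.
      by exists z0; [rewrite /U/=; lra|exact: reprK].
    by apply: nbhs_left_ge; lra.
  by move=> [y e] /= [[z Uz <-] He]; exists z => //; apply: le_trans He; exact: ltW.
move=> d /= d0 Hd.
pose e : R := 1 - Num.min d 1 / 2.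
have m0 : 0 < Num.min d 1 by rewrite lt_min d0 ltr01.
have e1 : e < 1 by rewrite /e; lra.
exists e => // z.
have [||z' z'z z'e] := Hd e _ _ (orbit_of (disc_action G) z) I; last 1 first.
- by have /esym/orbit_ofP[g z'E] := z'z; exists (\val g); [exact: set_valP g|rewrite z'E in z'e].
- have md : Num.min d 1 <= d by rewrite ge_min lexx.
  by rewrite /ball/= ger0_norm; rewrite /e; lra.
- exact: e1.
Qed.

Hypotheses (Gf : fuchsian G) (Gtf : torsion_free G).
Variable r : R.
Hypothesis r1 : r < 1.
Hypothesis dom : forall z : disc, exists2 g : Aut, sg_set G g & cabs (dval (g z)) <= r.

(** Freeness and proper discontinuity give a positive bound near each point,
    hence a uniform one on the fundamental ball, and everywhere because
    conjugation in G translates w. *)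
Lemma injectivity_radius : exists2 e : R, 0 < e &
  forall g : Aut, sg_set G g -> g <> 1%g -> forall w, e <= phdist w (g w).
Proof.
have := (compact_near_coveringP _).1 (compact_disc_ball r1) _ ((0 : R)^'+)
  (fun e w => forall g : Aut, sg_set G g -> g <> 1%g -> e <= phdist w (g w)) _.
case.
  move=> w _; have [e e0 He] := properly_discontinuous Gf w w.
  pose d := Num.min 2^-1 (e / 3).
  have d0 : 0 < d by rewrite lt_min invr_gt0 ltr0n divr_gt0.
  exists ([set x | phdist w x < d], [set t | t <= d]).
    by split => /=; [apply/nbhs_phdistP; exists d|exact: nbhs_right_le].
  move=> [x t] /= [wx td] g Gg g1; rewrite leNgt; apply/negP => xg.
  have d2 : d <= 2^-1 by rewrite ge_min lexx.
  have d3 : d <= e / 3 by rewrite ge_min lexx orbT.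
  apply: g1; apply: (torsion_free_fixed_point Gf Gtf Gg) (He g Gg x _ _) => //; first lra.
  apply: lt_le_trans (_ : 3 * d <= e); last lra.
  by apply: (phdist_tri (x := x)) => //; [rewrite phdistC|lra].
move=> d /= d0 Hd; exists (d / 2); first by rewrite divr_gt0.
move=> g Gg g1 w; have [h Gh hw] := dom w.
rewrite -(phdist_aut h w) -{2}(autK h w).
have -> : h (g (((h^-1)%g : Aut) (h w))) = ((h * g * h^-1)%g : Aut) (h w) by [].
have Gk : sg_set G (h * g * h^-1)%g by apply: sgM; [exact: sgM|exact: sgV].
have k1 : (h * g * h^-1)%g <> 1%g.
  move=> hg1; apply: g1; apply: (mulgI h); apply: (mulIg h^-1%g).
  by rewrite hg1 mulg1 mulgV.
have dd : ball_ Num.norm 0 d (d / 2) by rewrite /= sub0r normrN ger0_norm; lra.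
by apply: Hd dd _ (h w) hw _ Gk k1; lra.
Qed.

(** The elements translating a slightly larger ball to one that meets it
    generate G, since the disc is connected. Generation is expressed as an
    induction principle. *)
Lemma finitely_generated : exists2 S : set Aut, finite_set S /\ S `<=` G &
  forall P : set Aut, P 1%g -> (forall x y, S x -> sg_set G y -> P y -> P (x * y)%g) ->
  sg_set G `<=` P.
Proof.
pose r' := (Num.max r 0 + 1) / 2.
have m1 : Num.max r 0 < 1 by rewrite gt_max r1 ltr01.
have mr : r <= Num.max r 0 by rewrite le_max lexx.
have m0 : 0 <= Num.max r 0 by rewrite le_max lexx orbT.
have r'1 : r' < 1 by rewrite /r'; lra.
have rr' : r < r' by rewrite /r'; lra.
have r'0 : 0 < r' by rewrite /r'; lra.
pose S := [set g : Aut | sg_set G g /\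
  exists2 z : disc, cabs (dval z) <= r' & cabs (dval (g z)) <= r'].
exists S; first by split; [exact: finite_meet|move=> g []].
move=> P P1 PS.
have cont (k : Aut) (z : disc) : cabs (dval (k z)) < r' ->
    nbhs z [set y | cabs (dval (k y)) < r'].
  move=> kz; apply: (@aut_continuous R k z [set y : disc | cabs (dval y) < r']).
  apply/nbhs_discP; exists (r' - cabs (dval (k z))); first by rewrite subr_gt0.
  by move=> w; have := cabs_dist (dval w) (dval (k z)); rewrite /=; lra.
pose A := [set z : disc | forall k : Aut, sg_set G k -> cabs (dval (k z)) < r' -> P k].
have AE z (h : Aut) : sg_set G h -> P h -> cabs (dval (h z)) < r' -> A z.
  move=> Gh Ph hz k Gk kz; rewrite (_ : k = k * h^-1 * h)%g; last by rewrite -mulgA mulVg mulg1.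
  apply: PS => //.
  split; first by apply: sgM => //; exact: sgV.
  by exists (h z); [exact: ltW|rewrite aut_mulE autK ltW].
have A0 : A (disc_zero R).
  by apply: (AE _ 1%g) => //; [exact: sg1|rewrite aut1E dval0 cabs0].
have AT z : A z.
  apply: (segment_induction A0) => y _; split.
    move=> Ay; have [h Gh hy] := dom y; have hy' := le_lt_trans hy rr'.
    have := cont _ _ hy'; apply: filterS => x hx; apply: AE hx => //; exact: Ay.
  move=> nAy; have [k [Gk ky nPk]] : exists k : Aut, [/\ sg_set G k, cabs (dval (k y)) < r' & ~ P k].
    apply: contrapT => no; apply: nAy => k Gk ky; apply: contrapT => nPk; apply: no.
    by exists k.
  by have := cont _ _ ky; apply: filterS => x kx Ax; apply: nPk; exact: Ax.
move=> g Gg; apply: (AT (((g^-1)%g : Aut) (disc_zero R))) => //.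
by rewrite autVK dval0 cabs0.
Qed.

End Cocompact.

(** * Specialization to finite fields *)

Lemma finfield_root (k : finFieldType) (p : {poly k}) : (1 < size p)%N ->
  exists (k' : finFieldType) (iota : {rmorphism k -> k'}) (x : k'),
    (map_poly iota p).[x] = 0.
Proof.
move=> sp; have p0 : p != 0 by rewrite -size_poly_gt0 ltnW.
have [L [rs Dp _]] := FinSplittingFieldFor p0.
pose k' := FinFieldExtType L.
exists k', (in_alg L : {rmorphism k -> k'}).
case: rs Dp => [|x rs] Dp.
  have := eqp_size Dp; rewrite big_nil size_poly1 size_map_poly => E.
  by rewrite E in sp.
exists (x : k'); have : root (map_poly (in_alg L) p) x.
  by rewrite (eqp_root Dp) big_cons rootM root_XsubC eqxx.
by move=> /rootP.
Qed.

(** Homomorphisms to finite fields separate the values of R in a field of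
    characteristic 0: a form of the Nullstellensatz over the integers. *)
Definition specializable (R : idomainType) : Prop :=
  forall (K : numFieldType) (ev : {rmorphism R -> K}) (b : R), ev b != 0 ->
  exists (k : finFieldType) (phi : {rmorphism R -> k}),
    (forall x, ev x = 0 -> phi x = 0) /\ phi b != 0.

Lemma specializable_int : specializable int.
Proof.
move=> K ev b evb; have evE m : ev m = m%:~R by rewrite -[m in LHS]intz rmorph_int.
have b0 : b != 0 by apply: contraNneq evb => ->; rewrite rmorph0.
pose p := pdiv (`|b|%N`!.+1).
have pp : prime p by apply: pdiv_prime; rewrite ltnS fact_gt0.
exists 'F_p, (intr : {rmorphism int -> 'F_p}); split=> [x|].
  by rewrite evE => /eqP; rewrite intr_eq0 => /eqP ->.
have pb : ~~ (p %| `|b|)%N.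
  apply/negP => pb; have : (p %| 1)%N.
    rewrite -(@dvdn_addr (`|b|%N`!)) ?addn1 ?pdiv_dvd//.
    by apply: dvdn_trans pb _; rewrite dvdn_fact// absz_gt0 b0 leqnn.
  by rewrite dvdn1 => /eqP p1; rewrite p1 in pp.
have H : (`|b|%N%:R : 'F_p) != 0 by rewrite -(dvdn_pcharf (pchar_Fp pp)).
apply: contraNneq H => H; rewrite pmulrn abszE normrEsign rmorphM /=.
by rewrite H mulr0.
Qed.

Section SpecializePoly.
Variables (R : idomainType) (K : numFieldType) (ev : {rmorphism {poly R} -> K}).
Implicit Types (p q : {poly R}).

Let ev0 : {rmorphism R -> K} := ev \o polyC.
Let P p : {poly K} := map_poly ev0 p.

Lemma evE p : ev p = (P p).[ev 'X].
Proof.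
rewrite -[p in LHS]coefK poly_def rmorph_sum/= /P.
rewrite -[p in RHS]coefK poly_def rmorph_sum/= horner_sum.
apply: eq_bigr => i _; rewrite -!mul_polyC !rmorphM !rmorphXn /= map_polyC map_polyX.
by rewrite hornerM hornerC hornerXn.
Qed.

(** Removes the leading coefficients killed by ev. *)
Let trunc p := take_poly (size (P p)) p.

Lemma P_trunc p : P (trunc p) = P p.
Proof.
apply/polyP => i; rewrite /trunc !coef_map coef_take_poly.
case: ltnP => // si; rewrite /= rmorph0.
by have := @nth_default _ 0 (P p) i si; rewrite coef_map.
Qed.

Lemma size_trunc p : (size (trunc p) <= size (P p))%N.
Proof. exact: size_take_poly. Qed.

Lemma lead_trunc p : P p != 0 ->
  size (trunc p) = size (P p) /\ ev0 (lead_coef (trunc p)) != 0.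
Proof.
move=> p0; have s : size (trunc p) = size (P p).
  apply/eqP; rewrite eqn_leq size_trunc /= -[in X in (X <= _)%N]P_trunc.
  exact: size_poly.
split=> //; rewrite lead_coefE s -coef_map -/(P _) P_trunc.
by rewrite -lead_coefE lead_coef_eq0.
Qed.

Lemma ev_P p : P p = 0 -> ev p = 0.
Proof. by move=> p0; rewrite evE p0 horner0. Qed.

Lemma min_size (A : set {poly R}) p : A p -> P p != 0 ->
  exists2 q, A q /\ P q != 0 & forall q', A q' -> (size (P q') < size (P q))%N -> P q' = 0.
Proof.
move=> Ap Pp; have [n] := ubnP (size (P p)).
elim: n p Ap Pp => // n IH p Ap Pp sp.
have [[q' [Aq' sq' q'0]]|no] := pselect (exists q', [/\ A q', (size (P q') < size (P p))%N & P q' != 0]).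
  by apply: (IH q') => //; apply: leq_trans sq' _.
exists p => // q' Aq' sq'; apply/eqP; apply: contra_notT no => q'0.
by exists q'.
Qed.

Hypothesis specR : specializable R.

Lemma ext_rmorph (k k' : finFieldType) (phi : {rmorphism R -> k})
    (iota : {rmorphism k -> k'}) (x : k') :
  exists psi : {rmorphism {poly R} -> k'},
    forall p, psi p = (map_poly iota (map_poly phi p)).[x].
Proof.
pose f : {rmorphism R -> k'} := iota \o phi.
have cf : commr_rmorph f x by move=> a; exact: mulrC.
exists (horner_morph cf) => p; rewrite /horner_morph; congr (_.[_]).
by rewrite -map_poly_comp.
Qed.

(** Here only coefficients are killed by ev. Specialize them so that b becomes a
    nonzero polynomial q, and X to some point where q does not vanish. *)
Lemma specialize_transcendental : (forall p, ev p = 0 -> P p = 0) ->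
  forall b, ev b != 0 -> exists (k : finFieldType) (psi : {rmorphism {poly R} -> k}),
    (forall p, ev p = 0 -> psi p = 0) /\ psi b != 0.
Proof.
move=> transc b evb.
have Pb : P b != 0 by apply: contraNneq evb => /ev_P ->.
have lb : ev0 b`_(size (P b)).-1 != 0.
  by rewrite -coef_map -/(P b) -lead_coefE lead_coef_eq0.
have [k [phi [phi0 phib]]] := specR lb.
pose q := map_poly phi b.
have q0 : q != 0.
  by apply: contraNneq phib => /polyP/(_ (size (P b)).-1); rewrite coef_map coef0 => ->.
(* a root of X q - 1 is not a root of q *)
have sq : (1 < size ('X * q - 1)%R)%N.
  rewrite mulrC size_polyDl ?size_mulX// ?size_polyN ?size_poly1 ltnS ?size_poly_gt0//.
have [k' [iota [x xr]]] := finfield_root sq.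
have [psi psiE] := ext_rmorph phi iota x.
exists k', psi; split=> [p /transc p0|].
  rewrite psiE (_ : map_poly phi p = 0) ?rmorph0 ?horner0//.
  apply/polyP => i; rewrite coef_map coef0; apply: phi0.
  by have := congr1 (fun r : {poly K} => r`_i) p0; rewrite coef_map coef0.
rewrite psiE -/q; apply/eqP => qx; move: xr.
rewrite rmorphB rmorphM rmorph1 /= map_polyX !hornerE qx mulr0 sub0r.
by move/eqP; rewrite oppr_eq0 oner_eq0.
Qed.

(** Let f have minimal degree among the polynomials killed by ev. An element r
    of minimal degree in the ideal (b, f) divides b and f up to leading
    coefficients and elements killed by ev; so ev r is nonzero, and minimality
    of f forces r to be a constant c. If c and the leading coefficient of f
    remain nonzero when the coefficients are specialized, then X can be sent to
    a root of f, where b cannot vanish. *)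
Lemma specialize_algebraic (f0 : {poly R}) : ev f0 = 0 -> P f0 != 0 ->
  forall b, ev b != 0 -> exists (k : finFieldType) (psi : {rmorphism {poly R} -> k}),
    (forall p, ev p = 0 -> psi p = 0) /\ psi b != 0.
Proof.
move=> evf0 Pf0 b evb.
have [f1 [evf1 Pf1] f1min] := @min_size [set p | ev p = 0] f0 evf0 Pf0.
pose f := trunc f1.
have [sf lf] := lead_trunc Pf1; rewrite -/f in sf lf.
have PfE : P f = P f1 by exact: P_trunc.
have evf : ev f = 0 by rewrite evE PfE -evE.
have fmin p : ev p = 0 -> (size p < size f)%N -> P p = 0.
  move=> p0 ps; apply: f1min => //; apply: leq_ltn_trans (size_poly _ _) _.
  by rewrite -sf.
have f_neq0 : f != 0 by apply: contraNneq lf => ->; rewrite lead_coef0 rmorph0.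
have Pmod p q : P p = 0 -> P (p * q) = 0.
  by move=> p0; rewrite /P rmorphM /= -/(P p) p0 mul0r.
(* the ideal (b, f), up to coefficients killed by ev *)
pose J : set {poly R} := fun r : {poly R} =>
  exists A B E : {poly R}, r = A * b + B * f + E /\ P E = 0.
have Jb : J b by exists 1, 0, 0; rewrite mul1r mul0r !addr0 /P rmorph0.
have Jf : J f by exists 0, 1, 0; rewrite mul1r mul0r add0r addr0 /P rmorph0.
have Jcomb x y p q : J p -> J q -> J (x * p - y * q).
  move=> [A [B [E [-> E0]]]] [A' [B' [E' [-> E'0]]]].
  exists (x * A - y * A'), (x * B - y * B'), (x * E - y * E'); split; first by ring.
  by rewrite /P rmorphB !rmorphM /= -/(P E) -/(P E') E0 E'0 !mulr0 subrr.
have Pb : P b != 0 by apply: contraNneq evb => /ev_P ->.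
have [r1 [Jr1 Pr1] r1min] := min_size Jb Pb.
pose r := trunc r1.
have [sr lr] := lead_trunc Pr1; rewrite -/r in sr lr.
have PrE : P r = P r1 by exact: P_trunc.
have Jr : J r.
  have [A [B [E [rE E0]]]] := Jr1; exists A, B, (E + (r - r1)).
  rewrite rE; split; first by ring.
  by rewrite /P rmorphD rmorphB /= -/(P E) -/(P r) -/(P _) -rE E0 PrE subrr addr0.
have r_neq0 : r != 0 by apply: contraNneq lr => ->; rewrite lead_coef0 rmorph0.
have rmin p : J p -> (size p < size r)%N -> P p = 0.
  move=> Jp ps; apply: r1min => //; apply: leq_ltn_trans (size_poly _ _) _.
  by rewrite -sr.
have divr p : J p -> exists n Q, lead_coef r ^+ n *: p = Q * r + p %% r /\ P (p %% r) = 0.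
  move=> Jp; exists (scalp p r), (p %/ r); split; first exact: Pdiv.Idomain.divp_eq.
  apply: rmin; last by rewrite Pdiv.Idomain.ltn_modp.
  have -> : p %% r = (lead_coef r ^+ scalp p r)%:P * p - (p %/ r) * r.
    by rewrite mul_polyC Pdiv.Idomain.divp_eq addrC addKr.
  exact: Jcomb.
have evr : ev r != 0.
  have [n [Q [E E0]]] := divr b Jb; apply: contraNneq evb => r0.
  have := congr1 ev E; rewrite -mul_polyC rmorphM rmorphD rmorphM (ev_P E0) r0 mulr0 addr0.
  have -> : ev (lead_coef r ^+ n)%:P = ev0 (lead_coef r) ^+ n by rewrite -rmorphXn.
  by move=> /eqP; rewrite mulf_eq0 expf_eq0 (negbTE lr) andbF /=.
have sr1 : size r = 1%N.
  have [n [Q [E E0]]] := divr f Jf.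
  have evQ : ev Q = 0.
    have := congr1 ev E; rewrite -mul_polyC rmorphM evf mulr0 rmorphD rmorphM (ev_P E0) addr0.
    by move=> /esym/eqP; rewrite mulf_eq0 (negbTE evr) orbF => /eqP.
  have Pf : P f != 0 by rewrite PfE.
  have Pr : P r != 0 by rewrite PrE.
  have sPr : size (P r) = size r by rewrite PrE sr.
  have PQr : P Q * P r = (ev0 (lead_coef r) ^+ n) *: P f.
    have := congr1 (map_poly ev0) E; rewrite rmorphD rmorphM /= -/(P _) -/(P _) -/(P (_ %% _)).
    rewrite E0 addr0 => <-.
    by rewrite /P map_polyZ rmorphXn.
  have Q0 : P Q != 0.
    apply: contraNneq Pf => Q0; move: PQr; rewrite Q0 mul0r => /esym/eqP.
    by rewrite scaler_eq0 expf_eq0 (negbTE lr) andbF.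
  have := congr1 (fun p : {poly K} => size p) PQr.
  rewrite /= size_mul// size_scale ?expf_neq0// sPr => sQ.
  have sr0 : (0 < size r)%N by rewrite size_poly_gt0.
  have [sr2|sr2|//] := ltngtP (size r) 1%N; first by rewrite ltnS leqNgt sr0 in sr2.
  exfalso; move/negP: Q0; apply; apply/eqP.
  apply: f1min => //; rewrite -PfE -sQ -subn1 -addnBA//.
  by rewrite -[X in (X < _)%N]addn0 ltn_add2l subn_gt0.
have [c rE] : exists c, r = c%:P by exists r`_0; apply: size1_polyC; rewrite sr1.
have [A [B [E [rJ E0]]]] := Jr.
have lc : ev0 c != 0 by have := lr; rewrite rE lead_coefC.
have lfc : ev0 (lead_coef f * c) != 0 by rewrite rmorphM mulf_neq0.
have [k [phi [phi0 phib]]] := specR lfc.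
move: phib; rewrite rmorphM mulf_eq0 negb_or => /andP[phil phic].
have szf : size (map_poly phi f) = size f.
  by apply: size_poly_eq; rewrite -lead_coefE.
have sf2 : (1 < size (map_poly phi f))%N.
  rewrite szf ltnNge; apply: contra lf => /size1_polyC fE.
  by move: evf; rewrite fE lead_coefC => /eqP.
have [k' [iota [x xr]]] := finfield_root sf2.
have [psi psiE] := ext_rmorph phi iota x.
have psiP p : P p = 0 -> psi p = 0.
  move=> p0; rewrite psiE (_ : map_poly phi p = 0) ?rmorph0 ?horner0//.
  apply/polyP => i; rewrite coef_map coef0; apply: phi0.
  by have := congr1 (fun r : {poly K} => r`_i) p0; rewrite coef_map coef0.
have psif : psi f = 0 by rewrite psiE.
have psiC a : psi a%:P = iota (phi a) by rewrite psiE !map_polyC hornerC.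
exists k', psi; split=> [p evp|].
  have E1 := Pdiv.Idomain.divp_eq p f.
  have evm : ev (p %% f) = 0.
    have := congr1 ev E1; rewrite -mul_polyC rmorphM evp mulr0 rmorphD rmorphM evf mulr0 add0r.
    by move=> <-.
  have Pm : P (p %% f) = 0 by apply: fmin => //; rewrite Pdiv.Idomain.ltn_modp.
  have := congr1 psi E1; rewrite -mul_polyC rmorphM rmorphD rmorphM psif mulr0 add0r (psiP _ Pm).
  move/eqP; rewrite mulf_eq0 psiC fmorph_eq0 rmorphXn expf_eq0 => /orP[/andP[_]|/eqP//].
  by rewrite (negbTE phil).
have := congr1 psi rJ; rewrite rE psiC !rmorphD !rmorphM psif mulr0 addr0 (psiP _ E0) addr0.
move=> H; apply: contraNneq phic => b0; rewrite b0 mulr0 in H.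
by move/eqP: H; rewrite fmorph_eq0.
Qed.

End SpecializePoly.

Lemma specializable_poly (R : idomainType) : specializable R -> specializable {poly R}.
Proof.
move=> specR K ev b evb.
have [transc|] := pselect (forall p, ev p = 0 -> map_poly (ev \o polyC) p = 0).
  exact: specialize_transcendental specR transc b evb.
move=> /existsNP[f /not_implyP[evf /eqP Pf]].
exact: specialize_algebraic specR f evf Pf b evb.
Qed.

(** Every finitely generated subring of a field of characteristic 0 is the image
    of an iterated polynomial ring over the integers. *)
Lemma finitely_generated_subring (K : numFieldType) (s : seq K) :
  exists (R : idomainType) (ev : {rmorphism R -> K}),
    specializable R /\ forall x, x \in s -> exists a, ev a = x.
Proof.
elim: s => [|x s [R [ev [specR evs]]]].
  by exists int, (intr : {rmorphism int -> K}); split; first exact: specializable_int.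
have cx : commr_rmorph ev x by move=> a; exact: mulrC.
exists {poly R}, (horner_morph cx); split; first exact: specializable_poly.
move=> y; rewrite inE => /orP[/eqP ->|/evs[a <-]].
  by exists 'X; rewrite /= horner_morphX.
by exists a%:P; rewrite /= horner_morphC.
Qed.

(** * Residual finiteness *)

Definition residually_finite (F : groupType) : Prop :=
  forall x : F, x <> 1%g -> exists N : fin_normal F, ~ sg_set N x.

(** The matrix entries lie in a finitely generated ring. An entry in which rho x
    differs from the identity survives in some finite field, and the matrices
    over that field provide a finite quotient of F. *)
Theorem malcev (F : groupType) (K : numFieldType) n (rho : F -> 'M[K]_n) (S : seq F) :
  rho 1%g = 1%:M -> (forall x y, rho (x * y)%g = rho x *m rho y) ->
  (forall x, rho x = 1%:M -> x = 1%g) ->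
  (forall P : set F, P 1%g -> (forall x y, x \in S -> P y -> P (x * y)%g) ->
     forall y, P y) ->
  residually_finite F.
Proof.
move=> rho1 rhoM rhoI gen x x1.
have [R [ev [specR evs]]] := finitely_generated_subring
  (flatten [seq flatten [seq [seq rho g i j | j <- enum 'I_n] | i <- enum 'I_n] | g <- S]).
have rng y i j : exists a, ev a = rho y i j.
  move: y i j; apply: gen => [i j|g y gS IH i j].
    by exists (i == j)%:R; rewrite rho1 mxE rmorph_nat.
  have /choice[f fE] : forall k, exists a, ev a = rho g i k.
    move=> k; apply: evs; apply/flattenP.
    exists (flatten [seq [seq rho g i j | j <- enum 'I_n] | i <- enum 'I_n]).
      by apply/mapP; exists g.
    apply/flattenP; exists [seq rho g i j | j <- enum 'I_n].
      by apply/mapP; exists i; rewrite ?mem_enum.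
    by apply/mapP; exists k; rewrite ?mem_enum.
  have /choice[f' f'E] : forall k, exists a, ev a = rho y k j by move=> k; exact: IH.
  exists (\sum_k f k * f' k); rewrite rhoM mxE rmorph_sum/=.
  by apply: eq_bigr => k _; rewrite rmorphM fE f'E.
have /choice[M ME] : forall y, exists A : 'M[R]_n, map_mx ev A = rho y.
  move=> y; have /choice[f fE] : forall p : 'I_n * 'I_n, exists a, ev a = rho y p.1 p.2.
    by move=> p; exact: rng.
  by exists (\matrix_(i, j) f (i, j)); apply/matrixP => i j; rewrite !mxE fE.
have [i [j ij]] : exists i j, rho x i j != (i == j)%:R.
  apply: contrapT => no; apply: x1; apply: rhoI; apply/matrixP => i j; rewrite mxE.
  by apply/eqP; apply: contra_notT no => ij; exists i, j.
pose b := M x i j - (i == j)%:R.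
have evb : ev b != 0.
  have := congr1 (fun X : 'M[K]_n => X i j) (ME x); rewrite mxE => E.
  by rewrite rmorphB rmorph_nat subr_eq0 E.
have [k [phi [phi0 phib]]] := specR K ev b evb.
pose psi y := map_mx phi (M y).
have psiE (A B : 'M[R]_n) : map_mx ev A = map_mx ev B -> map_mx phi A = map_mx phi B.
  move=> AB; apply/matrixP => i' j'; rewrite !mxE; apply/eqP; rewrite -subr_eq0 -rmorphB.
  apply/eqP/phi0; rewrite rmorphB; apply/eqP; rewrite subr_eq0; apply/eqP.
  by have := congr1 (fun X : 'M[K]_n => X i' j') AB; rewrite !mxE.
have psi1 : psi 1%g = 1%:M.
  by rewrite -(map_mx1 phi); apply: psiE; rewrite ME rho1 map_mx1.
have psiM y z : psi (y * z)%g = psi y *m psi z.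
  by rewrite /psi -map_mxM; apply: psiE; rewrite map_mxM !ME rhoM.
have psiV y : psi y = 1%:M -> psi y^-1%g = 1%:M.
  by move=> y1; rewrite -[psi _]mulmx1 -y1 -psiM mulVg psi1 y1.
have NM y z : [set y | psi y = 1%:M] y -> [set y | psi y = 1%:M] z ->
    [set y | psi y = 1%:M] (y * z)%g.
  by move=> /= py pz; rewrite psiM py pz mulmx1.
pose N0 := @Subgroup F [set y | psi y = 1%:M] psi1 NM psiV.
have NJ y z : sg_set N0 y -> sg_set N0 (y ^ z)%g.
  by move=> /= y1; rewrite conjgE !psiM y1 mul1mx -psiM mulVg psi1.
have Nfin : finite_index N0 [set: F].
  apply: (@sub_finite_set _ _ ((fun A => [set y | psi y = A]) @` [set: 'M[k]_n])).
    move=> _ [y _ <-]; exists (psi y) => //; apply/seteqP; split=> z; rewrite /lcoset/= => H.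
      by rewrite psiM H -psiM mulVg psi1.
    by rewrite -[psi z]mul1mx -psi1 -(mulgV y) psiM -mulmxA -psiM H mulmx1.
  exact/finite_image/finite_finset.
exists (FinNormal NJ Nfin) => /= px.
move/eqP: phib; apply; rewrite /b rmorphB rmorph_nat.
by have := congr1 (fun X : 'M[k]_n => X i j) px; rewrite !mxE => ->; rewrite subrr.
Qed.

Section LorentzRepresentation.
Variable R : realType.
Local Notation C := R[i].
Local Notation disc := (disc R).
Local Notation Aut := (Aut R).

(** The point of the hyperboloid over z, on which automorphisms act linearly. *)
Definition hyperboloid (z : disc) : 'rV[C]_4 :=
  \row_j ([:: 1; dval z; cj (dval z); dval z * cj (dval z)]`_j /
          (1 - dval z * cj (dval z))).

Lemma dval_den (z : disc) : 1 - dval z * cj (dval z) != 0.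
Proof. by rewrite mulrC; apply: mob_den; rewrite ?dval_lt1// ltW ?dval_lt1. Qed.

Lemma hyperboloid_aut (g : Aut) : exists L : 'M[C]_4,
  forall z, hyperboloid (g z) = hyperboloid z *m L.
Proof.
have [c [a [c1 a1 gE]]] := aut_mobius g.
have c0 : c != 0 by rewrite -cabs_gt0 c1.
have a0 : 1 - cj a * a != 0 by apply: mob_den => //; exact: ltW.
pose k := (1 - cj a * a)^-1.
pose b := cj a.
(* with x = dval z and y its conjugate, column j expands in the monomials 1, x, y, x y
   the numerator of coordinate j *)
exists (\matrix_(i < 4, j < 4) nth 0 (nth [::] [:: [:: k; - k * b; - k * a; k * a * b];
    [:: - k * c * a; k * c; k * c * a ^+ 2; - k * c * a];
    [:: - k / c * b; k / c * b ^+ 2; k / c; - k / c * b];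
    [:: k * a * b; - k * b; - k * a; k]] j) i) => z.
have D1 := mob_den a1 (ltW (dval_lt1 z)).
have D2 : 1 - a * cj (dval z) != 0.
  by have := D1; rewrite -conjc_eq0 rmorphB rmorphM rmorph1 /= conjcK.
have D3 := dval_den z; have D4 := dval_den (g z).
have gc : cj (dval (g z)) = c^-1 * (cj (dval z) - b) / (1 - a * cj (dval z)).
  rewrite gE /mob !rmorphM fmorphV !rmorphB rmorph1 rmorphM /= conjcK.
  by rewrite (unit_conjE c1).
apply/rowP => j; rewrite !mxE !big_ord_recl big_ord0 !mxE /=.
rewrite gc gE /mob -/b in D4 *; rewrite -/b in D1 a0; rewrite /k -/b.
move: (dval z) (cj (dval z)) D1 D2 D3 D4 => x y D1 D2 D3 D4.
have D5 : (1 - b * x) * (1 - a * y) - (x - a) * (y - b) != 0.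
  by rewrite (_ : _ - _ = (1 - b * a) * (1 - x * y)) ?mulf_neq0//; ring.
case: j => [[|[|[|[|//]]]] jP] /=; field; rewrite ?c0 ?a0 ?D1 ?D2 ?D3 ?D5 //=.
Qed.

(** The points over 0, 1/2, -1/2 and i/2 span. *)
Lemma hyperboloid_spans (A B : 'M[C]_4) :
  (forall z, hyperboloid z *m A = hyperboloid z *m B) -> A = B.
Proof.
move=> AB; apply/matrixP => i j.
pose i1 : 'I_4 := lift ord0 ord0; pose i2 : 'I_4 := lift ord0 (lift ord0 ord0).
pose i3 : 'I_4 := lift ord0 (lift ord0 (lift ord0 ord0)).
pose d (i : 'I_4) := A i j - B i j.
have lin (x : C) : cabs x < 1 ->
    d ord0 + d i1 * x + d i2 * cj x + d i3 * (x * cj x) = 0.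
  move=> x1; have [z <-] := disc_exists x1; have D := dval_den z.
  have /rowP/(_ j) := AB z; rewrite !mxE !big_ord_recl !big_ord0 !mxE /=.
  rewrite -/i1 -/i2 -/i3 => /eqP; rewrite -subr_eq0 => /eqP E.
  move: D E; move: (dval z) (cj (dval z)) => u v D E.
  by rewrite -[LHS](mulfK D) -[RHS](mul0r (1 - u * v)) -E /d; field.
have h1 : cabs (2^-1 : C) < 1 by rewrite cabsV -[2]/(2%:R) -(rmorph_nat (real_complex R)) cabs_real ger0_norm; lra.
have ih1 : cabs ('i%C / 2 : C) < 1 by rewrite cabsM /cabs/= expr0n/= expr1n add0r sqrtr1 mul1r; exact: h1.
have c2 : cj (2^-1 : C) = 2^-1 by rewrite fmorphV rmorph_nat.
have ci : cj ('i%C / 2 : C) = - 'i%C / 2.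
  rewrite rmorphM fmorphV rmorph_nat; congr (_ / _).
  by apply/eqP; rewrite eq_complex/= oppr0 !eqxx.
have i2E : 'i%C * 'i%C = -1 :> C by rewrite -expr2 sqr_i.
have := lin 0; rewrite cabs0 conjc0 !mulr0 !addr0 => /(_ ltr01) d0.
have H1 := lin _ h1; rewrite c2 d0 add0r in H1.
have c2N : cj (- 2^-1 : C) = - 2^-1 by rewrite rmorphN; congr (- _).
have := lin (- 2^-1); rewrite cabsN c2N d0 add0r => /(_ h1) H2.
have H3 := lin _ ih1; rewrite ci d0 add0r in H3.
have d3 : d i3 = 0.
  have : d i3 = 2 * ((d i1 * 2^-1 + d i2 * 2^-1 + d i3 * (2^-1 * 2^-1)) +
    (d i1 * - 2^-1 + d i2 * - 2^-1 + d i3 * (- 2^-1 * - 2^-1))) by field.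
  by rewrite H1 H2 addr0 mulr0.
rewrite d3 mul0r addr0 in H1; rewrite d3 mul0r addr0 in H3.
have d12 : d i1 = - d i2.
  by apply/eqP; rewrite -subr_eq0 opprK; apply/eqP; rewrite -[RHS](mulr0 2) -H1; field.
have d2 : d i2 = 0.
  have : d i2 = (d i1 * ('i%C / 2) + d i2 * (- 'i%C / 2)) * 'i%C.
    rewrite d12 (_ : _ * 'i%C = - d i2 * ('i%C * 'i%C)); last by field.
    by rewrite i2E mulrN1 opprK.
  by rewrite H3 mul0r.
apply/eqP; rewrite -subr_eq0; apply/eqP; rewrite -/(d i).
have d1 : d i1 = 0 by rewrite d12 d2 oppr0.
have -> // : d i = 0.
case: i => [[|[|[|[|//]]]] iP]; [rewrite -[RHS]d0|rewrite -[RHS]d1|rewrite -[RHS]d2|rewrite -[RHS]d3];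
  by congr d; apply: val_inj.
Qed.

Lemma hyperboloid_inj : injective hyperboloid.
Proof.
move=> z w zw; apply: dval_inj.
have /rowP H := zw; have := H ord0; have := H (lift ord0 ord0); rewrite !mxE /=.
rewrite !mul1r => + /invr_inj E; rewrite E => /mulIf -> //.
by rewrite invr_eq0 dval_den.
Qed.

Lemma inG (G : subgroup Aut) (g : Aut) : sg_set G g -> exists y : subg_of G, val y = g.
Proof. by move=> Gg; exists (SigSub (mem_set Gg)). Qed.

(** The action on the hyperboloid is a faithful linear representation; inverses
    appear because matrices act on row vectors. *)
Theorem fuchsian_residually_finite (G : subgroup Aut) :
  fuchsian G -> cocompact G -> residually_finite (subg_of G).
Proof.
move=> Gf Gc; have [r r1 dom] := fundamental_ball Gc.
have [S [Sfin SG] Sgen] := finitely_generated Gf r1 dom.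
have /choice[L LE] := hyperboloid_aut.
have [s sS] := (finite_seqP S).1 Sfin.
pose s' : seq (subg_of G) := map (insubd 1%g) s.
pose rho (x : subg_of G) := L (val x^-1%g).
have LM (g h : Aut) : L (g * h)%g = L h *m L g.
  by apply: hyperboloid_spans => z; rewrite mulmxA -!LE.
apply: (@malcev _ _ _ rho s').
- apply: hyperboloid_spans => z; rewrite /rho invg1 -LE mulmx1.
  by congr hyperboloid.
- by move=> x y; rewrite /rho invgM -LM.
- move=> x x1; apply: invg_inj; apply: val_inj; rewrite invg1.
  apply: aut_eq => z; apply: hyperboloid_inj; rewrite LE -/(rho x) x1 mulmx1.
  by [].
- move=> P P1 PS y.
  pose P' : set Aut := [set g | forall h : subg_of G, val h = g -> P h].
  have Gy : sg_set G (val y) := set_valP y.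
  apply: (Sgen P' _ _ (val y) Gy) => // [h h1|x g Sx Gg P'g h hE].
    by rewrite (_ : h = 1%g)//; exact: val_inj.
  have [x' x'E] := inG (SG _ Sx); have [g' g'E] := inG Gg.
  rewrite (_ : h = x' * g')%g; last by apply: val_inj; rewrite hE /= x'E g'E.
  apply: PS; last exact: P'g.
  apply/mapP; exists x; first by move: Sx; rewrite sS.
  by apply: val_inj; rewrite val_insubd; case: ifP => //; rewrite -x'E (valP x').
Qed.

End LorentzRepresentation.

Local Open Scope group_scope.

(** * Profinite completions *)

Section FiniteIndex.
Variable gT : groupType.
Implicit Types (A B : subgroup gT) (x y z : gT).

Lemma finite_indexP B (A : set gT) : finite_index B A <->
  exists s : seq gT, forall x, A x -> exists2 y, y \in s & sg_set B (y^-1 * x).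
Proof.
split=> [Bfin|[s sP]].
  pose pick (X : set gT) : gT := xget 1 X.
  have [s sE] := (finite_seqP _).1 (finite_image pick Bfin).
  exists s => x Ax.
  have xs : [set` s] (pick (lcoset x B)).
    by rewrite -sE; exists (lcoset x B) => //; exists x.
  exists (pick (lcoset x B)) => //; rewrite /pick; case: xgetP => [y _|no].
    by rewrite /lcoset/= => /sgV; rewrite invgM invgK.
  by have := no x; rewrite /lcoset/= mulVg; case; exact: sg1.
apply: (@sub_finite_set _ _ ((fun y => lcoset y B) @` [set` s])).
  move=> _ [x Ax <-]; have [y ys yx] := sP x Ax; exists y => //.
  apply/seteqP; split=> z; rewrite /lcoset/= => H.
    rewrite (_ : x^-1 * z = (y^-1 * x)^-1 * (y^-1 * z)); first by apply: sgM => //; exact: sgV.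
    by rewrite invgM invgK -!mulgA mulVKg.
  rewrite (_ : y^-1 * z = (y^-1 * x) * (x^-1 * z)); first exact: sgM.
  by rewrite -!mulgA mulVKg.
exact/finite_image/finite_seq.
Qed.

Lemma finite_index_sub A B (C : set gT) : A `<=` B -> finite_index A C -> finite_index B C.
Proof.
move=> AB /finite_indexP[s sP]; apply/finite_indexP; exists s => x /sP[y ys Ay].
by exists y => //; exact: AB.
Qed.

Lemma finite_indexI A B (C : set gT) :
  finite_index A C -> finite_index B C -> finite_index (subgI A B) C.
Proof.
move=> fA fB; have fAB := finite_setX fA fB.
apply: sub_finite_set (finite_image (fun p => p.1 `&` p.2) fAB).
move=> _ [x Cx <-]; exists (lcoset x A, lcoset x B) => //=.
by split; exists x.
Qed.

(** The intersection of the conjugates of A. A conjugate only depends on a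
    coset, so that finitely many of them suffice. *)
Lemma finite_index_setT A : finite_index A [set: gT] ->
  exists N : fin_normal gT, N `<=` A.
Proof.
move=> fA; have [s sP] := (finite_indexP A setT).1 fA.
pose N0 : set gT := [set z | forall x, sg_set A (z ^ x)].
have N1 : N0 1 by move=> x; rewrite conj1g; exact: sg1.
have NM x y : N0 x -> N0 y -> N0 (x * y).
  by move=> Nx Ny z; rewrite conjMg; exact: sgM.
have NV x : N0 x -> N0 x^-1 by move=> Nx z; rewrite conjVg; exact: sgV.
pose N := Subgroup N1 NM NV.
have NJ x y : sg_set N x -> sg_set N (x ^ y).
  by move=> Nx z; rewrite -conjgM; exact: Nx.
have fconj y : finite_index (subgJ y A) [set: gT].
  apply/finite_indexP; exists [seq y * t * y^-1 | t <- s] => x _.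
  have [t ts tx] := sP (x ^ y) I; exists (y * t * y^-1); first by apply/mapP; exists t.
  rewrite /= conjgE; move: tx; rewrite conjgE.
  by rewrite !invgM !invgK !mulgA mulVg mul1g.
have finN : exists B : subgroup gT, finite_index B [set: gT] /\
    forall z y, sg_set B z -> y \in s -> sg_set A (z ^ y).
  elim: (s) => [|y s' [B [fB BP]]].
    exists (@Subgroup gT setT I (fun _ _ _ _ => I) (fun _ _ => I)); split => //.
    by apply/finite_indexP; exists [:: 1] => x _; exists 1; rewrite ?inE.
  exists (subgI (subgJ y A) B); split; first exact: finite_indexI.
  move=> z y' [zA zB]; rewrite inE => /orP[/eqP ->|]; first exact: zA.
  exact: BP.
have [B [fB BP]] := finN.
have BN : B `<=` N.
  move=> z Bz x; have [y ys yx] := sP x I.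
  rewrite (_ : x = y * (y^-1 * x)); last by rewrite mulgA mulgV mul1g.
  rewrite conjgM [X in sg_set A X]conjgE; apply: sgM; first exact: sgV.
  by apply: sgM => //; exact: BP.
exists (FinNormal NJ (finite_index_sub BN fB)) => x Nx.
by rewrite -(conjg1 x); exact: Nx.
Qed.

Lemma fin_normalI (M N : fin_normal gT) :
  exists L : fin_normal gT, L `<=` M /\ L `<=` N.
Proof.
have [L LMN] := finite_index_setT (finite_indexI (fin_normal_index M) (fin_normal_index N)).
by exists L; split=> x /LMN[].
Qed.

End FiniteIndex.

Lemma compact_set_type (X : topologicalType) (A : set X) :
  compact A -> compact [set: set_type A].
Proof.
move=> cA F PF FT.
have PF' : ProperFilter ((set_val : set_type A -> X) @ F) by exact: fmap_proper_filter.
have FA : F (set_val @^-1` A) by apply: filterS FT => x _; exact: set_valP.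
have [p [Ap pcl]] := cA _ PF' FA.
exists (SigSub (mem_set Ap)); split => // B D FB; rewrite nbhsE => -[_ [[W oW <-] Wp] WD].
have FB' : F (set_val @^-1` (set_val @` B)) by apply: filterS FB => w Bw; exists w.
have Wn : nbhs p W by rewrite nbhsE; exists W.
have [_ [[w Bw <-] wW]] := pcl _ _ FB' Wn.
by exists w; split => //; exact: WD.
Qed.

Section ProfiniteTopology.
Variable F : groupType.
Implicit Types (u v w : profinite F) (N M : fin_normal F).

(** The type gives access to the group structure of the component, which the
    topological product hides. *)
Definition pcoord u N : quot N := set_val u N.

Lemma pcoord_inj u v : (forall N, pcoord u N = pcoord v N) -> u = v.
Proof. exact: profinite_eq. Qed.
Lemma pcoordM u v N : pcoord (u * v) N = pcoord u N * pcoord v N. Proof. by []. Qed.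
Lemma pcoord_to (x : F) N : pcoord (to_profinite x) N = \pi_(quot N)%qT x. Proof. by []. Qed.

Lemma pcoord_sub u v M N : M `<=` N -> pcoord u M = pcoord v M -> pcoord u N = pcoord v N.
Proof.
move=> MN uv; apply: etrans (esym (set_valP u M N MN)) _.
apply: etrans (set_valP v M N MN).
exact: (congr1 (fun a : quot M => \pi_(quot N)%qT (repr a)) uv).
Qed.

Lemma exists_fin_normal : exists N : fin_normal F, True.
Proof.
have fT : finite_index (@Subgroup F setT I (fun _ _ _ _ => I) (fun _ _ => I)) [set: F].
  by apply/finite_indexP; exists [:: 1] => x _; exists 1; rewrite ?inE.
by have [N _] := finite_index_setT fT; exists N.
Qed.

Lemma pcoord_open u N : open [set v | pcoord v N = pcoord u N].
Proof.
have c1 : continuous (set_val : profinite F -> quot_prod F).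
  exact: initial_continuous.
have c2 : continuous (fun f : quot_prod F => f N : discrete_topology (quot N)).
  exact: (@proj_continuous (fin_normal F) (fun N => discrete_topology (quot N)) N).
pose V : set (discrete_topology (quot N)) := [set pcoord u N].
exact: ((continuousP _).1 c1 _ ((continuousP _).1 c2 _ (discrete_open V))).
Qed.

(** A neighbourhood constrains finitely many components, all of which are
    determined by the one at the intersection of the subgroups. *)
Lemma nbhs_profiniteP u (A : set (profinite F)) :
  nbhs u A <-> exists N, forall v, pcoord v N = pcoord u N -> A v.
Proof.
split; last first.
  move=> [N NA]; rewrite nbhsE; exists [set v | pcoord v N = pcoord u N] => //.
  by split => //; exact: pcoord_open.
pose G : set_system (profinite F) := [set A | exists N, forall v, pcoord v N = pcoord u N -> A v].
have FG : Filter G.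
  split; first by have [N _] := exists_fin_normal; exists N.
  - move=> B D [M BM] [N DN]; have [L [LM LN]] := fin_normalI M N.
    exists L => v vu; split; [apply: BM|apply: DN]; exact: pcoord_sub vu.
  - by move=> B D BD [M BM]; exists M => v /BM/BD.
have Gu : ((set_val : profinite F -> quot_prod F) @ G) --> (set_val u : quot_prod F).
  apply/cvg_sup => N W; rewrite nbhsE => -[_ [[D oD <-] Du] DW].
  exists N => v vu; apply: DW; rewrite /= /proj in Du *.
  by rewrite (_ : set_val v N = set_val u N).
rewrite nbhsE => -[_ [[W oW <-] Wu] WA].
have /Gu[N NW] : nbhs (set_val u : quot_prod F) W by rewrite nbhsE; exists W.
by exists N => v /NW/WA.
Qed.

Lemma quot_finite N : finite_set [set: quot N].
Proof.
pose pick (X : set F) : quot N := \pi_(quot N)%qT (xget 1 X).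
apply: sub_finite_set (finite_image pick (fin_normal_index N)).
elim/quotW => x _; exists (lcoset x N); first by exists x.
apply/esym/quot_eqP; rewrite /pick; case: xgetP => [y _//|no].
by have := no x; rewrite /lcoset/= mulVg; case; exact: sg1.
Qed.

(** Coherence is a closed condition in a product of finite discrete spaces. *)
Lemma profinite_compact : compact [set: profinite F].
Proof.
apply: compact_set_type.
have cT : compact [set f : quot_prod F | forall N, [set: discrete_topology (quot N)] (f N)].
  apply: (@tychonoff (fin_normal F) (fun N => discrete_topology (quot N)) (fun N => setT)).
  by move=> N; apply: finite_compact; exact: quot_finite.
have pn (f : quot_prod F) N : nbhs f [set g | g N = f N].
  have c2 : continuous (fun f : quot_prod F => f N : discrete_topology (quot N)).
    exact: (@proj_continuous (fin_normal F) (fun N => discrete_topology (quot N)) N).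
  apply: (c2 f [set f N]); rewrite nbhsE; exists [set f N] => //.
  by split => //; exact: discrete_open.
have cC : closed (@coherent F).
  rewrite -[coherent (F:=F)]setCK; apply: open_closedC; rewrite openE => f /= fn.
  have [M [N [MN fMN]]] : exists M N : fin_normal F,
      M `<=` N /\ \pi_(quot N)%qT (repr (f M : quot M)) <> f N.
    apply: contrapT => no; apply: fn => M N MN; apply: contrapT => fMN.
    by apply: no; exists M, N.
  have FF : Filter (nbhs f) by exact: nbhs_filter.
  apply: (@filterS _ _ FF _ _ _ (filterI (pn f M) (pn f N))) => g /= [gM gN] gc.
  by apply: fMN; rewrite -gM -gN; exact: gc.
exact: subclosed_compact cC cT _.
Qed.

Lemma profinite_separated u v : u <> v -> exists N, pcoord u N <> pcoord v N.
Proof.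
move=> uv; apply: contrapT => no; apply: uv; apply: pcoord_inj => N.
by apply: contrapT => ?; apply: no; exists N.
Qed.

Lemma to_profinite_dense u N : exists x, pcoord (to_profinite x) N = pcoord u N.
Proof. by exists (repr (pcoord u N)); rewrite pcoord_to reprK. Qed.

Lemma to_profinite_eq (x y : F) N :
  pcoord (to_profinite x) N = pcoord (to_profinite y) N <-> sg_set N (x^-1 * y).
Proof. exact: quot_eqP. Qed.

Lemma profinite_mull_continuous u : continuous (fun v => u * v).
Proof.
move=> v A /nbhs_profiniteP[N NA]; apply/nbhs_profiniteP; exists N => w wv.
by apply: NA; rewrite !pcoordM wv.
Qed.

Lemma profinite_closed_dense (A : set (profinite F)) :
  closed A -> (forall x, A (to_profinite x)) -> A = setT.
Proof.
move=> cA Ax; apply/seteqP; split=> // u _; apply: cA => B /nbhs_profiniteP[N NB].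
have [x xN] := to_profinite_dense u N; exists (to_profinite x); split => //.
exact: NB.
Qed.

Lemma profinite_hausdorff : hausdorff_space (profinite F).
Proof.
move=> u v uv; apply: contrapT => /profinite_separated[N uvN].
have Un : nbhs u [set w | pcoord w N = pcoord u N] by apply/nbhs_profiniteP; exists N.
have Vn : nbhs v [set w | pcoord w N = pcoord v N] by apply/nbhs_profiniteP; exists N.
by have [w [/= wu wv]] := uv _ _ Un Vn; apply: uvN; rewrite -wu -wv.
Qed.

End ProfiniteTopology.

Section ProfiniteMap.
Variables (F E : groupType) (phi : {multiplicative F -> E}).

Lemma pcoord_map u (N : fin_normal E) :
  pcoord (profinite_map phi u) N = \pi_(quot N)%qT (phi (repr (pcoord u (preim_normal phi N)))).
Proof. by []. Qed.

Lemma profinite_map_continuous : continuous (profinite_map phi).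
Proof.
move=> u A /nbhs_profiniteP[N NA]; apply/nbhs_profiniteP.
exists (preim_normal phi N) => v vu; apply: NA; rewrite !pcoord_map.
by rewrite vu.
Qed.

Lemma pcoord_map_eq u v (N : fin_normal E) :
  pcoord (profinite_map phi u) N = pcoord (profinite_map phi v) N ->
  pcoord u (preim_normal phi N) = pcoord v (preim_normal phi N).
Proof.
rewrite !pcoord_map => /quot_eqP H.
rewrite -(reprK (pcoord u _)) -(reprK (pcoord v _)); apply/quot_eqP => /=.
by rewrite gmulfM multiplicativeV.
Qed.

(** Through phi, F is a subgroup of finite index in E, with s representing its cosets. *)
Hypothesis phi_inj : injective phi.
Variable s : seq E.
Hypothesis phi_cofinite : forall x, exists2 y, y \in s & exists h, x = y * phi h.

(** A subgroup of finite index in F has finite index in E: the profinite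
    topology of F is induced by that of E. *)
Lemma image_subgroup_index (M : fin_normal F) : exists N : fin_normal E,
  forall x, sg_set N x -> exists2 h, sg_set M h & phi h = x.
Proof.
pose A0 : set E := phi @` M.
have A1 : A0 1 by exists 1; [exact: sg1|exact: multiplicative1].
have AM x y : A0 x -> A0 y -> A0 (x * y).
  by move=> [h Mh <-] [k Mk <-]; exists (h * k); [exact: sgM|exact: gmulfM].
have AV x : A0 x -> A0 x^-1.
  by move=> [h Mh <-]; exists h^-1; [exact: sgV|exact: multiplicativeV].
have fA : finite_index (Subgroup A1 AM AV) [set: E].
  have [t tP] := (finite_indexP M setT).1 (fin_normal_index M).
  apply/finite_indexP; exists [seq y * phi k | y <- s, k <- t] => x _.
  have [y ys [h ->]] := phi_cofinite x; have [k kt Mkh] := tP h I.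
  exists (y * phi k); first by apply/allpairsP; exists (y, k).
  exists (k^-1 * h) => //.
  by rewrite gmulfM multiplicativeV invgM -!mulgA mulKg.
by have [N NA] := finite_index_setT fA; exists N => x /NA[h Mh <-]; exists h.
Qed.

Lemma profinite_map_inj : injective (profinite_map phi).
Proof.
move=> u v uv; apply: pcoord_inj => M; have [N NM] := image_subgroup_index M.
apply: (@pcoord_sub _ _ _ (preim_normal phi N)).
  by move=> x /NM[h Mh /phi_inj <-].
by apply: pcoord_map_eq; rewrite uv.
Qed.

Lemma profinite_map_to_image u x : profinite_map phi u = to_profinite x ->
  exists h, phi h = x.
Proof.
move=> ux; have [M _] := exists_fin_normal F.
have [N NM] := image_subgroup_index M.
have := congr1 (fun w => pcoord w N) ux; rewrite /= pcoord_map pcoord_to => /quot_eqP/NM[h _ hE].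
exists (repr (pcoord u (preim_normal phi N)) * h).
by rewrite gmulfM hE mulgA mulgV mul1g.
Qed.

(** The finitely many translates of the image are compact and cover the dense
    subgroup E. *)
Lemma profinite_map_cofinite v :
  exists y u, v = to_profinite y * profinite_map phi u.
Proof.
pose A y : set (profinite E) := (fun w => to_profinite y * w) @` range (profinite_map phi).
have clA y : closed (A y).
  apply: compact_closed; first exact: profinite_hausdorff.
  apply: continuous_compact; first exact/continuous_subspaceT/profinite_mull_continuous.
  apply: continuous_compact; first exact/continuous_subspaceT/profinite_map_continuous.
  exact: profinite_compact.
have cl : closed (\bigcup_(y in [set` s]) A y).
  by apply: closed_bigcup; [exact: finite_seq|move=> y _; exact: clA].
have [] : (\bigcup_(y in [set` s]) A y) v.
  rewrite (profinite_closed_dense cl) // => x.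
  have [y ys [h ->]] := phi_cofinite x; exists y => //.
  by exists (profinite_map phi (to_profinite h)); [exists (to_profinite h)|rewrite profinite_map_to to_profiniteM].
by move=> y _ [_ [u _ <-] <-]; exists y, u.
Qed.

End ProfiniteMap.

(** * Topology of the solenoid *)

Lemma closed_equalizer (T U : topologicalType) (f g : T -> U) : hausdorff_space U ->
  continuous f -> continuous g -> closed [set x | f x = g x].
Proof.
move=> hU fc gc x xcl; apply: hU => A B fA gB.
have nx : nbhs x (f @^-1` A `&` g @^-1` B) by apply: filterI; [exact: fc|exact: gc].
have [y [/= fg [Ay By]]] := xcl _ nx.
by exists (f y); split => //; rewrite fg.
Qed.

Lemma compact_inverse_continuous (T U : topologicalType) (f : T -> U) (g : U -> T) :
  compact [set: T] -> hausdorff_space U -> continuous f -> cancel f g -> cancel g f ->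
  continuous g.
Proof.
move=> cT hU fc fK gK; apply/continuousP => A oA.
rewrite (_ : g @^-1` A = ~` (f @` (~` A))).
  apply: closed_openC; apply: compact_closed => //.
  apply: continuous_compact; first exact: continuous_subspaceT.
  by apply: subclosed_compact cT _ => //; exact: open_closedC.
apply/seteqP; split=> y /=.
  by move=> Agy [x nAx xy]; apply: nAx; rewrite -(fK x) xy.
by move=> H; apply: contrapT => nA; apply: H; exists (g y).
Qed.

Section SolenoidTopology.
Variable R : realType.
Local Notation disc := (disc R).
Local Notation Aut := (Aut R).
Implicit Types (G H K : subgroup Aut) (g : Aut).

Lemma slice_eqP G (u v : hat G) z w : slice u z = slice v w <->
  exists g : subg_of G, w = (val g : Aut) z /\ v = to_profinite g * u.
Proof.
rewrite /slice; split=> [/orbit_ofP[g [-> ->]]|[g [-> ->]]]; first by exists g.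
by apply/orbit_ofP; exists g.
Qed.

Lemma slice_act G (u : hat G) (g : subg_of G) z :
  slice (to_profinite g * u) ((val g : Aut) z) = slice u z.
Proof. by apply/esym/slice_eqP; exists g. Qed.

Lemma slice_surj G (x : solenoid G) : exists u z, x = slice u z.
Proof. by exists (repr x).2, (repr x).1; rewrite /slice -surjective_pairing /orbit_of reprK. Qed.

(** The base leaf is the image of every slice through an element of G. *)
Lemma slice_to_profinite G (g : subg_of G) z :
  slice (to_profinite g : hat G) z = slice 1 ((val g^-1 : Aut) z).
Proof.
apply/slice_eqP; exists g^-1; split => //.
by rewrite -to_profiniteM mulVg.
Qed.

Lemma slice_continuous G : continuous (fun p : disc * hat G => slice p.2 p.1).
Proof.
move=> p; rewrite (_ : (fun p => _) = orbit_of (solenoid_action G)).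
  exact: pi_continuous.
by apply/funext => -[z u].
Qed.

Lemma solenoid_action_continuous G h : continuous (solenoid_action G h).
Proof.
move=> [z u] A [[B D] [/= Bn Dn] BDA].
exists ((val h : Aut) @^-1` B, (fun v => to_profinite h * v) @^-1` D) => /=.
  split; first exact: (@aut_continuous R (val h) z B Bn).
  exact: (@profinite_mull_continuous _ (to_profinite h) u D Dn).
by move=> [z' u'] /= [Bz Du]; exact: BDA.
Qed.

Lemma solenoid_continuousP G (T : topologicalType) (f : solenoid G -> T) :
  continuous (fun p : disc * hat G => f (slice p.2 p.1)) -> continuous f.
Proof.
move=> fc; apply/quotient_continuous.
rewrite (_ : f \o _ = fun p : disc * hat G => f (slice p.2 p.1))//.
by apply/funext => -[z u].
Qed.

(** Being the image of all the slices through elements of G, the base leaf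
    inherits density from G in its completion. *)
Lemma base_leaf_dense G (A : set (solenoid G)) : closed A ->
  (forall z, A (slice 1 z)) -> A = setT.
Proof.
move=> cA A1; apply/seteqP; split=> // x _; have [u [z ->]] := slice_surj x.
suff : [set v : hat G | A (slice v z)] = setT by move=> H; rewrite -[A _]/([set v | A (slice v z)] u) H.
apply: profinite_closed_dense; last first.
  by move=> g /=; rewrite slice_to_profinite.
apply: (@closed_comp _ _ (fun v : hat G => slice v z)) => // v _ B Bn.
have [[D E] [/= Dn En] DEB] := @slice_continuous G (z, v) B Bn.
suff : nbhs v ((fun v : hat G => slice v z) @^-1` B) by [].
apply: filterS En => v' Ev'; apply: (DEB (z, v')); split => //=.
exact: nbhs_singleton Dn.
Qed.

(** A point of the solenoid has product neighbourhoods, the projection to an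
    orbit space being open. *)
Lemma slice_nbhs G (w : disc) (v : hat G) (A : set disc) N : nbhs w A ->
  nbhs (slice v w) [set x | exists b u, [/\ x = slice u b, A b & pcoord u N = pcoord v N]].
Proof.
move=> Aw.
pose W : set (disc * hat G) := [set p | A p.1 /\ pcoord p.2 N = pcoord v N].
rewrite nbhsE; exists (orbit_of (solenoid_action G) @` W°).
  split; first exact: orbit_of_open (@solenoid_action_continuous G) (open_interior _).
  exists (w, v) => //.
  exists (A, [set u | pcoord u N = pcoord v N]); last by move=> [].
  by split => //; apply/nbhs_profiniteP; exists N.
by move=> _ [[b u] /interior_subset [/= W1 W2] <-]; exists b, u.
Qed.

(** Two points over z and w are separated by proper discontinuity when no
    element of G sends z to w. Otherwise this element is unique, the action
    being free, and some finite quotient separates the transverse coordinates. *)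
Lemma solenoid_hausdorff G : fuchsian G -> torsion_free G -> hausdorff_space (solenoid G).
Proof.
move=> Gf Gtf x y; have [u [z ->]] := slice_surj x; have [v [w ->]] := slice_surj y.
move=> xy; apply: contrapT => zw.
have [e e0 He] := properly_discontinuous Gf z w.
have [N HN] : exists N, forall g : subg_of G, (val g : Aut) z = w ->
    pcoord (to_profinite g * u) N <> pcoord v N.
  have [[g0 g0z]|no] := pselect (exists g : subg_of G, (val g : Aut) z = w); last first.
    have [N _] := exists_fin_normal (subg_of G); exists N => g gz.
    by exfalso; apply: no; exists g.
  have /profinite_separated[N NE] : to_profinite g0 * u <> v.
    by move=> uv; apply: zw; apply/slice_eqP; exists g0.
  exists N => g gz; rewrite (_ : g = g0) //; apply: val_inj.
  have : (val g0)^-1 * val g = 1.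
    apply: (torsion_free_fixed_point Gf Gtf (z := z)).
      by apply: sgM; [apply: sgV; exact: set_valP|exact: set_valP].
    by rewrite aut_mulE gz -g0z autK.
  by move=> H; apply: (mulgI (val g0)^-1); rewrite H mulVg.
have bn (a : disc) : nbhs a [set a' | (phdist a a' < e)%R].
  by apply/nbhs_phdistP; exists e.
have [_ [[z' [u' [-> zz' uu']]] [w' [v' [/slice_eqP[g [w'E v'E]] ww' vv']]]]] :=
  xy _ _ (slice_nbhs u N (bn z)) (slice_nbhs v N (bn w)).
apply: (HN g); last by rewrite -vv' v'E !pcoordM uu'.
by apply: (He (val g) (set_valP g) z') => //; rewrite -w'E.
Qed.

Lemma finite_index_fundamental_ball H G (r : R) : H `<=` G -> finite_index H G ->
  (r < 1)%R -> (forall z : disc, exists2 g : Aut, sg_set G g & (cabs (dval (g z)) <= r)%R) ->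
  exists2 r' : R, (r' < 1)%R &
    forall z : disc, exists2 g : Aut, sg_set H g & (cabs (dval (g z)) <= r')%R.
Proof.
move=> HG /finite_indexP[s sP] r1 dom.
have [r' r'1 Hr'] : exists2 r' : R, (r' < 1)%R & forall (y : Aut), y \in s ->
    forall w : disc, (cabs (dval w) <= r)%R -> (cabs (dval ((y^-1%g : Aut) w)) <= r')%R.
  elim: (s) => [|y s' [r2 r21 IH]]; first by exists 0%R; rewrite ?ltr01.
  have [c [a [c1 a1 yE]]] := aut_mobius y^-1.
  have [r3 r31 H3] := mob_ball c1 a1 r1.
  exists (Num.max r2 r3); first by rewrite gt_max r21.
  move=> y'; rewrite inE => /orP[/eqP ->|/IH Hy] w wr; rewrite le_max.
    by rewrite yE H3// orbT.
  by rewrite Hy.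
exists r' => // z; have [g Gg gz] := dom z; have [y ys Hy] := sP g Gg.
exists (y^-1 * g) => //.
exact: Hr'.
Qed.

Lemma solenoid_compact H (r : R) : (r < 1)%R ->
  (forall z : disc, exists2 g : Aut, sg_set H g & (cabs (dval (g z)) <= r)%R) ->
  compact [set: solenoid H].
Proof.
move=> r1 dom.
have -> : [set: solenoid H] = (fun p : disc * hat H => slice p.2 p.1) @`
    ([set z : disc | (cabs (dval z) <= r)%R] `*` [set: hat H]).
  apply/seteqP; split=> // x _; have [u [z ->]] := slice_surj x.
  have [g Hg gz] := dom z; have [g' g'E] := inG Hg.
  exists ((val g' : Aut) z, to_profinite g' * u); first by split; rewrite //= g'E.
  exact: slice_act.
apply: continuous_compact; first exact/continuous_subspaceT/slice_continuous.
apply: compact_setX; first exact: compact_disc_ball.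
exact: profinite_compact.
Qed.

End SolenoidTopology.

(** * The action of the commensurator *)

Section Commensurator.
Variable R : realType.
Local Notation disc := (disc R).
Local Notation Aut := (Aut R).
Variable G : subgroup Aut.
Implicit Types (g h : Aut).

(** The subgroup G ∩ g^-1 G g, which conjugation by g keeps inside G. *)
Definition conj_domain g : subgroup Aut := subgI G (subgJ g^-1 G).

Lemma conj_domainP g x : sg_set (conj_domain g) x <-> sg_set G x /\ sg_set G (x ^ g^-1).
Proof. by []. Qed.

Lemma finite_index_subset (B : subgroup Aut) (C D : set Aut) : C `<=` D ->
  finite_index B D -> finite_index B C.
Proof.
by move=> CD; apply: sub_finite_set => _ [x Cx <-]; exists x => //; exact: CD.
Qed.

(** The two indices in the definition of commensurability, the one in the
    conjugate of G being transported to G by conjugation. *)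
Lemma ComAutP g : ComAut G g <->
  finite_index (conj_domain g) G /\ finite_index (conj_domain g^-1) G.
Proof.
have E : (subgJ g G : set Aut) `&` G = conj_domain g^-1.
  by rewrite setIC; apply/seteqP; split=> x [Gx]; rewrite /= invgK.
rewrite /ComAut /mkset /commensurable E; split=> -[].
  move=> /finite_indexP[s sP] fG; split => //.
  apply/finite_indexP; exists [seq y ^ g | y <- s] => x Gx.
  have [|y ys [Gy yx]] := sP (x ^ g^-1); first by rewrite /= -conjgM mulVg conjg1.
  exists (y ^ g); first by apply/mapP; exists y.
  have xE : (y ^ g)^-1 * x = (y^-1 * x ^ g^-1) ^ g.
    by rewrite conjMg conjVg -conjgM mulVg conjg1.
  split; first by move: yx; rewrite /= invgK xE.
  by rewrite /= xE -conjgM mulgV conjg1.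
move=> /finite_indexP[s sP] fG; split => //.
apply/finite_indexP; exists [seq y ^ g^-1 | y <- s] => x Gx.
have [y ys [Gy yx]] := sP (x ^ g) Gx.
exists (y ^ g^-1); first by apply/mapP; exists y.
have xE : (y ^ g^-1)^-1 * x = (y^-1 * x ^ g) ^ g^-1.
  by rewrite conjMg conjVg -conjgM mulgV conjg1.
split; first by rewrite xE.
by rewrite /= invgK xE -conjgM mulVg conjg1.
Qed.

Lemma conj_domain1 : finite_index (conj_domain 1) G.
Proof.
apply/finite_indexP; exists [:: 1] => x Gx; exists 1; first by rewrite inE.
by rewrite invg1 mul1g; split; rewrite //= invg1 conjg1.
Qed.

(** The subgroup for g is pulled back by conjugation by h. *)
Lemma conj_domainM g h : finite_index (conj_domain g) G ->
  finite_index (conj_domain h) G -> finite_index (conj_domain (g * h)) G.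
Proof.
move=> fg /finite_indexP[s sP].
pose K := conj_domain h^-1.
have KG : K `<=` G by move=> x [].
have fK : finite_index K K.
  by apply/finite_indexP; exists [:: 1] => x Kx; exists 1; rewrite ?inE// invg1 mul1g.
have /finite_indexP[s' s'P] := finite_indexI fK (finite_index_subset KG fg).
apply/finite_indexP; exists [seq y * y' ^ h | y <- s, y' <- s'] => x Gx.
have [y ys [Gyx hyx]] := sP x Gx; pose k := (y^-1 * x) ^ h^-1.
have khE : k ^ h = y^-1 * x by rewrite /k -conjgM mulVg conjg1.
have Kk : sg_set K k by split; rewrite //= invgK khE.
have [y' y's [[Gm hm] [_ gm]]] := s'P k Kk.
exists (y * y' ^ h); first by apply/allpairsP; exists (y, y').
have E : (y * y' ^ h)^-1 * x = (y'^-1 * k) ^ h.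
  by rewrite conjMg conjVg khE invgM mulgA.
move: hm; rewrite /= invgK => hm.
split; first by rewrite E.
by rewrite /= E invgM conjgM -(conjgM _ h) mulgV conjg1.
Qed.

Lemma ComAut1 : ComAut G 1.
Proof. by apply/ComAutP; rewrite invg1; split; exact: conj_domain1. Qed.

Lemma ComAutV g : ComAut G g -> ComAut G g^-1.
Proof. by move=> /ComAutP[? ?]; apply/ComAutP; rewrite invgK. Qed.

Lemma ComAutM g h : ComAut G g -> ComAut G h -> ComAut G (g * h).
Proof.
move=> /ComAutP[? ?] /ComAutP[? ?]; apply/ComAutP; split.
  exact: conj_domainM.
by rewrite invgM; exact: conj_domainM.
Qed.

End Commensurator.

Section QMap.
Variable R : realType.
Local Notation disc := (disc R).
Local Notation Aut := (Aut R).
Implicit Types (G H K : subgroup Aut).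

Lemma slice_map_continuous G H (f : hat H -> hat G) (h : disc -> disc) :
  continuous f -> continuous h ->
  continuous (fun p : disc * hat H => slice (f p.2) (h p.1)).
Proof.
move=> fc hc [z u] A An.
have [[B D] [/= Bn Dn] BDA] := @slice_continuous _ G (h z, f u) A An.
exists (h @^-1` B, f @^-1` D) => /=; first by split; [exact: hc|exact: fc].
by move=> [z' u'] [/= Bz Du]; apply: (BDA (h z', f u')).
Qed.

Variables (H G : subgroup Aut) (HG : H `<=` G).

Lemma incl_inj : injective (Defs.incl HG).
Proof. by move=> x y /(congr1 val) xy; exact: val_inj. Qed.

Lemma incl_cofinite : finite_index H G -> exists s : seq (subg_of G),
  forall x : subg_of G, exists2 y, y \in s & exists h : subg_of H, x = y * Defs.incl HG h.
Proof.
move=> /finite_indexP[s sP].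
exists [seq insubd (1 : subg_of G) y | y <- s] => x.
have [y ys Hyx] := sP (val x) (set_valP x).
have Gy : sg_set G y.
  rewrite (_ : y = val x * (y^-1 * val x)^-1); last by rewrite invgM invgK mulgA mulgV mul1g.
  by apply: sgM; [exact: set_valP|apply: sgV; exact: HG].
have yE : val (insubd (1 : subg_of G) y) = y.
  by rewrite val_insubd ifT//; exact: mem_set.
exists (insubd 1 y); first by apply/mapP; exists y.
have [h hE] := inG Hyx; exists h; apply: val_inj.
by rewrite /= yE hE mulgA mulgV mul1g.
Qed.

Lemma Q_map_continuous : continuous (Q_map HG).
Proof.
apply: solenoid_continuousP.
rewrite (_ : (fun p => _) = fun p : disc * hat H => slice (profinite_map (Defs.incl HG) p.2) p.1).
  apply: (@slice_map_continuous _ _ (profinite_map (Defs.incl HG)) id).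
    exact: profinite_map_continuous.
  by move=> z; exact: cvg_id.
by apply/funext => p; rewrite Q_mapE.
Qed.

Hypothesis fin : finite_index H G.

Lemma Q_map_inj : injective (Q_map HG).
Proof.
have [s sP] := incl_cofinite fin.
move=> x y; have [u [z ->]] := slice_surj x; have [v [w ->]] := slice_surj y.
rewrite !Q_mapE => /slice_eqP[g [wE vE]].
have : profinite_map (Defs.incl HG) (v * u^-1) = to_profinite g.
  apply: (mulIg (profinite_map (Defs.incl HG) u)).
  by rewrite -profinite_mapM -mulgA mulVg mulg1 vE.
move=> /(profinite_map_to_image sP)[h hE].
apply/slice_eqP; exists h; split; first by rewrite wE -hE.
apply: (profinite_map_inj incl_inj sP).
by rewrite vE profinite_mapM profinite_map_to hE.
Qed.

Lemma Q_map_surj y : exists u z, y = Q_map HG (slice u z).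
Proof.
have [s sP] := incl_cofinite fin.
have [v [w ->]] := slice_surj y.
have [g [u vE]] := profinite_map_cofinite sP v.
exists u, ((val g^-1 : Aut) w); rewrite Q_mapE vE -[RHS](slice_act _ g).
by congr slice; rewrite (autVK (val g)).
Qed.

End QMap.

Section HinftyFacts.
Variable R : realType.
Local Notation disc := (disc R).
Local Notation Aut := (Aut R).
Variable G : subgroup Aut.
Hypotheses (Gf : fuchsian G) (Gtf : torsion_free G) (Gc : cocompact G).
Implicit Types (g h : Aut).

Let slice1 : disc -> solenoid G := slice 1.

Lemma to_profinite_inj : injective (@to_profinite (subg_of G)).
Proof.
move=> x y xy; apply: contrapT => nxy.
have [|N] := @fuchsian_residually_finite R G Gf Gc (x^-1 * y).
  by move=> H; apply: nxy; apply: (mulgI x^-1); rewrite H mulVg.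
by apply; apply/to_profinite_eq; rewrite xy.
Qed.

(** Residual finiteness of G makes the base leaf a copy of the disc, rather than
    of a quotient of it. *)
Lemma slice1_inj : injective slice1.
Proof.
move=> z w /slice_eqP[g [-> g1]].
have -> : g = 1; last by [].
by apply: to_profinite_inj; rewrite -[RHS]/(1 : hat G) g1 mulg1.
Qed.

Lemma fundamental_ball_domain g : finite_index (conj_domain G g) G ->
  exists2 r : R, (r < 1)%R & forall z : disc,
    exists2 h : Aut, sg_set (conj_domain G g) h & (cabs (dval (h z)) <= r)%R.
Proof.
move=> fg; have [r r1 dom] := fundamental_ball Gc.
exact: finite_index_fundamental_ball (@subgIl _ G _) fg r1 dom.
Qed.

Section One.
Variable g : Aut.
Hypothesis gC : ComAut G g.
Let H := conj_domain G g.
Let Q := Q_map (@subgIl _ G (subgJ g^-1 G)).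
Let Qinv : solenoid G -> solenoid H := pinv setT Q.

Let fin : finite_index H G. Proof. by have [] := (ComAutP G g).1 gC. Qed.

Let QinvK : cancel Q Qinv.
Proof.
move=> x; apply: pinvKV; last by rewrite inE.
by move=> y z _ _; exact: Q_map_inj.
Qed.

Let QK : cancel Qinv Q.
Proof.
move=> y; apply: pinvK; rewrite inE; have [u [z ->]] := Q_map_surj (@subgIl _ G _) fin y.
by exists (slice u z).
Qed.

Let Qinv_continuous : continuous Qinv.
Proof.
have [r r1 dom] := fundamental_ball_domain fin.
apply: compact_inverse_continuous QinvK QK.
- exact: solenoid_compact r1 dom.
- exact: solenoid_hausdorff.
- exact: Q_map_continuous.
Qed.

Lemma Hinfty_slice (u : hat H) z : Hinfty G g (Q (slice u z)) =
  slice (profinite_map (Defs.incl (@subgIl _ G (subgJ g G)))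
    (profinite_map (conj_hom (@Hinfty_conj R G g)) u)) (g z).
Proof. by rewrite /Hinfty /= -/Qinv QinvK PsiE Q_mapE. Qed.

Lemma Hinfty_continuous : continuous (Hinfty G g).
Proof.
have Pc : continuous (@Psi R G g).
  apply: solenoid_continuousP.
  rewrite (_ : (fun p => _) = fun p : disc * hat H =>
      slice (profinite_map (conj_hom (@Hinfty_conj R G g)) p.2) (g p.1)).
    apply: slice_map_continuous; first exact: profinite_map_continuous.
    exact: aut_continuous.
  by apply/funext => p; rewrite PsiE.
move=> x; apply: (@continuous_comp _ _ _ (@Psi R G g \o Qinv)); last exact: Q_map_continuous.
by apply: continuous_comp; [exact: Qinv_continuous|exact: Pc].
Qed.

Lemma Hinfty_base z : Hinfty G g (slice1 z) = slice1 (g z).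
Proof.
have m1 (A B : groupType) (f : {multiplicative A -> B}) :
    profinite_map f (1 : profinite A) = 1.
  by rewrite -[1 in LHS]/(to_profinite 1) profinite_map_to multiplicative1.
have -> : slice1 z = Q (slice 1 z) by rewrite /Q Q_mapE m1.
by rewrite Hinfty_slice !m1.
Qed.

Lemma Hinfty_leafwise : leafwise_holomorphic (Hinfty G g).
Proof.
move=> v; have [s sP] := incl_cofinite (@subgIl _ G _) fin.
have [y [u vE]] := profinite_map_cofinite sP v.
eexists; exists (aut_fun g \o aut_fun ((val y)^-1)%g); split; last first.
  move=> z; have -> : slice v z = Q (slice u (((val y)^-1 : Aut) z)).
    rewrite /Q Q_mapE vE -[RHS](slice_act _ y); congr slice.
    by rewrite (autVK (val y)).
  exact: Hinfty_slice.
apply: holomorphic_comp; first by have [] := aut_biholomorphic g.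
by have [] := aut_biholomorphic (val y)^-1.
Qed.

End One.

(** The base leaf is dense and the solenoid is Hausdorff. *)
Lemma continuous_eq_base (F F' : solenoid G -> solenoid G) :
  continuous F -> continuous F' -> (forall z, F (slice1 z) = F' (slice1 z)) -> F = F'.
Proof.
move=> Fc F'c FF'.
have := base_leaf_dense (closed_equalizer (solenoid_hausdorff Gf Gtf) Fc F'c) FF'.
by move=> FT; apply/funext => x; have : [set: solenoid G] x by []; rewrite -FT.
Qed.

Lemma HinftyM g h : ComAut G g -> ComAut G h ->
  Hinfty G (g * h) = Hinfty G g \o Hinfty G h.
Proof.
move=> gC hC; apply: continuous_eq_base.
- exact/Hinfty_continuous/ComAutM.
- by move=> x; apply: continuous_comp; exact: Hinfty_continuous.
- by move=> z; rewrite /= !Hinfty_base//; exact: ComAutM.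
Qed.

Lemma Hinfty1 : Hinfty G 1 = id.
Proof.
apply: continuous_eq_base; first exact/Hinfty_continuous/ComAut1.
- by move=> x; exact: cvg_id.
- by move=> z; rewrite Hinfty_base//; exact: ComAut1.
Qed.

Lemma Hinfty_hol_homeo g : ComAut G g -> hol_homeo_base G (Hinfty G g).
Proof.
move=> gC; have gVC := ComAutV gC; split; last 1 first.
- apply/seteqP; split=> [_ [_ [z _ <-] <-]|_ [z _ <-]].
    by exists (g z) => //; rewrite -[LHS]Hinfty_base.
  exists (slice1 ((g^-1 : Aut) z)); first by exists ((g^-1 : Aut) z).
  by rewrite Hinfty_base// autVK.
- split; first exact: Hinfty_continuous.
  exists (Hinfty G g^-1); split; first exact: Hinfty_continuous.
    by move=> x; have := congr1 (@^~ x) (HinftyM gVC gC); rewrite mulVg Hinfty1.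
  by move=> x; have := congr1 (@^~ x) (HinftyM gC gVC); rewrite mulgV Hinfty1.
- exact: Hinfty_leafwise.
Qed.

Lemma Hinfty_inj g h : ComAut G g -> ComAut G h -> Hinfty G g = Hinfty G h -> g = h.
Proof.
move=> gC hC gh; apply: aut_eq => z; apply: slice1_inj.
by rewrite -!Hinfty_base// gh.
Qed.

End HinftyFacts.

(** * Homeomorphisms preserving the base leaf *)

Section LeafTopology.
Variable R : realType.
Local Notation disc := (disc R).
Local Notation Aut := (Aut R).
Variable G : subgroup Aut.
Hypotheses (Gf : fuchsian G) (Gtf : torsion_free G) (Gc : cocompact G).
Implicit Types (g h : subg_of G).

Let slice1 : disc -> solenoid G := slice 1.
Local Notation act g := (aut_fun (val g)).

Lemma actM (g h : subg_of G) z : act (g * h) z = act g (act h z). Proof. by []. Qed.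
Lemma actK (g : subg_of G) : cancel (act g) (act g^-1).
Proof. by move=> z; rewrite -actM mulVg. Qed.
Lemma actVK (g : subg_of G) : cancel (act g^-1) (act g).
Proof. by move=> z; rewrite -actM mulgV. Qed.

Lemma slice1_continuous : continuous slice1.
Proof.
move=> z A An; have [[D E] [/= Dn En] DEA] := @slice_continuous R G (z, 1) A An.
suff : nbhs z (slice1 @^-1` A) by [].
by apply: filterS Dn => z' Dz'; apply: (DEA (z', 1)); split => //=; exact: nbhs_singleton En.
Qed.

Lemma free_action_radius : exists2 e : R, (0 < e)%R & forall g z, (phdist z (act g z) < e)%R -> g = 1.
Proof.
have [r r1 dom] := fundamental_ball Gc.
have [e e0 He] := injectivity_radius Gf Gtf r1 dom.
exists e => // g z gz; apply: contrapT => g1.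
have : (e <= phdist z (act g z))%R.
  by apply: He; [exact: set_valP|move=> H; apply: g1; exact: val_inj].
by rewrite leNgt gz.
Qed.

Lemma unique_translate (e : R) : (forall g z, (phdist z (act g z) < e)%R -> g = 1) ->
  forall (d : R) g h x y, (d <= 2^-1)%R -> (3 * d <= e)%R ->
  (phdist x (act g y) < d)%R -> (phdist x (act h y) < d)%R -> g = h.
Proof.
move=> He d g h x y d2 d3 xg xh.
have H := lt_le_trans (phdist_tri d2 xg xh) d3.
have : h * g^-1 = 1.
  by apply: (He _ (act g y)); rewrite actM actK.
by move=> E; apply/esym; apply: (mulIg g^-1); rewrite E mulgV.
Qed.

(** The leaf topology is finer than that of the solenoid: a neighbourhood of F
    (slice1 w0) meets the base leaf in many discs, which are indexed by G. Along
    a path the coset modulo N of the index of the disc containing f w is locally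
    constant, for each N; by residual finiteness the index itself does not
    change. *)
Lemma leaf_continuous (F : solenoid G -> solenoid G) (f : disc -> disc) :
  continuous F -> (forall z, F (slice1 z) = slice1 (f z)) -> continuous f.
Proof.
move=> Fc Ff w0 A /nbhs_phdistP[e1 e10 HA].
have [e0 e00 He0] := free_action_radius.
pose e := Num.min e1 (Num.min 2^-1 (e0 / 3))%R.
have e_gt0 : (0 < e)%R by rewrite !lt_min e10 invr_gt0 ltr0n divr_gt0.
have ee1 : (e <= e1)%R by rewrite ge_min lexx.
have e2 : (e <= 2^-1)%R by rewrite !ge_min lexx orbT.
have e3 : (3 * e <= e0)%R.
  by have : (e <= e0 / 3)%R by [rewrite !ge_min lexx !orbT]; lra.
pose y0 := f w0.
have uniq g h y : (phdist y0 (act g y) < e)%R -> (phdist y0 (act h y) < e)%R -> g = h.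
  exact: unique_translate He0 _ _ _ _ _ e2 e3.
(* near y, some translate of f falls in the disc around y0, the coset modulo N of
   the translating element being constant *)
have loc (N : fin_normal (subg_of G)) y g : (phdist y0 (act g (f y)) < e)%R ->
    nbhs y [set y' | exists2 g', (phdist y0 (act g' (f y')) < e)%R & sg_set N (g^-1 * g')].
  move=> gy.
  have FB := slice_nbhs (to_profinite g) N (phdist_near gy).
  have yE : F (slice1 y) = slice (to_profinite g) (act g (f y)).
    by rewrite Ff -[LHS](slice_act _ g) mulg1.
  rewrite -yE in FB.
  have FB' : nbhs y (slice1 @^-1` (F @^-1` _)) := slice1_continuous (Fc _ _ FB).
  apply: filterS FB' => y' [b [u []]].
  rewrite Ff => /slice_eqP[g' [-> ->]]; rewrite mulg1 => gb gu.
  by exists g' => //; apply/to_profinite_eq.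
have w0e : (phdist y0 (act (1 : subg_of G)%g (f w0)) < e)%R by rewrite -[act _ _]/y0 phdistxx.
have [N0 _] := exists_fin_normal (subg_of G).
have /nbhs_discP[d d0 Hd] := loc N0 w0 1 w0e.
apply/nbhs_discP; exists d => // w wd; have [g gw _] := Hd w wd.
have gN (N : fin_normal (subg_of G)) : sg_set N g.
  suff [g' g'w Ng'] : exists2 g', (phdist y0 (act g' (f w)) < e)%R & sg_set N g'.
    by rewrite (uniq _ _ _ gw g'w).
  apply: (@segment_induction _ w0 w
    [set y | exists2 g', (phdist y0 (act g' (f y)) < e)%R & sg_set N g']).
    by exists 1 => //; exact: sg1.
  move=> y [t /andP[t0 t1] yt]; have [|h hy _] := Hd y.
    rewrite yt addrC addKr cabsM cabs_real ger0_norm//; apply: le_lt_trans wd.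
    by rewrite ler_piMl// cabs_ge0.
  split=> [[g' g'y Ng']|nA].
    apply: filterS (loc N y g' g'y) => y' [g'' g''y' Ng'']; exists g'' => //.
    by rewrite -(mulVKg g' g''); exact: sgM.
  apply: filterS (loc N y h hy) => y' [h' h'y' Nh'] [g' g'y' Ng']; apply: nA.
  exists h => //; rewrite (_ : h = g' * (h^-1 * h')^-1); first by apply: sgM => //; exact: sgV.
  by rewrite (uniq _ _ _ g'y' h'y') invgM invgK mulVKg.
apply: HA; apply: lt_le_trans ee1; rewrite -/y0 (_ : f w = act g (f w))//.
have -> : g = 1; last by [].
apply: contrapT => /(@fuchsian_residually_finite R G Gf Gc)[N]; exact.
Qed.

End LeafTopology.

Section Rigidity.
Variable R : realType.
Local Notation disc := (disc R).
Local Notation Aut := (Aut R).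
Variable G : subgroup Aut.
Hypotheses (Gf : fuchsian G) (Gtf : torsion_free G) (Gc : cocompact G).
Implicit Types (g h : subg_of G).

Let slice1 : disc -> solenoid G := slice 1.
Local Notation act g := (aut_fun (val g)).

(** Since the inverse of F preserves the base leaf too, F restricts to an
    injective holomorphic map of the disc, with an inverse which is continuous
    by [leaf_continuous]. So the restriction is proper, hence an automorphism. *)
Lemma base_restriction (F : solenoid G -> solenoid G) : hol_homeo_base G F ->
  exists (F' : solenoid G -> solenoid G) (phi : Aut), [/\ continuous F, continuous F',
    forall z, F (slice1 z) = slice1 (phi z) &
    forall z, F' (slice1 z) = slice1 ((phi^-1 : Aut) z)].
Proof.
move=> [[Fc [F' [F'c FK F'K]]] hol base].
have [v [f0 [f0h Ff0]]] := hol 1.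
have : base_leaf G (F (slice1 (disc_zero R))).
  by rewrite -base; exists (slice1 (disc_zero R)) => //; exists (disc_zero R).
move=> [z _]; rewrite Ff0 => /slice_eqP[g [_ vE]]; rewrite mulg1 in vE.
pose f : disc -> disc := aut_fun (val g^-1) \o f0.
have Ff x : F (slice1 x) = slice1 (f x) by rewrite Ff0 vE slice_to_profinite.
have fh : holomorphic f.
  by apply: holomorphic_comp f0h; have [] := aut_biholomorphic (val g^-1).
have /choice[q Fq] x : exists y, F' (slice1 x) = slice1 y.
  have : base_leaf G (slice1 x) by exists x.
  by rewrite -base => -[_ [y _ <-] <-]; exists y; rewrite FK.
have fK : cancel f q.
  by move=> x; apply: (slice1_inj Gf Gc); rewrite -/(slice1 _) -/(slice1 x) -Fq -Ff FK.
have qc : continuous q := leaf_continuous Gf Gtf Gc F'c Fq.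
have fb := proper_aut fh (can_inj fK) (continuous_inverse_proper qc fK).
exists F', (to_aut fb); split => // x; rewrite Fq; congr slice1.
have qK : f (q x) = x by apply: (slice1_inj Gf Gc); rewrite -/(slice1 _) -/(slice1 x) -Ff -Fq F'K.
by rewrite -{2}qK -[f (q x)]/(to_aut fb (q x)) autK.
Qed.

(** A small transverse translation moves the values of F by little, uniformly
    because the solenoid is covered by the product of a closed ball with a
    profinite group. Seen from the base leaf, translating z by an element of a
    small N is such a translation, followed by an element of G. *)
Lemma leaf_uniformly_close (F : solenoid G -> solenoid G) (f : disc -> disc) (e : R) :
  continuous F -> (forall z, F (slice1 z) = slice1 (f z)) -> (0 < e <= 2^-1)%R ->
  exists N : fin_normal (subg_of G), forall h, sg_set N h ->
    forall z, exists g, (phdist (f (act h z)) (act g (f z)) < 3 * e)%R.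
Proof.
move=> Fc Ff /andP[e0 e2]; have [r r1 dom] := fundamental_ball Gc.
pose close (p q : solenoid G) := exists w z1 v1 z2 v2,
  [/\ p = slice v1 z1, q = slice v2 z2, (phdist w z1 < e)%R & (phdist w z2 < e)%R].
have cK : compact ([set z : disc | (cabs (dval z) <= r)%R] `*` [set: hat G]).
  by apply: compact_setX; [exact: compact_disc_ball|exact: profinite_compact].
pose P (u : hat G) (p : disc * hat G) :=
  close (F (slice p.2 p.1)) (F (slice (p.2 * u) p.1)).
suff loc : forall p, ([set z : disc | (cabs (dval z) <= r)%R] `*` [set: hat G]) p ->
    \forall p' \near p & u \near (1 : hat G), P u p'.
  have Pn : nbhs (1 : hat G) [set u | forall p, (cabs (dval p.1) <= r)%R -> P u p].
    have := (compact_near_coveringP _).1 cK _ (nbhs (1 : hat G)) P (nbhs_filter _) loc.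
    by apply: filterS => u uP p pr; apply: uP.
  have [N HN] := (nbhs_profiniteP _ _).1 Pn.
  exists N => h Nh z.
  have [k Gk kz] := dom z; have [k' k'E] := inG Gk.
  have hN : pcoord (to_profinite h^-1) N = pcoord (1 : hat G) N.
    by apply/to_profinite_eq; rewrite mulg1 invgK.
  have [|w [z1 [v1 [z2 [v2 [F1 F2 w1 w2]]]]]] := HN _ hN (act k' z, to_profinite k').
    by rewrite /= k'E.
  have E1 : slice (to_profinite k' : hat G) (act k' z) = slice1 z.
    by rewrite slice_to_profinite actK.
  have E2 : slice (to_profinite k' * to_profinite h^-1 : hat G) (act k' z) = slice1 (act h z).
    by rewrite -[LHS](slice_act _ k'^-1) mulgA -to_profiniteM mulVg mul1g slice_to_profinite
      invgK actK.
  move: F1 F2; rewrite /= E1 E2 !Ff => /slice_eqP[g1 [z1E _]] /slice_eqP[g2 [z2E _]].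
  exists (g2^-1 * g1); rewrite actM -z1E -(phdist_aut (val g2)) -z2E actVK.
  exact: phdist_tri e2 w2 w1.
move=> [z0 v0] _; have [va [w Fw]] := slice_surj (F (slice v0 z0)).
have [N0 _] := exists_fin_normal (subg_of G).
have wn : nbhs w [set b | (phdist w b < e)%R] by apply/nbhs_phdistP; exists e.
have Fn := slice_nbhs va N0 wn; rewrite -Fw in Fn; have {}Fn := Fc _ _ Fn.
have [[D E] [/= Dn /nbhs_profiniteP[M ME]] DEB] := @slice_continuous R G (z0, v0) _ Fn.
have key z v : D z -> pcoord v M = pcoord v0 M ->
    exists z1 v1, F (slice v z) = slice v1 z1 /\ (phdist w z1 < e)%R.
  by move=> Dz vM; have [z1 [v1 [? ? _]]] := DEB (z, v) (conj Dz (ME v vM)); exists z1, v1.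
exists ((D `*` [set v | pcoord v M = pcoord v0 M]), [set u | pcoord u M = pcoord (1 : hat G) M]).
  split => /=; last by apply/nbhs_profiniteP; exists M.
  by exists (D, [set v | pcoord v M = pcoord v0 M]) => //; split => //; apply/nbhs_profiniteP; exists M.
move=> [[z v] u] [/= [Dz vM] uM].
have [z1 [v1 [? ?]]] := key z v Dz vM.
have [|z2 [v2 [? ?]]] := key z (v * u) Dz; first by rewrite pcoordM uM -pcoordM mulg1.
by exists w, z1, v1, z2, v2.
Qed.

(** An automorphism which is everywhere close to the discrete group is in it:
    the element g close to k at z is unique, so it does not depend on z, and
    g^-1 * k has bounded displacement. The powers of 3 come from repeated use of
    [phdist_tri]. *)
Lemma close_to_group (k : Aut) (e e0 : R) : (27 * e <= 2^-1)%R -> (81 * e <= e0)%R ->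
  (forall g z, (phdist z (act g z) < e0)%R -> g = 1) ->
  (forall z, exists g, (phdist (k z) (act g z) < 3 * e)%R) -> sg_set G k.
Proof.
move=> e1 e2 He kg.
have [g0 g0z] := kg (disc_zero R).
have e_gt0 : (0 < e)%R by have := phdist_ge0 (k (disc_zero R)) (act g0 (disc_zero R)); lra.
have loc y y' g g' : (phdist y y' < e)%R -> (phdist (k y) (act g y) < 3 * e)%R ->
    (phdist (k y') (act g' y') < 3 * e)%R -> g = g'.
  move=> yy' gy g'y'.
  have K1 : (phdist (k y') (act g y) < 9 * e)%R.
    rewrite (_ : 9 * e = 3 * (3 * e))%R; last by ring.
    by apply: (phdist_tri (x := k y)) gy; rewrite ?phdist_aut; lra.
  have K2 : (phdist (k y') (act g y') < 27 * e)%R.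
    rewrite (_ : 27 * e = 3 * (9 * e))%R; last by ring.
    apply: (phdist_tri (x := act g y)); first lra; first by rewrite phdistC.
    by rewrite phdist_aut; lra.
  apply: (unique_translate He (d := (27 * e)%R) (x := k y') (y := y')) => //; lra.
have all y : (phdist (k y) (act g0 y) < 3 * e)%R.
  apply: (@segment_induction _ (disc_zero R) y [set y | (phdist (k y) (act g0 y) < 3 * e)%R]) => //.
  move=> {}y _; split=> [gy|ngy]; apply/nbhs_phdistP; exists e => // y' yy' /=.
    by have [g' g'y'] := kg y'; rewrite (loc _ _ _ _ yy' gy g'y').
  by move=> gy'; have [g gy] := kg y; apply: ngy; rewrite /= -(loc _ _ _ _ yy' gy gy').
have : (val g0)^-1 * k = 1.
  apply: (@bounded_displacement R _ (3 * e)); first lra.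
  move=> z; rewrite -(phdist_aut (val g0)) aut_mulE autVK phdistC.
  exact: ltW.
move=> H; rewrite (_ : k = val g0); first exact: set_valP.
by apply: (mulgI (val g0)^-1); rewrite H mulVg.
Qed.

(** For h in a small normal subgroup N of finite index, phi * h * phi^-1 is
    everywhere close to G, hence in G: N is contained in the subgroup whose
    index is to be bounded. *)
Lemma conj_domain_finite_index (F : solenoid G -> solenoid G) (phi : Aut) :
  continuous F -> (forall z, F (slice1 z) = slice1 (phi z)) ->
  finite_index (conj_domain G phi) G.
Proof.
move=> Fc Ff; have [e0 e00 He0] := free_action_radius Gf Gtf Gc.
pose e : R := Num.min (54^-1)%R (e0 / 81)%R.
have e_gt0 : (0 < e)%R by rewrite lt_min invr_gt0 ltr0n divr_gt0.
have e1 : (e <= 54^-1)%R by rewrite ge_min lexx.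
have e2 : (e <= e0 / 81)%R by rewrite ge_min lexx orbT.
have [|N HN] := leaf_uniformly_close Fc Ff (e := e); first by apply/andP; split; lra.
have /finite_indexP[s sP] := fin_normal_index N.
apply/finite_indexP; exists (map val s) => x Gx; have [x' x'E] := inG Gx.
have [y ys Nyx] := sP x' I; exists (val y); first exact: map_f.
rewrite -x'E; apply/conj_domainP; split; first exact: (set_valP (y^-1 * x')).
apply: (close_to_group (e := e) (e0 := e0)) => //; [lra|lra|].
move=> z; have [g] := HN _ Nyx ((phi^-1 : Aut) z).
by rewrite autVK => gz; exists g; rewrite conjgE invgK !aut_mulE.
Qed.

Lemma Hinfty_surj F : hol_homeo_base G F -> exists2 g : Aut, ComAut G g & Hinfty G g = F.
Proof.
move=> /base_restriction[F' [phi [Fc F'c Ff F'f]]].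
have phiC : ComAut G phi.
  by apply/ComAutP; split; [exact: conj_domain_finite_index Fc Ff|exact: conj_domain_finite_index F'c F'f].
exists phi => //; apply: (continuous_eq_base Gf Gtf) => //.
  exact: Hinfty_continuous.
by move=> z; rewrite Hinfty_base.
Qed.

End Rigidity.

Theorem proposition4p12 (R : realType) (G : subgroup (Aut R))
    (G_fuchsian : fuchsian G) (G_torsion_free : torsion_free G)
    (G_cocompact : cocompact G) :
  set_bij (ComAut G) (hol_homeo_base G) (Hinfty G) /\
  (forall g h : Aut R, ComAut G g -> ComAut G h ->
     Hinfty G (g * h)%g = Hinfty G g \o Hinfty G h).
Proof.
split; last by move=> g h; exact: HinftyM.
split.
- by move=> g; exact: Hinfty_hol_homeo.
- by move=> g h /set_mem gC /set_mem hC; exact: Hinfty_inj.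
- by move=> F /Hinfty_surj[]// g; exists g.
Qed.
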